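(* Let $A_\Gamma$ be an Artin group in the class $\mathcal{B}$, that is, such that for each free of infinity subset $Y\subset V(\Gamma)$ and for all parabolic subgroups $P_1,P_2$ of $A_Y$, the intersection $P_1\cap P_2$ is a parabolic subgroup of $A_Y$. Let $H\subset A_\Gamma$ be a subgroup. If $H$ is an $\mathrm{F}\mathcal{C}'$-group, then $H$ is contained in a complete parabolic subgroup of $A_\Gamma$.
   Context: Let $\Gamma$ be a finite non-empty simplicial graph with vertex set $V(\Gamma)$, edge set $E(\Gamma)$ and an edge-labeling $m\colon E(\Gamma)\to\{2,3,4,\ldots\}$. The Artin group $A_\Gamma$ is the group with generating set $V(\Gamma)$ and relations $vwv\cdots = wvw\cdots$ (both sides alternating words with $m(\{v,w\})$ letters) for each $\{v,w\}\in E(\Gamma)$. For $X\subset V(\Gamma)$, $A_X$ denotes the subgroup of $A_\Gamma$ generated by $X$ (trivial if $X=\emptyset$); it is canonically isomorphic to the Artin group of the induced labeled subgraph $\langle X\rangle$ (van der Lek). A parabolic subgroup of $A_\Gamma$ is a conjugate $gA_Xg^{-1}$ with $g\in A_\Gamma$, $X\subset V(\Gamma)$; parabolic subgroups of $A_Y$ are the subgroups $gA_Xg^{-1}$ with $g\in A_Y$, $X\subset Y$. A subset $X\subset V(\Gamma)$ is free of infinity if $\{v,w\}\in E(\Gamma)$ for all distinct $v,w\in X$. A complete parabolic subgroup is a conjugate $gA_Xg^{-1}$ with $X$ free of infinity. A group $G$ is an $\mathrm{F}\mathcal{C}'$-group if every cellular action of $G$ on a finite dimensional $\mathrm{CAT}(0)$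 cube complex is locally elliptic, i.e. every element of $G$ has a fixed point. *)

(* Defs.v *)
From HB Require Import structures.
From mathcomp Require Import all_boot all_order all_algebra generic_quotient.
From mathcomp Require Import all_classical all_reals.

Set Implicit Arguments.
Unset Strict Implicit.
Unset Printing Implicit Defensive.
Import Order.TTheory GRing.Theory Num.Theory.

Local Open Scope classical_set_scope.
Local Open Scope quotient_scope.
Local Open Scope ring_scope.

(** * Groups given by generators and relations *)

Section Presentation.
Context {S : choiceType}.

(* The letter (s, true) stands for s and (s, false) for s^-1. *)
Definition word := seq (S * bool).

Variable rel : word -> word -> Prop.

Inductive word_eq : word -> word -> Prop :=
| WordRefl u : word_eq u u
| WordSym u v : word_eq u v -> word_eq v u
| WordTrans u v w : word_eq u v -> word_eq v w -> word_eq u w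
| WordCat u u' v v' : word_eq u u' -> word_eq v v' -> word_eq (u ++ v) (u' ++ v')
| WordCancel s b : word_eq [:: (s, b); (s, ~~ b)] [::]
| WordRel u v : rel u v -> word_eq u v.

Definition word_eqb (u v : word) : bool := `[< word_eq u v >].

Lemma word_eqb_refl : reflexive word_eqb.
Proof. by move=> u; apply/asboolP; exact: WordRefl. Qed.

Lemma word_eqb_sym : symmetric word_eqb.
Proof. by move=> u v; apply/asboolP/asboolP; exact: WordSym. Qed.

Lemma word_eqb_trans : transitive word_eqb.
Proof.
move=> v u w /asboolP uv /asboolP vw; apply/asboolP; exact: WordTrans uv vw.
Qed.

Canonical word_equiv := EquivRel word_eqb word_eqb_refl word_eqb_sym word_eqb_trans.

Definition presented_group := {eq_quot word_equiv}.
HB.instance Definition _ := Choice.on presented_group.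

Definition word_class (u : word) : presented_group := \pi_({eq_quot word_equiv})%qT u.

Lemma word_classP u v : word_class u = word_class v <-> word_eq u v.
Proof.
split=> [/eqmodP /asboolP //|uv]; exact/eqmodP/asboolP.
Qed.

Definition word_repr (x : presented_group) : word := repr x.

Lemma word_reprK x : word_class (word_repr x) = x.
Proof. exact: reprK. Qed.

Lemma word_repr_class u : word_eq (word_repr (word_class u)) u.
Proof. by apply/word_classP; rewrite word_reprK. Qed.

Definition word_inv (u : word) : word := rev [seq (a.1, ~~ a.2) | a <- u].

Lemma word_inv_cat u v : word_inv (u ++ v) = word_inv v ++ word_inv u.
Proof. by rewrite /word_inv map_cat rev_cat. Qed.

Lemma word_invK : involutive word_inv.
Proof.
move=> u; rewrite /word_inv map_rev revK -map_comp map_id_in // => -[s b] _ /=.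
by rewrite negbK.
Qed.

Lemma word_mulV u : word_eq (u ++ word_inv u) [::].
Proof.
elim: u => [|[s b] u IHu]; first exact: WordRefl.
rewrite /word_inv map_cons rev_cons -cats1 -/(word_inv u).
rewrite -[(s, b) :: u]cat1s -catA (catA u).
apply: (WordTrans (v := [:: (s, b)] ++ ([::] ++ [:: (s, ~~ b)]))).
  by apply: WordCat (WordRefl _) (WordCat IHu (WordRefl _)).
exact: WordCancel.
Qed.

Lemma word_mulVl u : word_eq (word_inv u ++ u) [::].
Proof. by rewrite -{2}[u]word_invK; apply: word_mulV. Qed.

Lemma word_inv_eq u v : word_eq u v -> word_eq (word_inv u) (word_inv v).
Proof.
move=> uv; apply: (WordTrans (v := word_inv u ++ (v ++ word_inv v))).
  rewrite -[X in word_eq X _]cats0.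
  exact: WordCat (WordRefl _) (WordSym (word_mulV v)).
rewrite catA -[X in word_eq _ X]cat0s; apply: WordCat (WordRefl _).
apply: WordTrans (word_mulVl u).
exact: WordCat (WordRefl _) (WordSym uv).
Qed.

Definition presented_one : presented_group := word_class [::].
Definition presented_mul (x y : presented_group) : presented_group :=
  word_class (word_repr x ++ word_repr y).
Definition presented_inv (x : presented_group) : presented_group :=
  word_class (word_inv (word_repr x)).

Lemma word_classM u v :
  presented_mul (word_class u) (word_class v) = word_class (u ++ v).
Proof. apply/word_classP; exact: WordCat (word_repr_class _) (word_repr_class _). Qed.

Lemma word_classV u : presented_inv (word_class u) = word_class (word_inv u).
Proof. apply/word_classP; exact/word_inv_eq/word_repr_class. Qed.

Lemma presented_mulA : associative presented_mul.
Proof.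
move=> x y z; rewrite -[x]word_reprK -[y]word_reprK -[z]word_reprK.
by rewrite !word_classM catA.
Qed.

Lemma presented_mul1 : left_id presented_one presented_mul.
Proof. by move=> x; rewrite -[x]word_reprK word_classM. Qed.

Lemma presented_mulr1 : right_id presented_one presented_mul.
Proof. by move=> x; rewrite -[x]word_reprK word_classM cats0. Qed.

Lemma presented_mulV : left_inverse presented_one presented_inv presented_mul.
Proof.
move=> x; rewrite -[x]word_reprK word_classV word_classM.
apply/word_classP; exact: word_mulVl.
Qed.

Lemma presented_mulrV : right_inverse presented_one presented_inv presented_mul.
Proof.
move=> x; rewrite -[x]word_reprK word_classV word_classM.
apply/word_classP; exact: word_mulV.
Qed.

HB.instance Definition _ := isGroup.Build presented_group
  presented_mulA presented_mul1 presented_mulr1 presented_mulV presented_mulrV.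

End Presentation.
Arguments word : clear implicits.
Arguments presented_group : clear implicits.

(** * Subgroups of a possibly infinite group *)

Definition is_subgroup (G : groupType) (H : set G) : Prop :=
  group_closed [pred x | x \in H].

Record subgroup (G : groupType) := Subgroup {
  subgroup_set :> set G;
  subgroupP : is_subgroup subgroup_set
}.

Definition subgroup_type (G : groupType) (H : subgroup G) : Type :=
  {x : G | [pred y | y \in subgroup_set H] x}.
HB.instance Definition _ (G : groupType) (H : subgroup G) :=
  SubChoice.on (subgroup_type H).
HB.instance Definition _ (G : groupType) (H : subgroup G) :=
  SubChoice_isSubGroup.Build G _ (subgroup_type H) (subgroupP H).

Definition generated (G : groupType) (A : set G) : set G :=
  smallest (@is_subgroup G) A.

Definition conjugate (G : groupType) (g : G) (A : set G) : set G :=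
  [set (g * a * g^-1)%g | a in A].

(** * Artin groups *)

(* Only the values of [label] on edges are meaningful. *)
Record labeled_graph := LabeledGraph {
  vertex :> finType;
  edges : {set {set vertex}};
  label : {set vertex} -> nat;
  vertex_gt0 : (0 < #|vertex|)%N;
  card_edge : forall e, e \in edges -> #|e| = 2;
  label_ge2 : forall e, e \in edges -> (2 <= label e)%N
}.

Section Artin.
Variable Gamma : labeled_graph.

Definition alternating (v w : Gamma) (n : nat) : word Gamma :=
  mkseq (fun i => (if odd i then w else v, true)) n.

Inductive artin_rel : word Gamma -> word Gamma -> Prop :=
| ArtinRel v w : [set v; w]%SET \in edges Gamma ->
    artin_rel (alternating v w (label [set v; w]%SET))
              (alternating w v (label [set v; w]%SET)).

Definition artin_group : groupType := presented_group Gamma artin_rel.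

Definition artin_gen (v : Gamma) : artin_group := word_class artin_rel [:: (v, true)].

Definition standard_parabolic (X : {set Gamma}) : set artin_group :=
  generated [set artin_gen v | v in [set` X]].

(* P is a parabolic subgroup of A_Y. *)
Definition parabolic_in (Y : {set Gamma}) (P : set artin_group) : Prop :=
  exists g : artin_group, exists X : {set Gamma},
    [/\ standard_parabolic Y g, X \subset Y
      & P = conjugate g (standard_parabolic X)].

Definition free_of_infinity (X : {set Gamma}) : Prop :=
  forall v w, v \in X -> w \in X -> v != w -> [set v; w]%SET \in edges Gamma.

Definition complete_parabolic (P : set artin_group) : Prop :=
  exists g : artin_group, exists X : {set Gamma},
    free_of_infinity X /\ P = conjugate g (standard_parabolic X).

Definition class_B : Prop :=
  forall Y : {set Gamma}, free_of_infinity Y ->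
  forall P1 P2 : set artin_group, parabolic_in Y P1 -> parabolic_in Y P2 ->
    parabolic_in Y (P1 `&` P2).

End Artin.

(** * CAT(0) metric spaces *)

Section Cat0.
Context {R : realType}.

Definition edist n (x y : 'rV[R]_n) : R :=
  Num.sqrt (\sum_(i < n) (x 0 i - y 0 i) ^+ 2).

Context {T : Type}.
Variable d : T -> T -> R.

Definition is_metric : Prop :=
  [/\ forall x y, 0 <= d x y,
      forall x y, d x y = 0 <-> x = y,
      forall x y, d x y = d y x
    & forall x y z, d x z <= d x y + d y z].

Definition geodesic (x y : T) (c : R -> T) : Prop :=
  [/\ c 0 = x, c (d x y) = y
    & forall s t, 0 <= s <= d x y -> 0 <= t <= d x y -> d (c s) (c t) = `|s - t|].

(* z' lies on the Euclidean segment [x', y'], at distance t from x'. *)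
Definition at_distance (x' y' : 'rV[R]_2) (t : R) (z' : 'rV[R]_2) : Prop :=
  edist x' z' = t /\ exists2 l, 0 <= l <= 1 & z' = (1 - l) *: x' + l *: y'.

(* The i-th side of a geodesic triangle joins p i to p (i + 1 mod 3). *)
Definition cat0_inequality : Prop :=
  forall (p : 'I_3 -> T) (c : 'I_3 -> R -> T) (p' : 'I_3 -> 'rV[R]_2),
    (forall i, geodesic (p i) (p (ordS i)) (c i)) ->
    (forall i j, edist (p' i) (p' j) = d (p i) (p j)) ->
  forall (i j : 'I_3) (s t : R) (x' y' : 'rV[R]_2),
    0 <= s <= d (p i) (p (ordS i)) -> 0 <= t <= d (p j) (p (ordS j)) ->
    at_distance (p' i) (p' (ordS i)) s x' ->
    at_distance (p' j) (p' (ordS j)) t y' ->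
    d (c i s) (c j t) <= edist x' y'.

Definition cat0_metric : Prop :=
  [/\ is_metric, forall x y, exists c, geodesic x y c & cat0_inequality].

End Cat0.

(** * Cubical complexes *)

Section Cubes.
Context {R : realType}.

Definition unit_cube n : set 'rV[R]_n := [set x | forall i, 0 <= x 0 i <= 1].

(* [f i = Some b] fixes the i-th coordinate to b, [f i = None] leaves it free. *)
Definition cube_face n (f : 'I_n -> option bool) : set 'rV[R]_n :=
  [set x | unit_cube x /\ forall i b, f i = Some b -> x 0 i = b%:R].

Definition is_face n (A : set 'rV[R]_n) : Prop := exists f, A = cube_face f.

Definition isometry_onto n m (A : set 'rV[R]_n) (B : set 'rV[R]_m)
    (h : 'rV[R]_n -> 'rV[R]_m) : Prop :=
  h @` A = B /\ forall x y, A x -> A y -> edist (h x) (h y) = edist x y.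

End Cubes.
Arguments unit_cube R n : clear implicits.

(* Bridson-Haefliger, Definition I.7.32: the set of points is a quotient of a
   disjoint union of unit cubes, given by the projections [chart] (only their
   values on unit cubes matter), injective on each cube, and two cubes that
   meet are glued along an isometry between a face of each. *)
Record cubical_complex (R : realType) := CubicalComplex {
  carrier : Type;
  cell : Type;
  cell_dim : cell -> nat;
  chart : forall c : cell, 'rV[R]_(cell_dim c) -> carrier;
  chart_surj : forall x, exists c, (chart (c := c) @` unit_cube R (cell_dim c)) x;
  chart_inj : forall (c : cell) u v, unit_cube R (cell_dim c) u ->
    unit_cube R (cell_dim c) v -> chart u = chart v -> u = v;
  chart_glue : forall c c' : cell,
    (chart (c := c) @` unit_cube R (cell_dim c)) `&`
      (chart (c := c') @` unit_cube R (cell_dim c')) !=set0 ->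
    exists (A : set 'rV[R]_(cell_dim c)) (A' : set 'rV[R]_(cell_dim c')) h,
      [/\ is_face A, is_face A', isometry_onto A A' h
        & forall u u', unit_cube R (cell_dim c) u -> unit_cube R (cell_dim c') u' ->
            (chart u = chart u' <-> A u /\ u' = h u)]
}.
Arguments chart {R K c} u : rename.

Section CubicalComplex.
Context {R : realType} (K : cubical_complex R).

(* A string of total length l: consecutive points lie in a common cube. *)
Inductive string : carrier K -> carrier K -> R -> Prop :=
| StringNil x : string x x 0
| StringCons (c : cell K) u v y l :
    unit_cube R (cell_dim c) u -> unit_cube R (cell_dim c) v ->
    string (chart v) y l -> string (chart u) y (edist u v + l).

Definition cube_dist (x y : carrier K) : R := inf [set l | string x y l].

(* Without connectedness, [cube_dist] would take the junk value [inf set0]. *)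
Definition cube_connected : Prop := forall x y : carrier K, exists l, string x y l.

Definition finite_dimensional : Prop :=
  exists N : nat, forall c : cell K, (cell_dim c <= N)%N.

Definition cat0_cube_complex : Prop :=
  [/\ inhabited (carrier K), cube_connected & cat0_metric cube_dist].

(* f maps every cube isometrically onto a cube: the cubes of K are the images
   under the charts of all the faces of the unit cubes. *)
Definition cellular (f : carrier K -> carrier K) : Prop :=
  forall c : cell K, exists (c' : cell K) (A : set 'rV[R]_(cell_dim c')) h,
    [/\ is_face A, isometry_onto (unit_cube R (cell_dim c)) A h
      & forall u, unit_cube R (cell_dim c) u -> f (chart u) = chart (h u)].

Definition cellular_action (G : groupType) (act : G -> carrier K -> carrier K) : Prop :=
  [/\ forall x, act 1%g x = x,
      forall g h x, act (g * h)%g x = act g (act h x)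
    & forall g, cellular (act g)].

Definition locally_elliptic (G : groupType) (act : G -> carrier K -> carrier K) : Prop :=
  forall g, exists x, act g x = x.

End CubicalComplex.

Definition FC'_group (R : realType) (G : groupType) : Prop :=
  forall (K : cubical_complex R) (act : G -> carrier K -> carrier K),
    finite_dimensional K -> cat0_cube_complex K -> cellular_action act ->
    locally_elliptic act.

(* Main.v *)
From mathcomp Require Import all_boot all_order all_algebra all_classical all_reals.
From mathcomp Require Import trigo ring lra zify.
Require Import Defs.

Set Implicit Arguments.
Unset Strict Implicit.
Unset Printing Implicit Defensive.

Local Open Scope classical_set_scope.

(** The idea is to let [H] act on Bass-Serre trees, which are one-dimensional CAT(0)
    cube complexes, one for each pair of distinct vertices [a], [b] of the graph that
    do not span an edge.  No defining relation involves both [a] and [b], so the Artin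
    group is the amalgam of the standard parabolic subgroups that omit [a] and [b]
    respectively, over their intersection ([bs_tree]).  The realization of a
    tree is CAT(0) because its metric satisfies the four-point condition
    ([four_point_cat0]); hence each element of an FC'-group fixes a vertex of each of
    these trees ([FC'_fixes_vertex]), and by Serre's argument so does each finitely
    generated subgroup ([serre]).

    A set that lies in a parabolic subgroup [k A_Y k^-1] and fixes a vertex of the tree
    of a non-edge of [Y] also fixes a vertex of the subtree of that subgroup, by
    projection.  The stabilizers of these vertices in [k A_Y k^-1] are parabolic
    subgroups of smaller rank, and going down until no non-edge is left shows that
    every finite subset of [H] lies in a complete parabolic subgroup
    ([elliptic_complete]).  The same descent, combined with a walk along the path
    between two fixed vertices, reduces the intersection of two complete parabolic
    subgroups to the case where both lie in [A_Z] with [Z] free of infinity, which is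
    the hypothesis on the class B ([completeI]).  Finally, a finite subset of [H] whose
    smallest complete parabolic subgroup has the largest possible rank already
    forces all of [H] into that parabolic subgroup ([locally_complete]).

    These arguments rest on two facts about all Artin groups: van der Lek's theorem that
    [A_X] and [A_Y] meet in the standard parabolic subgroup of the intersection of
    [X] and [Y] ([standard_parabolicI]), and the fact that a parabolic subgroup
    contained in [A_X] is conjugate inside [A_X] to a standard one of the same rank
    ([parabolic_sub_standard]).  Both come from a retraction onto [A_X]: the Artin
    group acts on the cosets of [W_X] in the Coxeter group [W], and a letter that
    fixes a coset is recorded as the generator of [X] by which it acts on the
    minimal representative of that coset.  The recorded word satisfies the braid
    relations because the dihedral reflections fixing a coset are all or at most one
    of them ([fixed_dihedral]).  The Coxeter combinatorics is developed from the
    inversion cocycle, and the orders of products of generators from the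
    geometric representation. *)

(** * Groups and presentations *)

Section Subgroups.
Variable G : groupType.
Implicit Types (A B : set G) (g h : G).
Local Open Scope group_scope.

(** An inductive form of [generated], to argue by induction on a word. *)
Inductive span A : G -> Prop :=
| Span1 : span A 1
| SpanM a g : A a -> span A g -> span A (a * g)
| SpanV a g : A a -> span A g -> span A (a^-1 * g).

Lemma span_mul A g h : span A g -> span A h -> span A (g * h).
Proof.
move=> Ag Ah; elim: Ag => [|a k Aa _ IH|a k Aa _ IH]; rewrite -?mulgA ?mul1g //.
- exact: SpanM.
- exact: SpanV.
Qed.

Lemma span_in A a : A a -> span A a.
Proof. by move=> Aa; rewrite -[a]mulg1; apply: SpanM => //; exact: Span1. Qed.

Lemma span_inV A a : A a -> span A a^-1.
Proof. by move=> Aa; rewrite -[a^-1]mulg1; apply: SpanV => //; exact: Span1. Qed.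

Lemma span_inv A g : span A g -> span A g^-1.
Proof.
elim=> [|a k Aa _ IH|a k Aa _ IH]; first by rewrite invg1; exact: Span1.
- by rewrite invgM; apply: span_mul => //; exact: span_inV.
- by rewrite invgM invgK; apply: span_mul => //; exact: span_in.
Qed.

Lemma span_sub A B : A `<=` B -> span A `<=` span B.
Proof.
move=> AB g; elim=> [|a k Aa _ IH|a k Aa _ IH]; first exact: Span1.
- exact: SpanM (AB _ Aa) IH.
- exact: SpanV (AB _ Aa) IH.
Qed.

Lemma spanMl A g h : span A g -> span A (g * h) <-> span A h.
Proof.
move=> Ag; split; last exact: span_mul.
by move=> Agh; rewrite -[h](mulKg g); apply: span_mul => //; exact: span_inv.
Qed.

Lemma spanMr A g h : span A h -> span A (g * h) <-> span A g.
Proof.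
move=> Ah; split; last by move=> Ag; exact: span_mul.
by move=> Agh; rewrite -[g](mulgK h); apply: span_mul => //; exact: span_inv.
Qed.

Lemma is_subgroupP (H : set G) : is_subgroup H <->
  [/\ H 1, forall g h, H g -> H h -> H (g * h) & forall g, H g -> H g^-1].
Proof.
have memE x : (x \in [pred y | y \in H]) <-> H x by rewrite -[_ \in _]/(x \in H) inE.
split=> [[/memE H1 Hd]|[H1 HM HV]]; last first.
  by split=> [|u v /memE Hu /memE Hv]; apply/memE => //; apply: HM => //; exact: HV.
have HV g : H g -> H g^-1.
  by move=> Hg; rewrite -[g^-1]mul1g; apply/memE/Hd; exact/memE.
split=> // g h Hg Hh; rewrite -[h]invgK; apply/memE/Hd; first exact/memE.
exact/memE/HV.
Qed.

Lemma generatedE A : generated A = span A.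
Proof.
apply/seteqP; split=> g.
  apply; split; last by move=> a; exact: span_in.
  apply/is_subgroupP; split=> [|u v|u]; [exact: Span1|exact: span_mul|exact: span_inv].
move=> Ag H [/is_subgroupP[H1 HM HV] AH].
by elim: Ag => // a k Aa _ IH; apply: HM => //; [|apply: HV]; apply: AH.
Qed.

Lemma conjugateP g A x : conjugate g A x <-> A (g^-1 * x * g).
Proof.
split=> [[a Aa <-]|Ax]; first by rewrite !mulgA mulVg mul1g mulgVK.
by exists (g^-1 * x * g) => //; rewrite !mulgA mulgV mul1g mulgK.
Qed.

Lemma conjugate_span g A : conjugate g (span A) = span (conjugate g A).
Proof.
apply/seteqP; split=> x.
  case=> y Ay <-; elim: Ay => [|a k Aa _ IH|a k Aa _ IH].
  - by rewrite mulg1 mulgV; exact: Span1.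
  - have -> : g * (a * k) * g^-1 = (g * a * g^-1) * (g * k * g^-1).
      by rewrite !mulgA mulgVK.
    by apply: SpanM => //; exists a.
  - have -> : g * (a^-1 * k) * g^-1 = (g * a * g^-1)^-1 * (g * k * g^-1).
      by rewrite !invgM !invgK !mulgA mulgVK.
    by apply: SpanV => //; exists a.
elim=> [|_ k [a Aa <-] _ /conjugateP IH|_ k [a Aa <-] _ /conjugateP IH];
    apply/conjugateP.
- by rewrite mulg1 mulVg; exact: Span1.
- have -> : g^-1 * (g * a * g^-1 * k) * g = a * (g^-1 * k * g).
    by rewrite !mulgA mulVg mul1g.
  exact: SpanM.
- have -> : g^-1 * ((g * a * g^-1)^-1 * k) * g = a^-1 * (g^-1 * k * g).
    by rewrite !invgM !invgK !mulgA mulVg mul1g.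
  exact: SpanV.
Qed.

Lemma conjugateM g h A : conjugate g (conjugate h A) = conjugate (g * h) A.
Proof.
by apply/seteqP; split=> x; rewrite !conjugateP invgM !mulgA.
Qed.

Lemma conjugate1 A : conjugate 1 A = A.
Proof. by apply/seteqP; split=> x; rewrite conjugateP invg1 mul1g mulg1. Qed.

Lemma conjugateI g A B :
  conjugate g (A `&` B) = conjugate g A `&` conjugate g B.
Proof.
by apply/seteqP; split=> x; rewrite /setI /= !conjugateP.
Qed.

Lemma conjugate_in A g : span A g -> conjugate g (span A) = span A.
Proof.
move=> Ag; apply/seteqP; split=> x; rewrite conjugateP.
  by rewrite (spanMr _ Ag) (spanMl _ (span_inv Ag)).
by rewrite (spanMr _ Ag) (spanMl _ (span_inv Ag)).
Qed.

End Subgroups.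

Section PresentedAction.
Context {S : choiceType} (rel : word S -> word S -> Prop).
Local Open Scope group_scope.
Local Notation G := (presented_group S rel).

Definition letter (l : S * bool) : G := word_class rel [:: l].

Lemma word_class_cat u v : word_class rel (u ++ v) = word_class rel u * word_class rel v :> G.
Proof. by rewrite -word_classM. Qed.

Lemma word_class_cons l u : word_class rel (l :: u) = letter l * word_class rel u :> G.
Proof. by rewrite -cat1s word_class_cat. Qed.

Lemma word_class_nil : word_class rel [::] = 1 :> G.
Proof. by []. Qed.

Lemma letterV s : letter (s, false) = (letter (s, true))^-1.
Proof.
apply/esym/mulg1_eq; rewrite -word_class_cons -word_class_nil.
apply/word_classP; exact: WordCancel.
Qed.

Lemma presented_ind (P : G -> Prop) : P 1 ->
  (forall s g, P g -> P (letter (s, true) * g)) ->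
  (forall s g, P g -> P ((letter (s, true))^-1 * g)) -> forall g, P g.
Proof.
move=> P1 PM PV g; rewrite -[g]word_reprK; elim: (word_repr g) => // -[s b] u IH.
by rewrite word_class_cons; case: b; [exact: PM|rewrite letterV; exact: PV].
Qed.

Variables (T : Type) (P : T -> Prop) (f : S * bool -> T -> T).
Hypothesis fP : forall l x, P x -> P (f l x).
Hypothesis fK : forall s b x, P x -> f (s, b) (f (s, ~~ b) x) = x.
Hypothesis frel : forall u v, rel u v -> forall x, P x -> foldr f x u = foldr f x v.

(** Letters that act by bijections and respect the relations define an action of the
    presented group.  The relations are only required on an invariant part [P]
    of [T]. *)
Definition presented_act (g : G) (x : T) : T := foldr f x (word_repr g).

Lemma foldr_pred u x : P x -> P (foldr f x u).
Proof. by move=> Px; elim: u => //= l u IH; exact: fP. Qed.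

Lemma foldr_word_eq u v : word_eq rel u v -> forall x, P x -> foldr f x u = foldr f x v.
Proof.
elim=> {u v} //.
- by move=> u v _ IH x Px; rewrite IH.
- by move=> u v w _ IH1 _ IH2 x Px; rewrite IH1 ?IH2.
- move=> u u' v v' _ IH1 _ IH2 x Px; rewrite !foldr_cat IH2 // IH1 //; exact: foldr_pred.
Qed.

Lemma presented_actE u x : P x -> presented_act (word_class rel u) x = foldr f x u.
Proof. by move=> Px; apply: foldr_word_eq => //; exact: word_repr_class. Qed.

Lemma presented_actP g x : P x -> P (presented_act g x).
Proof. exact: foldr_pred. Qed.

Lemma presented_act1 x : P x -> presented_act 1 x = x.
Proof. by move=> Px; rewrite -word_class_nil presented_actE. Qed.

Lemma presented_actM g h x : P x ->
  presented_act (g * h) x = presented_act g (presented_act h x).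
Proof.
move=> Px; rewrite -[g]word_reprK -[h]word_reprK -word_class_cat.
by rewrite !presented_actE ?foldr_cat //; exact: foldr_pred.
Qed.

Lemma presented_act_letter l x : P x -> presented_act (letter l) x = f l x.
Proof. by move=> Px; rewrite presented_actE. Qed.

End PresentedAction.

(** * The geometric representation of a Coxeter group *)

Section Alternating.
Variable T : Type.

Fixpoint alt_iter (f g : T -> T) n x := if n is n'.+1 then f (alt_iter g f n' x) else x.

(** For involutions, the two alternating products of the same length differ by a power
    of the rotation, so a braid relation expresses that the rotation has finite order. *)
Lemma alt_iter_rotation f g n x : involutive f -> involutive g ->
  alt_iter f g n x = iter n (f \o g) (alt_iter g f n x).
Proof.
move=> fK gK; elim: n f g fK gK => //= n IH f g fK gK.
rewrite (IH g f) //.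
have E m y : f (iter m (g \o f) y) = iter m (f \o g) (f y).
  by elim: m => //= m ->.
by rewrite E -[LHS]/(iter n (f \o g) _) -[RHS]/(iter n.+1 (f \o g) _) iterSr /= gK.
Qed.

End Alternating.

Lemma alternatingS (Gamma : labeled_graph) (s t : Gamma) n :
  Defs.alternating s t n.+1 = (s, true) :: Defs.alternating t s n.
Proof.
rewrite /Defs.alternating /mkseq /= -[1%N]addn0 iotaDl -map_comp; congr (_ :: _).
by apply: eq_map => i /=; case: (odd i).
Qed.

Lemma foldr_alternating (Gamma : labeled_graph) (T : Type) (f : Gamma * bool -> T -> T)
    (s t : Gamma) n x :
  foldr f x (Defs.alternating s t n) = alt_iter (f (s, true)) (f (t, true)) n x.
Proof. by elim: n s t => // n IH s t; rewrite alternatingS /= IH. Qed.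

Lemma edge_neq (Gamma : labeled_graph) (s t : Gamma) :
  [set s; t]%SET \in edges Gamma -> s != t.
Proof. by move=> /card_edge; rewrite cards2; case: (s != t). Qed.

Section GeometricRepresentation.
Variables (R : realType) (Gamma : labeled_graph) (m0 : nat).
Hypothesis m0_ge2 : (2 <= m0)%N.
Local Open Scope ring_scope.
Import Order.TTheory GRing.Theory Num.Theory.

(** The order of the product of two generators, with a spare value [m0] at the
    non-edges: it can be chosen larger than any given label, which is
    enough to tell non-edges from edges. *)
Definition cox_order (s t : Gamma) : nat :=
  if [set s; t]%SET \in edges Gamma then label [set s; t]%SET else m0.

Lemma cox_order_ge2 s t : (2 <= cox_order s t)%N.
Proof. by rewrite /cox_order; case: ifP => // /label_ge2. Qed.

Lemma cox_orderC s t : cox_order s t = cox_order t s.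
Proof. by rewrite /cox_order finset.setUC. Qed.

Definition cox_form (s t : Gamma) : R :=
  if s == t then 1 else - cos (pi / (cox_order s t)%:R).

Lemma cox_formC s t : cox_form s t = cox_form t s.
Proof. by rewrite /cox_form eq_sym cox_orderC. Qed.

(** The scalar product with the root of [s]. *)
Definition root_form s (v : Gamma -> R) : R := \sum_t cox_form s t * v t.

Definition root_reflection s (v : Gamma -> R) : Gamma -> R :=
  fun t => v t - 2 * root_form s v * (t == s)%:R.

Lemma root_form_reflection s t v :
  root_form t (root_reflection s v) = root_form t v - 2 * root_form s v * cox_form t s.
Proof.
rewrite /root_form /root_reflection.
under eq_bigr do rewrite mulrBr.
rewrite sumrB; congr (_ - _).
rewrite (bigD1 s) //= eqxx mulr1n big1 ?addr0; first by rewrite mulr1 mulrC.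
by move=> i /negbTE ->; rewrite !mulr0.
Qed.

Lemma root_reflectionK s : involutive (root_reflection s).
Proof.
move=> v; apply/funext => t.
rewrite [LHS]/root_reflection root_form_reflection /cox_form eqxx /root_reflection; ring.
Qed.

Section Plane.
Variables s t : Gamma.
Hypothesis neq_st : s != t.
Local Notation k := (cox_order s t).
Let theta : R := pi / k%:R.
Let c := cos theta.

(** In the coordinate [root_form t v + exp (i theta) * root_form s v], of which these are
   the real and imaginary parts, the reflection at [s] is the complex conjugation and
   the reflection at [t] is the conjugation followed by the rotation of angle
   [2 theta]; their product is therefore a rotation of angle [2 theta]. *)
Let zRe v := root_form t v + root_form s v * c.
Let zIm v := root_form s v * sin theta.

Let k_gt0 : 0 < k%:R :> R.
Proof. by rewrite ltr0n; apply: leq_trans (cox_order_ge2 s t). Qed.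

Let sin_theta_gt0 j : (0 < j < k)%N -> 0 < sin (j%:R * theta).
Proof.
move=> /andP[j0 jk]; apply: sin_gt0_pi; rewrite mulr_gt0 ?ltr0n ?divr_gt0 ?pi_gt0 //=.
by rewrite mulrCA gtr_pMr ?pi_gt0 // ltr_pdivrMr // mul1r ltr_nat.
Qed.

Let sin_theta : 0 < sin theta.
Proof.
by have := @sin_theta_gt0 1; rewrite mul1r; apply; rewrite /= cox_order_ge2.
Qed.

Let form_st : cox_form s t = - c.
Proof. by rewrite /cox_form (negbTE neq_st). Qed.

Let sq : sin theta ^+ 2 = 1 - c ^+ 2.
Proof. by rewrite /c sin2cos2. Qed.

Let rot v := root_reflection s (root_reflection t v).

Let form_tt u : cox_form u u = 1. Proof. by rewrite /cox_form eqxx. Qed.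

Let rotRe v : zRe (rot v) = zRe v * cos (theta + theta) + zIm v * sin (theta + theta).
Proof.
rewrite /zRe /zIm /rot !root_form_reflection ?(cox_formC t s) form_st !form_tt cosD sinD -/c.
by have := sq; move: (sin theta) c => S C SC; ring: SC.
Qed.

Let rotIm v : zIm (rot v) = zIm v * cos (theta + theta) - zRe v * sin (theta + theta).
Proof.
rewrite /zRe /zIm /rot !root_form_reflection ?(cox_formC t s) form_st !form_tt cosD sinD -/c.
by have := sq; move: (sin theta) c => S C SC; ring: SC.
Qed.

Let iter_rot n v :
  zRe (iter n rot v) = zRe v * cos (n%:R * (theta + theta)) + zIm v * sin (n%:R * (theta + theta))
  /\ zIm (iter n rot v) = zIm v * cos (n%:R * (theta + theta)) - zRe v * sin (n%:R * (theta + theta)).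
Proof.
elim: n => [|n [IHr IHi]]; first by rewrite mul0r cos0 sin0; split; rewrite /=; ring.
rewrite iterS rotRe rotIm IHr IHi -natr1 (mulrDl n%:R) mul1r (cosD (n%:R * _)) (sinD (n%:R * _)).
by split; ring.
Qed.

Let theta2 : k%:R * (theta + theta) = pi *+ 2.
Proof. by rewrite mulrDr /theta mulrC divfK ?gt_eqF // mulr2n. Qed.

Let iter_rot_off n v u : u != s -> u != t -> iter n rot v u = v u.
Proof.
move=> us ut; elim: n => //= n IH.
by rewrite /rot /root_reflection (negbTE us) (negbTE ut) !mulr0 !subr0.
Qed.

(** The coordinate turns by the full angle [2 pi], so the vector moves by a
    combination of the basis vectors at [s] and [t] that is orthogonal to both;
    the form is nondegenerate on that plane because [sin theta] is nonzero. *)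
Lemma rotation_order v : iter k (root_reflection s \o root_reflection t) v = v.
Proof.
rewrite -/rot; have [] := iter_rot k v; rewrite theta2 cos2pi sin2pi !mulr1 !mulr0.
rewrite addr0 subr0 /zIm /zRe; set w := iter k rot v => Er Ei.
have {}Ei : root_form s w = root_form s v by exact: (mulIf (lt0r_neq0 sin_theta)).
have {}Er : root_form t w = root_form t v by move: Er; rewrite Ei => /addIr.
have off u : u != s -> u != t -> w u = v u by exact: iter_rot_off.
have dec r : root_form r w - root_form r v
    = cox_form r s * (w s - v s) + cox_form r t * (w t - v t).
  rewrite /root_form -sumrB (bigD1 s) //= (bigD1 t) 1?eq_sym //= big1 ?addr0; last first.
    by move=> i /andP[is_ it_]; rewrite off // subrr.
  by ring.
have := dec s; have := dec t; rewrite Er Ei !subrr !form_tt (cox_formC t s) form_st.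
move: (w s - v s) (w t - v t) (subr_eq0 (w s) (v s)) (subr_eq0 (w t) (v t)).
move=> p q Ep Eq Ht Hs.
have qE : q = c * p by lra.
have pE : p = c * (c * p) by rewrite -qE; lra.
have Hp : p * sin theta ^+ 2 = 0.
  have -> : p * sin theta ^+ 2 = p - c * (c * p) by rewrite sq; ring.
  by rewrite -pE subrr.
have p0 : p = 0 by apply: (mulIf (lt0r_neq0 (exprn_gt0 2 sin_theta))); rewrite Hp mul0r.
have q0 : q = 0 by rewrite qE p0 mulr0.
move: Ep Eq; rewrite p0 q0 eqxx => /esym/eqP ws /esym/eqP wt.
apply/funext => u; case: (eqVneq u s) => [->//|us]; case: (eqVneq u t) => [->//|ut].
exact: off.
Qed.

(** The root of [s] itself has a nonzero coordinate, and a smaller power turns it by an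
    angle that is not a multiple of [2 pi]. *)
Lemma rotation_neq j : (0 < j < k)%N ->
  exists v, iter j (root_reflection s \o root_reflection t) v <> v.
Proof.
move=> jk; pose v : Gamma -> R := fun u => (u == s)%:R.
have cv r : root_form r v = cox_form r s.
  rewrite /root_form (bigD1 s) //= /v eqxx mulr1 big1 ?addr0 //.
  by move=> i /negbTE ->; rewrite mulr0.
exists v => E; have [_] := iter_rot j v; rewrite -/rot in E; rewrite E.
rewrite /zIm /zRe !cv form_tt (cox_formC t s) form_st mulrDr cosD => H.
have S0 := @sin_theta_gt0 j jk.
suff : sin (j%:R * theta) ^+ 2 = 0 by move=> /eqP; rewrite sqrf_eq0 gt_eqF.
apply: (mulIf (lt0r_neq0 sin_theta)); rewrite mul0r.
move: H; rewrite !mul1r addNr mul0r subr0 => H.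
have C := cos2Dsin2 (j%:R * theta).
have H' : sin theta * (cos (j%:R * theta) ^+ 2 - sin (j%:R * theta) ^+ 2) = sin theta.
  by rewrite [RHS]H !expr2.
have {}C : cos (j%:R * theta) ^+ 2 = 1 - sin (j%:R * theta) ^+ 2 by lra.
move: H'; rewrite C; move: (sin (_ * _) ^+ 2) (sin theta) => x y; nra.
Qed.

End Plane.
End GeometricRepresentation.

(** * Inversions in Coxeter groups *)

Section CoxeterGroup.
Variable Gamma : labeled_graph.
Local Open Scope group_scope.
Implicit Types (s t x y : Gamma) (X Y : {set Gamma}).

Inductive cox_rel : word Gamma -> word Gamma -> Prop :=
| CoxArtin u v : artin_rel u v -> cox_rel u v
| CoxInvol s : cox_rel [:: (s, true); (s, true)] [::].

Definition coxeter_group : groupType := presented_group Gamma cox_rel.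
Local Notation W := coxeter_group.

Definition cgen s : W := letter cox_rel (s, true).

Lemma cgenK s : cgen s * cgen s = 1.
Proof.
rewrite -word_class_cons -(word_class_nil cox_rel); apply/word_classP/WordRel.
exact: CoxInvol.
Qed.

Lemma cgenV s : (cgen s)^-1 = cgen s.
Proof. exact/mulg1_eq/cgenK. Qed.

Lemma cgenKl s w : cgen s * (cgen s * w) = w.
Proof. by rewrite mulgA cgenK mul1g. Qed.

Lemma cgenKr s w : w * cgen s * cgen s = w.
Proof. by rewrite -mulgA cgenK mulg1. Qed.

Lemma cox_ind (P : W -> Prop) : P 1 -> (forall s w, P w -> P (cgen s * w)) ->
  forall w, P w.
Proof.
move=> P1 PM; apply: presented_ind => // s w Pw.
by rewrite -/(cgen s) cgenV; exact: PM.
Qed.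

Lemma word_class_alternating s t n :
  word_class cox_rel (Defs.alternating s t n)
  = alt_iter ( *%g (cgen s)) ( *%g (cgen t)) n 1 :> W.
Proof.
elim: n s t => //= n IH s t; by rewrite alternatingS word_class_cons IH.
Qed.

Lemma alt_iterM (G : groupType) (g h : G) n (x y : G) :
  alt_iter ( *%g g) ( *%g h) n (x * y) = alt_iter ( *%g g) ( *%g h) n x * y.
Proof. by elim: n g h => //= n IH g h; rewrite IH mulgA. Qed.

Lemma iter_mul2 (G : groupType) (g h : G) n (x : G) :
  iter n ( *%g g \o *%g h) x = (g * h) ^+ n * x.
Proof. by elim: n => [|n IH] /=; rewrite ?mul1g // IH expgS !mulgA. Qed.

Lemma cgen_order s t : [set s; t]%SET \in edges Gamma ->
  (cgen s * cgen t) ^+ (label [set s; t]%SET) = 1.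
Proof.
move=> st; set m := label _.
have := word_class_alternating s t m; have := word_class_alternating t s m.
have -> : word_class cox_rel (Defs.alternating t s m)
    = word_class cox_rel (Defs.alternating s t m).
  by apply/word_classP/WordSym/WordRel/CoxArtin; exact: ArtinRel.
move=> ->; rewrite [RHS]alt_iter_rotation; try exact: cgenKl.
rewrite iter_mul2; move: (alt_iter _ _ m 1) => a E.
by rewrite -[LHS](mulgK a) -E mulgV.
Qed.

(** Counted modulo 2, the reflections [u s u^-1] met along a word with prefixes [u s] only
    depend on the element of the group that the word represents.  They are the value
    at the zero function of an affine action on boolean functions, whose linear part
    is the conjugation and where the generator [s] adds the indicator of [s]. *)
Definition inv_step (l : Gamma * bool) (f : W -> bool) : W -> bool :=
  fun r => f (cgen l.1 * r * cgen l.1) (+) (r == cgen l.1).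

Lemma inv_stepK s b b' f : inv_step (s, b) (inv_step (s, b') f) = f.
Proof.
apply/funext => r; rewrite /inv_step /= !mulgA cgenK mul1g cgenKr.
have -> : (cgen s * r * cgen s == cgen s) = (r == cgen s).
  apply/eqP/eqP => [E|->]; last by rewrite cgenK mul1g.
  have := congr1 (fun z => cgen s * z) E; rewrite !mulgA cgenK mul1g => E'.
  by have := congr1 (fun z => z * cgen s) E'; rewrite cgenKr mul1g.
by rewrite -addbA addbb addbF.
Qed.

(** Along an alternating word, the reflections met are the palindromes [(s t)^i s]. *)
Lemma inv_step_alternating s t n f r :
  foldr inv_step f (Defs.alternating s t n) r =
  f ((word_class cox_rel (Defs.alternating s t n) : W)^-1 * r
      * word_class cox_rel (Defs.alternating s t n))
  (+) \big[addb/false]_(i < n) (r == (cgen s * cgen t) ^+ i * cgen s).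
Proof.
elim: n s t r => [|n IH] s t r.
  by rewrite big_ord0 addbF /= word_class_nil invg1 mul1g mulg1.
rewrite alternatingS /= {1}/inv_step /= IH -addbA word_class_cons -/(cgen s).
congr (f _ (+) _); first by rewrite invgM cgenV !mulgA.
rewrite big_ord_recl expg0 mul1g addbC; congr (_ (+) _).
apply: eq_bigr => i _; rewrite lift0.
have -> : (cgen s * cgen t) ^+ i.+1 * cgen s
    = cgen s * ((cgen t * cgen s) ^+ i * cgen t) * cgen s.
  elim: (i : nat) => [|j IHj]; first by rewrite expg1 expg0 mul1g.
  by rewrite expgS -(mulgA (cgen s * cgen t)) IHj [in RHS]expgS !mulgA.
apply/eqP/eqP => [<-|->]; first by rewrite !mulgA cgenK mul1g cgenKr.
by rewrite !mulgA cgenK mul1g cgenKr.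
Qed.

(** When the length is the order of [s t], exchanging [s] and [t] lists the same
    palindromes in the reverse order. *)
Lemma inv_step_rel u v : cox_rel u v -> forall f, True -> foldr inv_step f u = foldr inv_step f v.
Proof.
case=> {u v} [u v [s t st]|s] f _; last exact: inv_stepK.
apply/funext => r; rewrite !inv_step_alternating; set m := label _.
have -> : word_class cox_rel (Defs.alternating s t m)
    = word_class cox_rel (Defs.alternating t s m).
  by apply/word_classP/WordRel/CoxArtin; exact: ArtinRel.
congr (_ (+) _); rewrite (reindex_inj rev_ord_inj) /=; apply: eq_bigr => i _.
have tsV : cgen t * cgen s = (cgen s * cgen t)^-1 by rewrite invgM !cgenV.
have E : (cgen s * cgen t) ^+ (m - i.+1) = (cgen t * cgen s) ^+ i.+1.
  by rewrite expgnFr // cgen_order // mul1g tsV expVgn.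
by rewrite E expgSr -mulgA cgenKr.
Qed.

Let trivP (f : W -> bool) : Prop := True.
Let inv_act := presented_act (rel := cox_rel) inv_step.
Let inv_actK s b f : trivP f -> inv_step (s, b) (inv_step (s, ~~ b) f) = f.
Proof. by move=> _; exact: inv_stepK. Qed.
Let inv_stepP l f : trivP f -> trivP (inv_step l f). Proof. by []. Qed.

Definition inversions (w : W) : W -> bool := inv_act w (fun=> false).

Let inv_actE w f r : inv_act w f r = f (w^-1 * r * w) (+) inversions w r.
Proof.
have actM := presented_actM inv_stepP inv_actK inv_step_rel.
have act1 := presented_act1 inv_stepP inv_actK inv_step_rel.
have actl := presented_act_letter inv_stepP inv_actK inv_step_rel.
elim/cox_ind: w f r => [|s w IH] f r.
  by rewrite /inversions /inv_act !act1 // invg1 mul1g mulg1 addbF.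
rewrite /inversions /inv_act !actM // !actl // /inv_step /= -!/(inv_act _ _).
by rewrite IH -/(inversions w) -addbA invgM cgenV !mulgA.
Qed.

Lemma inversionsM u v r :
  inversions (u * v) r = inversions u r (+) inversions v (u^-1 * r * u).
Proof.
have actM := presented_actM inv_stepP inv_actK inv_step_rel.
by rewrite {1}/inversions /inv_act actM // -!/(inv_act _ _) inv_actE addbC.
Qed.

Lemma inversions1 r : inversions 1 r = false.
Proof. by rewrite /inversions /inv_act (presented_act1 inv_stepP inv_actK inv_step_rel). Qed.

Lemma inversions_gen s r : inversions (cgen s) r = (r == cgen s).
Proof.
by rewrite /inversions /inv_act (presented_act_letter inv_stepP inv_actK inv_step_rel).
Qed.

Lemma inversionsV w r : inversions w^-1 r = inversions w (w * r * w^-1).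
Proof.
have := inversionsM w^-1 w r; rewrite mulVg inversions1 invgK.
by case: (inversions _ _); case: (inversions _ _).
Qed.

Definition cprod (xs : seq Gamma) : W := foldr (fun x w => cgen x * w) 1 xs.

Lemma cprod_surj w : exists xs, w = cprod xs.
Proof. by elim/cox_ind: w => [|s w [xs ->]]; [exists [::]|exists (s :: xs)]. Qed.

(** A reflection that occurs an odd number of times occurs at least once, at a letter
    that the multiplication by this reflection deletes. *)
Lemma exchange xs r : inversions (cprod xs) r ->
  exists ys zs x, xs = ys ++ x :: zs /\ r * cprod xs = cprod (ys ++ zs).
Proof.
elim: xs r => [|x xs IH] r /=; first by rewrite inversions1.
rewrite inversionsM inversions_gen cgenV; case: eqVneq => [-> _|_ /=].
  by exists [::], xs, x; rewrite cgenKl.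
move=> /IH[ys [zs [y [-> E]]]]; exists (x :: ys), zs, y; split=> //=.
by rewrite -E !mulgA cgenK mul1g.
Qed.

Definition cox_parabolic X : set W := span [set cgen x | x in [set` X]].

Lemma cox_parabolicP X w : cox_parabolic X w <->
  exists2 xs, all [in X] xs & w = cprod xs.
Proof.
split=> [|[xs]].
  elim=> [|_ g [x Xx <-] _ [xs Xxs ->]|_ g [x Xx <-] _ [xs Xxs ->]].
  - by exists [::].
  - by exists (x :: xs) => //=; apply/andP.
  - by rewrite cgenV; exists (x :: xs) => //=; apply/andP.
elim: xs w => [|x xs IH] w /=; first by move=> _ ->; exact: Span1.
by move=> /andP[Xx Xxs] ->; apply: SpanM; [exists x|exact: IH Xxs _].
Qed.

Lemma cox_parabolic_gen X x : x \in X -> cox_parabolic X (cgen x).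
Proof. by move=> Xx; apply: span_in; exists x. Qed.

(** A shortest word for [u] in the letters of [X] starts with a left inversion:
    otherwise, the exchange property would shorten it. *)
Lemma descent X u : cox_parabolic X u -> u != 1 ->
  exists2 x, x \in X & inversions u (cgen x).
Proof.
move=> /cox_parabolicP Xu u1.
pose Q n := `[< exists xs, [/\ all [in X] xs, u = cprod xs & size xs = n] >].
have exQ : exists n, Q n by case: Xu => xs ? ?; exists (size xs); apply/asboolP; exists xs.
case: (ex_minnP exQ) => n /asboolP[xs [Xxs Eu sxs]] minn.
case: xs Xxs Eu sxs => [|x xs] /=; first by move=> _ E; rewrite E eqxx in u1.
move=> /andP[Xx Xxs] Eu sxs; exists x => //; apply/negPn/negP => Nx.
have : inversions (cprod xs) (cgen x).
  move: Nx; rewrite Eu inversionsM inversions_gen eqxx cgenV cgenKr.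
  by case: inversions.
move=> /exchange[ys [zs [y [Exs E]]]].
have : Q (size (ys ++ zs)).
  apply/asboolP; exists (ys ++ zs); split=> //; last by rewrite Eu E.
  by move: Xxs; rewrite Exs !all_cat /= => /and3P[-> _ ->].
move=> /minn; rewrite -sxs Exs !size_cat /=; lia.
Qed.

(** Minimal representatives of left cosets (resp. right cosets) of the standard
    parabolic subgroup, described by their inversions instead of their length. *)
Definition right_min X (w : W) := forall r, cox_parabolic X r -> inversions w^-1 r = false.
Definition left_min X (w : W) := forall r, cox_parabolic X r -> inversions w r = false.

(** An inversion in the parabolic subgroup would shorten an element of minimal length
    in the coset, by the exchange property. *)
Lemma left_min_exists X w :
  exists d w0, [/\ cox_parabolic X d, left_min X w0 & w = d * w0].
Proof.
pose Q n := `[< exists d xs, [/\ cox_parabolic X d, d * w = cprod xs & size xs = n] >].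
have exQ : exists n, Q n.
  have [xs E] := cprod_surj w; exists (size xs); apply/asboolP; exists 1, xs.
  by split=> //; [exact: Span1|rewrite mul1g].
case: (ex_minnP exQ) => n /asboolP[d [xs [Xd Edw sxs]]] minn.
exists d^-1, (d * w); split; [exact: span_inv| |by rewrite mulKg].
move=> r Xr; apply/negP; rewrite Edw => /exchange[ys [zs [y [Exs E]]]].
have : Q (size (ys ++ zs)).
  apply/asboolP; exists (r * d), (ys ++ zs); split=> //; first exact: span_mul.
  by rewrite -mulgA Edw.
move=> /minn; rewrite -sxs Exs !size_cat /=; lia.
Qed.

(** The first letter of [u^-1] given by [descent] would be an inversion of [(w u)^-1],
    to which [w^-1] contributes no inversion in the parabolic subgroup. *)
Lemma right_min_unique X w u : right_min X w -> cox_parabolic X u ->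
  right_min X (w * u) -> u = 1.
Proof.
move=> mw Xu mwu; apply/invg_inj; rewrite invg1; apply/eqP/negPn/negP => /descent.
case/(_ X (span_inv Xu)) => x Xx Ix; have := mwu _ (cox_parabolic_gen Xx).
rewrite invgM inversionsM Ix mw //.
by rewrite invgK; apply: span_mul; [apply: span_mul => //; exact: cox_parabolic_gen|exact: span_inv].
Qed.

Lemma inversions_conj s w r : inversions (w^-1 * cgen s) r
  = inversions w^-1 r (+) (r == w^-1 * cgen s * w).
Proof.
rewrite inversionsM invgK inversions_gen; congr (_ (+) _).
by apply/eqP/eqP => [<-|->]; rewrite !mulgA ?mulVg ?mulgV ?mul1g ?mulgVK ?mulgK.
Qed.

Lemma cgen_neq1 s : cgen s != 1.
Proof.
apply/eqP => E; have := inversions_gen s (cgen s).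
by rewrite eqxx {1}E inversions1.
Qed.

(** Such an element is its own first letter. *)
Lemma inversions_one_gen X u : cox_parabolic X u ->
  (forall r, cox_parabolic X r -> inversions u r = (r == u)) -> u != 1 ->
  exists2 x, x \in X & u = cgen x.
Proof.
move=> Xu Iu /(descent Xu)[x Xx]; rewrite Iu; last exact: cox_parabolic_gen.
by move=> /eqP <-; exists x.
Qed.

(** Both [s w] and [w u], for [u := w^-1 s w], are the same element; comparing
    the inversions of its inverse in the parabolic subgroup shows that [u] has no other one than itself. *)
Lemma right_min_fixed X w s : right_min X w -> cox_parabolic X (w^-1 * cgen s * w) ->
  exists2 x, x \in X & w^-1 * cgen s * w = cgen x.
Proof.
move=> mw Xu; set u := _ * w in Xu *.
have uK : u^-1 = u by rewrite /u !invgM invgK cgenV mulgA.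
apply: inversions_one_gen => // [r Xr|]; last first.
  apply/eqP => E; have := cgen_neq1 s; have -> : cgen s = w * u * w^-1.
    by rewrite /u !mulgA mulgV mul1g mulgK.
  by rewrite E mulg1 mulgV eqxx.
have := inversions_conj s w r; rewrite mw // addFb -/u => <-.
have -> : w^-1 * cgen s = u * w^-1 by rewrite /u mulgK.
rewrite inversionsM mw ?addbF //.
by apply: span_mul => //; apply: span_mul => //; exact: span_inv.
Qed.

Lemma right_min_step X w s : right_min X w -> ~ cox_parabolic X (w^-1 * cgen s * w) ->
  right_min X (cgen s * w).
Proof.
move=> mw Xu r Xr; rewrite invgM cgenV inversions_conj mw //=.
by apply/eqP => E; apply: Xu; rewrite -E.
Qed.

Lemma inversions_parabolic X u r : cox_parabolic X u -> inversions u r ->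
  cox_parabolic X r.
Proof.
move=> /cox_parabolicP[xs Xxs ->].
elim: xs r Xxs => [|x xs IH] r /=; first by rewrite inversions1.
move=> /andP[Xx Xxs]; rewrite inversionsM inversions_gen cgenV.
case: eqVneq => [-> _|_ /= /IH]; first exact: cox_parabolic_gen.
move=> /(_ Xxs); have Hx := cox_parabolic_gen Xx.
by move=> /(spanMr _ Hx)/(spanMl _ Hx).
Qed.

Lemma cgen_parabolic X s : cox_parabolic X (cgen s) -> exists2 x, x \in X & cgen s = cgen x.
Proof.
by move=> Xs; apply: inversions_one_gen => // [r _|]; rewrite ?inversions_gen // cgen_neq1.
Qed.

End CoxeterGroup.

(** * Orders of products of generators *)

Section CoxeterOrders.
Variables (R : realType) (Gamma : labeled_graph).
Local Open Scope group_scope.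
Implicit Types (s t x y : Gamma).
Local Notation W := (coxeter_group Gamma).

Lemma root_reflection_rel m0 u v : (2 <= m0)%N -> cox_rel u v -> forall f : Gamma -> R, True ->
  foldr (fun l => root_reflection m0 l.1) f u = foldr (fun l => root_reflection m0 l.1) f v.
Proof.
move=> m02; case=> {u v} [u v [s t st]|s] f _; last exact: root_reflectionK.
rewrite !foldr_alternating /= [LHS]alt_iter_rotation; try exact: root_reflectionK.
rewrite -[RHS](rotation_order m02 (edge_neq st)); congr (iter _ _ _).
by rewrite /cox_order st.
Qed.

(** The product already has this order in the geometric representation. *)
Lemma cgen_expg_neq1 m0 s t j : (2 <= m0)%N -> s != t ->
  (0 < j < cox_order m0 s t)%N -> (cgen s * cgen t) ^+ j <> 1.
Proof.
move=> m02 st j_lt E; pose f (l : Gamma * bool) := @root_reflection R Gamma m0 l.1.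
have fP (l : Gamma * bool) (v : Gamma -> R) : True -> True by [].
have fK s' b (v : Gamma -> R) : True -> f (s', b) (f (s', ~~ b) v) = v.
  by move=> _; exact: root_reflectionK.
have frel u v : cox_rel u v -> forall g, True -> foldr f g u = foldr f g v.
  exact: root_reflection_rel.
have [v []] := rotation_neq R m02 st j_lt.
rewrite -[RHS](presented_act1 fP fK frel I) -E.
elim: (j) => [|i IH] /=; first by rewrite expg0 (presented_act1 fP fK frel).
rewrite IH expgS !(presented_actM fP fK frel) //.
by rewrite !(presented_act_letter fP fK frel).
Qed.

Lemma cgen_inj : injective (@cgen Gamma).
Proof.
move=> s t E; apply/eqP/negPn/negP => st.
apply: (@cgen_expg_neq1 2 s t 1 isT st); last by rewrite expg1 E cgenK.
by rewrite /= cox_order_ge2.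
Qed.

Lemma edge_expg_neq1 s t j : [set s; t]%SET \in edges Gamma ->
  (0 < j < label [set s; t]%SET)%N -> (cgen s * cgen t) ^+ j <> 1.
Proof.
move=> st jm; apply: (@cgen_expg_neq1 2) => //; first exact: edge_neq.
by rewrite /cox_order st.
Qed.

Lemma edge_expg_inj s t i j : [set s; t]%SET \in edges Gamma ->
  (i < label [set s; t]%SET)%N -> (j < label [set s; t]%SET)%N ->
  (cgen s * cgen t) ^+ i = (cgen s * cgen t) ^+ j -> i = j.
Proof.
move=> st; wlog ij : i j / (i <= j)%N.
  move=> Hw im jm E; have /orP[ij|ji] := leq_total i j; first exact: Hw.
  by apply/esym/Hw.
move=> im jm E; apply/eqP; rewrite eqn_leq ij /= -subn_eq0 -leqn0 leqNgt.
apply/negP => d0; apply: (@edge_expg_neq1 s t (j - i) st); first lia.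
by rewrite expgnFr // E mulgV.
Qed.

(** Conjugation in the Coxeter group preserves the order of a product of two
    generators, and this order determines whether they span an edge, and its label:
    if they do not, the representation where non-edges have order larger than
    the label separates them. *)
Lemma edge_conj s t x y u : [set s; t]%SET \in edges Gamma ->
  u^-1 * cgen s * u = cgen x -> u^-1 * cgen t * u = cgen y ->
  [set x; y]%SET \in edges Gamma /\ label [set x; y]%SET = label [set s; t]%SET.
Proof.
move=> st Ex Ey; set m := label [set s; t]%SET.
have Exy j : (cgen x * cgen y) ^+ j = u^-1 * (cgen s * cgen t) ^+ j * u.
  rewrite -Ex -Ey; elim: j => [|j IH]; first by rewrite !expg0 mulg1 mulVg.
  by rewrite !expgS IH !mulgA !mulgK.
have Exy1 j : (cgen x * cgen y) ^+ j = 1 <-> (cgen s * cgen t) ^+ j = 1.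
  rewrite Exy; split=> [E|->]; last by rewrite mulg1 mulVg.
  have := congr1 (fun z => u * z * u^-1) E.
  by rewrite mulg1 mulgV !mulgA mulgV mul1g mulgK.
have m2 : (2 <= m)%N by exact: label_ge2.
have xy : x != y.
  apply/eqP => E; move: (Exy1 1%N); rewrite !expg1 E cgenK => -[/(_ erefl) H _].
  by apply: (@edge_expg_neq1 s t 1%N st); rewrite ?expg1.
have m1 : (2 <= m.+1)%N by lia.
have xyE : [set x; y]%SET \in edges Gamma.
  apply/negPn/negP => nxy; apply: (@cgen_expg_neq1 m.+1 x y m m1 xy).
    by rewrite /cox_order (negbTE nxy) ltnSn andbT; lia.
  exact/Exy1/cgen_order.
split=> //; apply/eqP; rewrite eqn_leq; apply/andP; split; rewrite leqNgt; apply/negP => lt.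
- apply: (@edge_expg_neq1 x y m xyE); first by rewrite lt andbT; lia.
  exact/Exy1/cgen_order.
- apply: (@edge_expg_neq1 s t _ st); last exact/Exy1/cgen_order/xyE.
  by rewrite lt andbT; have := label_ge2 xyE; lia.
Qed.

End CoxeterOrders.

Section ArtinToCoxeter.
Variable Gamma : labeled_graph.
Local Open Scope group_scope.
Local Notation A := (artin_group Gamma).
Local Notation W := (coxeter_group Gamma).

Lemma artin_cox_eq u v : word_eq (@artin_rel Gamma) u v -> word_eq (@cox_rel Gamma) u v.
Proof.
elim=> {u v} [u|u v _|u v w _ IH1 _|u u' v v' _ IH1 _|s b|u v uv].
- exact: WordRefl.
- exact: WordSym.
- exact: WordTrans.
- exact: WordCat.
- exact: WordCancel.
- exact/WordRel/CoxArtin.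
Qed.

Definition artin_to_cox (g : A) : W := word_class (@cox_rel Gamma) (word_repr g).

Lemma artin_to_cox_class u :
  artin_to_cox (word_class (@artin_rel Gamma) u) = word_class (@cox_rel Gamma) u.
Proof. exact/word_classP/artin_cox_eq/word_repr_class. Qed.

Lemma artin_to_cox1 : artin_to_cox 1 = 1.
Proof. by rewrite -word_class_nil artin_to_cox_class. Qed.

Lemma artin_to_cox_gen s : artin_to_cox (artin_gen s) = cgen s.
Proof. exact: artin_to_cox_class. Qed.

Lemma artin_ind (P : A -> Prop) : P 1 ->
  (forall s g, P g -> P (artin_gen s * g)) ->
  (forall s g, P g -> P ((artin_gen s)^-1 * g)) -> forall g, P g.
Proof. exact: presented_ind. Qed.

Lemma standard_parabolicE (X : {set Gamma}) :
  standard_parabolic X = span [set artin_gen x | x in [set` X]].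
Proof. exact: generatedE. Qed.

Lemma standard_parabolic_gen (X : {set Gamma}) x : x \in X ->
  standard_parabolic X (artin_gen x).
Proof. by move=> Xx; rewrite standard_parabolicE; apply: span_in; exists x. Qed.

Lemma standard_parabolic_ind (X : {set Gamma}) (P : A -> Prop) : P 1 ->
  (forall s g, s \in X -> P g -> P (artin_gen s * g)) ->
  (forall s g, s \in X -> P g -> P ((artin_gen s)^-1 * g)) ->
  forall g, standard_parabolic X g -> P g.
Proof.
move=> P1 PM PV g; rewrite standard_parabolicE.
by elim=> // [_ k [x Xx <-] _|_ k [x Xx <-] _]; [exact: PM|exact: PV].
Qed.

Lemma artin_alternating s t : [set s; t]%SET \in edges Gamma ->
  alt_iter ( *%g (artin_gen s)) ( *%g (artin_gen t)) (label [set s; t]%SET) 1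
  = alt_iter ( *%g (artin_gen t)) ( *%g (artin_gen s)) (label [set s; t]%SET) 1 :> A.
Proof.
have E n a b : alt_iter ( *%g (artin_gen a)) ( *%g (artin_gen b)) n 1
    = word_class (@artin_rel Gamma) (Defs.alternating a b n) :> A.
  by elim: n a b => //= n IH a b; rewrite alternatingS word_class_cons IH.
by move=> st; rewrite !E; apply/word_classP/WordRel/ArtinRel.
Qed.

End ArtinToCoxeter.

(** * Retraction of an Artin group onto a standard parabolic subgroup *)

Section Zigzag.
Variable T : Type.

(** The alternating composite seen from its innermost map, which is always [f]; the
    outermost one depends on the parity of [n]. *)
Fixpoint zigzag (f g : T -> T) n x :=
  if n is n'.+1 then (if odd n' then g else f) (zigzag f g n' x) else x.

Lemma alt_iter_zigzag f g n x :
  alt_iter f g n x = if odd n then zigzag f g n x else zigzag g f n x.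
Proof. by elim: n f g => //= n IH f g; rewrite IH; case: (odd n). Qed.

End Zigzag.

Lemma zigzagSr (T : Type) (f g : T -> T) n x : zigzag f g n.+1 x = zigzag g f n (f x).
Proof. by elim: n => // n IH; rewrite [LHS]/= -/(zigzag f g n.+1 x) IH /=; case: (odd n). Qed.

Section ReflectionSequence.
Variable Gamma : labeled_graph.
Local Open Scope group_scope.
Implicit Types (s t : Gamma).
Local Notation W := (coxeter_group Gamma).

Definition dihedral_refl s t i : W := (cgen s * cgen t) ^+ i * cgen s.

Definition zigzag_elt s t n : W := zigzag ( *%g (cgen s)) ( *%g (cgen t)) n 1.

Lemma zigzagM s t n w : zigzag ( *%g (cgen s)) ( *%g (cgen t)) n w = zigzag_elt s t n * w.
Proof.
rewrite /zigzag_elt; elim: n => [|n /= ->]; first by rewrite mul1g.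
by case: (odd n); rewrite mulgA.
Qed.

(** The letter added at step [n] is the conjugate of the palindrome of that rank,
    whatever the parity of [n]. *)
Lemma zigzag_refl s t n :
  (zigzag_elt s t n)^-1 * cgen (if odd n then t else s) * zigzag_elt s t n
  = dihedral_refl s t n.
Proof.
elim: n s t => [|n IH] s t.
  by rewrite /dihedral_refl expg0 /zigzag_elt /= invg1 mulg1.
have -> : zigzag_elt s t n.+1 = zigzag_elt t s n * cgen s.
  by rewrite /zigzag_elt zigzagSr mulg1 -[LHS]/(zigzag _ _ n _) zigzagM.
have -> : (if odd n.+1 then t else s) = (if odd n then s else t) by rewrite /=; case: odd.
have shift i : cgen s * (cgen t * cgen s) ^+ i = (cgen s * cgen t) ^+ i * cgen s.
  elim: i => [|i IHi]; first by rewrite !expg0 mulg1 mul1g.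
  by rewrite [in RHS]expgS -[RHS]mulgA -IHi [in LHS]expgS !mulgA.
rewrite invgM cgenV !mulgA -2!(mulgA (cgen s)) IH.
by rewrite /dihedral_refl mulgA shift expgSr !mulgA.
Qed.

End ReflectionSequence.

Section Dihedral.
Variables (R : realType) (Gamma : labeled_graph).
Local Open Scope group_scope.
Local Notation W := (coxeter_group Gamma).
Variables (s t : Gamma).
Hypothesis st : [set s; t]%SET \in edges Gamma.
Local Notation m := (label [set s; t]%SET).
Local Notation D := [set s; t]%SET.

Let tsV i : (cgen t * cgen s) ^+ i = ((cgen s * cgen t) ^+ i)^-1 :> W.
Proof. by rewrite -expVgn invgM !cgenV. Qed.

Let s_exp i : cgen s * (cgen s * cgen t) ^+ i = (cgen t * cgen s) ^+ i * cgen s :> W.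
Proof.
elim: i => [|i IH]; first by rewrite !expg0 mulg1 mul1g.
by rewrite expgS -mulgA cgenKl [in RHS]expgS -[RHS]mulgA -IH !mulgA cgenKr.
Qed.

Let exp_mod i : (cgen s * cgen t) ^+ i = (cgen s * cgen t) ^+ (i %% m) :> W.
Proof. by rewrite {1}(divn_eq i m) expgnDr mulnC expgnA cgen_order // expg1n mul1g. Qed.

Let m_gt0 : (0 < m)%N. Proof. exact: leq_trans (label_ge2 st). Qed.

Let ts_exp i : (cgen t * cgen s) ^+ i = (cgen s * cgen t) ^+ (m.-1 * i) :> W.
Proof.
rewrite tsV; apply/mulg1_eq; rewrite -expgnDr -mulSn prednK //.
by rewrite expgnA cgen_order // expg1n.
Qed.

Lemma dihedral_refl_last : dihedral_refl s t m.-1 = cgen t.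
Proof.
apply/invg_inj; rewrite cgenV; apply/mulg1_eq; rewrite /dihedral_refl -mulgA -expgSr.
by rewrite prednK // cgen_order.
Qed.

Lemma dihedral_refl_inj i j : (i < m)%N -> (j < m)%N ->
  dihedral_refl s t i = dihedral_refl s t j -> i = j.
Proof. by move=> im jm /mulIg; exact: (edge_expg_inj R st). Qed.

Lemma dihedral_refl_in i : cox_parabolic D (dihedral_refl s t i).
Proof.
have Ds : cox_parabolic D (cgen s) by apply: cox_parabolic_gen; rewrite !inE eqxx.
have Dt : cox_parabolic D (cgen t) by apply: cox_parabolic_gen; rewrite !inE eqxx orbT.
apply: span_mul => //; elim: i => [|i IH]; first exact: Span1.
by rewrite expgS; apply: span_mul => //; exact: span_mul.
Qed.

Lemma dihedral_reflC i : (i < m)%N -> dihedral_refl s t i = dihedral_refl t s (m.-1 - i).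
Proof.
move=> im.
have -> : dihedral_refl t s (m.-1 - i)
    = (cgen t * cgen s) ^+ (m.-1 - i) * dihedral_refl s t m.-1.
  by rewrite dihedral_refl_last.
rewrite /dihedral_refl mulgA; congr (_ * _); rewrite tsV.
apply: (mulgI ((cgen s * cgen t) ^+ (m.-1 - i))).
by rewrite mulgA mulgV mul1g -expgnDr subnK // -ltnS prednK.
Qed.

(** The palindromes are all the reflections of the dihedral group, so it permutes them
    by conjugation. *)
Lemma dihedral_refl_conj d i : cox_parabolic D d ->
  exists2 j, (j < m)%N & d^-1 * dihedral_refl s t i * d = dihedral_refl s t j.
Proof.
move=> Dd; suff [j ->] : exists j, d^-1 * dihedral_refl s t i * d = dihedral_refl s t j.
  by exists (j %% m)%N; rewrite ?ltn_mod // /dihedral_refl -exp_mod.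
have cs j : exists k, cgen s * dihedral_refl s t j * cgen s = dihedral_refl s t k.
  exists (m.-1 * j)%N; rewrite /dihedral_refl mulgA cgenKr s_exp ts_exp //.
have ct j : exists k, cgen t * dihedral_refl s t j * cgen t = dihedral_refl s t k.
  exists (m.-1 + m.-1 * j.+1)%N; rewrite /dihedral_refl expgnDr -ts_exp.
  by rewrite -!mulgA -s_exp -expgSr -{1}dihedral_refl_last /dihedral_refl -!mulgA.
have [xs Dxs ->] := (cox_parabolicP _ _).1 Dd; elim: xs i Dxs => [|x xs IH] i /=.
  by exists i; rewrite invg1 mul1g mulg1.
rewrite !inE invgM cgenV => /andP[/orP[/eqP->|/eqP->] Dxs].
- by have [k E] := cs i; have [l El] := IH k Dxs; exists l; rewrite -El -E !mulgA.
- by have [k E] := ct i; have [l El] := IH k Dxs; exists l; rewrite -El -E !mulgA.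
Qed.

End Dihedral.

Section DihedralCosets.
Variables (R : realType) (Gamma : labeled_graph) (X : {set Gamma}).
Local Open Scope group_scope.
Implicit Types (s t : Gamma).
Local Notation W := (coxeter_group Gamma).
Local Notation fixed w r := (cox_parabolic X (w^-1 * r * w)).

(** Comparing the inversions of [r w = w x] inside the dihedral group, where [w] has
    none, shows that [r] is its own only inversion there. *)
Lemma both_min_refl s t (w r : W) x :
  left_min [set s; t]%SET w -> cox_parabolic [set s; t]%SET r ->
  w^-1 * r * w = cgen x -> r = cgen s \/ r = cgen t.
Proof.
move=> mw Dr Ex; have wx : w * cgen x = r * w.
  by rewrite -Ex !mulgA mulgV mul1g.
have Iq q : cox_parabolic [set s; t]%SET q -> inversions r q = (q == r).
  move=> Dq; have := inversionsM w (cgen x) q; rewrite wx inversionsM !mw //; last first.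
    by apply: span_mul => //; apply: span_mul => //; exact: span_inv.
  rewrite addbF addFb inversions_gen => ->; rewrite -Ex.
  by apply/eqP/eqP => [/mulIg/mulgI|->].
have r1 : r != 1.
  by apply/eqP => r1; have := cgen_neq1 x; rewrite -Ex r1 mulg1 mulVg eqxx.
have [y] := inversions_one_gen Dr Iq r1.
by rewrite !inE => /orP[]/eqP -> ->; [left|right].
Qed.

(** Apply [s], [t], [s], ... to [w]: as long as the coset moves, the representative
    stays minimal.  The first letter that fixes a coset acts as a generator, so
    its palindrome is [s] or [t] by [both_min_refl]; it is not [s], and [t] is the last
    palindrome. *)
Lemma fixed_dihedral_last s t (w : W) j : [set s; t]%SET \in edges Gamma ->
  left_min [set s; t]%SET w -> right_min X w -> ~ fixed w (cgen s) ->
  (j < label [set s; t]%SET)%N -> fixed w (dihedral_refl s t j) ->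
  j = (label [set s; t]%SET).-1.
Proof.
move=> st lw rw ns jm Kj; set m := label _.
have exK : exists i, `[< fixed w (dihedral_refl s t i) >] by exists j; apply/asboolP.
case: (ex_minnP exK) => i /asboolP Ki mini.
have ij : (i <= j)%N by apply/mini/asboolP.
have conj n : (zigzag_elt s t n * w)^-1 * cgen (if odd n then t else s)
    * (zigzag_elt s t n * w) = w^-1 * dihedral_refl s t n * w.
  by rewrite -zigzag_refl invgM !mulgA.
have rmin n : (n <= i)%N -> right_min X (zigzag_elt s t n * w).
  elim: n => [|n IH] ni; first by rewrite mul1g.
  have -> : zigzag_elt s t n.+1 = cgen (if odd n then t else s) * zigzag_elt s t n.
    by rewrite /zigzag_elt /=; case: odd.
  rewrite -mulgA; apply: right_min_step; first exact/IH/ltnW.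
  by rewrite conj => /asboolP/mini; rewrite leqNgt ni.
have [x _] : exists2 x, x \in X & w^-1 * dihedral_refl s t i * w = cgen x.
  by rewrite -conj; apply: right_min_fixed; [exact: rmin|rewrite conj].
move=> /(both_min_refl lw (dihedral_refl_in s t i))[] E.
  by case: ns; rewrite -E.
have im : i = m.-1.
  apply: (dihedral_refl_inj R st); rewrite ?dihedral_refl_last // -/m.
    exact: leq_ltn_trans ij jm.
  by rewrite prednK //; exact: leq_trans (label_ge2 st).
by apply/eqP; rewrite eqn_leq -{2}im ij andbT -ltnS prednK //; exact: leq_trans (label_ge2 st).
Qed.

(** Up to an element of the dihedral group, which permutes its reflections, [w] is also
    minimal on the left.  Then, if [s] or [t] does not fix the coset, only the other
    one can, by [fixed_dihedral_last]. *)
Lemma fixed_dihedral s t (w : W) i j : [set s; t]%SET \in edges Gamma ->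
  right_min X w -> (i < j < label [set s; t]%SET)%N ->
  fixed w (dihedral_refl s t i) -> fixed w (dihedral_refl s t j) ->
  fixed w (cgen s) /\ fixed w (cgen t).
Proof.
move=> st rw /andP[ij jm] Ki Kj; have im := ltn_trans ij jm.
have [d [v [Dd lv Ew]]] := left_min_exists [set s; t]%SET w; rewrite Ew in rw Ki Kj *.
have rv : right_min X v.
  move=> r Xr; apply/negP => Ir; have := rw r Xr.
  rewrite invgM inversionsM Ir invgK addTb => /negbFE/(inversions_parabolic (span_inv Dd)).
  by move=> Dr; move: Ir; rewrite inversionsV lv.
have cj r : (d * v)^-1 * r * (d * v) = v^-1 * (d^-1 * r * d) * v.
  by rewrite invgM !mulgA.
rewrite !cj in Ki Kj *.
have [i' i'm Ei] := dihedral_refl_conj st i Dd.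
have [j' j'm Ej] := dihedral_refl_conj st j Dd.
rewrite Ei in Ki; rewrite Ej in Kj.
have neq : i' <> j'.
  move=> E; move: ij; suff -> : i = j by rewrite ltnn.
  by apply: (dihedral_refl_inj R st) => //; apply: (mulgI d^-1); apply: (mulIg d); rewrite Ei Ej E.
have Ks : fixed v (cgen s).
  apply: contrapT => ns; apply: neq.
  by rewrite (fixed_dihedral_last st lv rv ns i'm Ki) (fixed_dihedral_last st lv rv ns j'm Kj).
have Kt : fixed v (cgen t).
  apply: contrapT => nt; have E := finset.setUC [set s]%SET [set t]%SET.
  have ts : [set t; s]%SET \in edges Gamma by rewrite -E.
  have lv' : left_min [set t; s]%SET v by rewrite -E.
  have m0 : (0 < label [set s; t]%SET)%N by exact: leq_trans (label_ge2 st).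
  apply: neq; rewrite (dihedral_reflC st i'm) in Ki; rewrite (dihedral_reflC st j'm) in Kj.
  have := fixed_dihedral_last ts lv' rv nt _ Ki; have := fixed_dihedral_last ts lv' rv nt _ Kj.
  rewrite -E; lia.
have Kd r : cox_parabolic [set s; t]%SET r -> fixed v r.
  elim=> [|_ k [x xD <-] _ IH|_ k [x xD <-] _ IH]; rewrite ?cgenV.
  - by rewrite mulg1 mulVg; exact: Span1.
  - have -> : v^-1 * (cgen x * k) * v = (v^-1 * cgen x * v) * (v^-1 * k * v).
      by rewrite !mulgA mulgK.
    by apply: span_mul => //; move: xD; rewrite /= !inE => /orP[]/eqP->.
  - have -> : v^-1 * (cgen x * k) * v = (v^-1 * cgen x * v) * (v^-1 * k * v).
      by rewrite !mulgA mulgK.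
    by apply: span_mul => //; move: xD; rewrite /= !inE => /orP[]/eqP->.
have Kc x : x \in [set s; t]%SET -> fixed v (d^-1 * cgen x * d).
  move=> xD; apply: Kd; apply: span_mul => //; apply: span_mul; first exact: span_inv.
  exact: cox_parabolic_gen.
by split; apply: Kc; rewrite !inE eqxx ?orbT.
Qed.

End DihedralCosets.

Section Retraction.
Variables (R : realType) (Gamma : labeled_graph) (X : {set Gamma}).
Local Open Scope group_scope.
Implicit Types (s t : Gamma).
Local Notation W := (coxeter_group Gamma).
Local Notation A := (artin_group Gamma).
Local Notation fixed w r := (cox_parabolic X (w^-1 * r * w)).

Definition artin_letter (s : Gamma) (b : bool) : A :=
  if b then artin_gen s else (artin_gen s)^-1.

(** A letter either moves the coset represented by [p.1] or fixes it, and then it is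
    recorded in [p.2] as the generator by which it acts on the representative. *)
Definition coset_step (l : Gamma * bool) (p : W * A) : W * A :=
  if [pick x in X | cgen x == p.1^-1 * cgen l.1 * p.1] is Some x
  then (p.1, artin_letter x l.2 * p.2) else (cgen l.1 * p.1, p.2).

Definition coset_state (p : W * A) := right_min X p.1 /\ standard_parabolic X p.2.

Lemma coset_step_fixed s b p x : x \in X -> cgen x = p.1^-1 * cgen s * p.1 ->
  coset_step (s, b) p = (p.1, artin_letter x b * p.2).
Proof.
move=> Xx Ex; rewrite /coset_step /=; case: pickP => [y /andP[_ /eqP]|/(_ x)].
  by rewrite -Ex => /(cgen_inj R) ->.
by rewrite Xx Ex eqxx.
Qed.

Lemma coset_step_moved s b p : ~ fixed p.1 (cgen s) ->
  coset_step (s, b) p = (cgen s * p.1, p.2).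
Proof.
move=> ns; rewrite /coset_step /=; case: pickP => [y /andP[Xy /eqP E]|//].
by case: ns; rewrite -E; exact: cox_parabolic_gen.
Qed.

Lemma coset_stepP l p : coset_state p -> coset_state (coset_step l p).
Proof.
case: l p => s b [w a] [/= rw Xa]; have [Ks|ns] := EM (fixed w (cgen s)).
  have [x Xx Ex] := right_min_fixed rw Ks.
  rewrite (coset_step_fixed b (x := x)) //; split=> //=.
  move: Xa; rewrite standard_parabolicE => Xa; apply: span_mul => //.
  by case: b; [apply: span_in|apply: span_inV]; exists x.
by rewrite coset_step_moved //; split=> //=; exact: right_min_step.
Qed.

Lemma coset_stepK s b p : coset_state p -> coset_step (s, b) (coset_step (s, ~~ b) p) = p.
Proof.
case: p => w a [/= rw Xa]; have [Ks|ns] := EM (fixed w (cgen s)).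
  have [x Xx Ex] := right_min_fixed rw Ks.
  rewrite (coset_step_fixed (~~ b) (x := x)) //= (coset_step_fixed b (x := x)) //=.
  by case: b; rewrite /= ?mulVKg ?mulKg.
rewrite coset_step_moved //= coset_step_moved /= ?cgenKl //.
by rewrite invgM cgenV -!mulgA cgenKl mulgA.
Qed.

(** From a state that the two letters do not both fix, at most one letter is recorded
    along an alternating word not longer than the label, by [fixed_dihedral].  The
    product of the state and of the recorded element in the Coxeter group
    is carried along. *)
Lemma zigzag_coset_state s t (w : W) (a : A) n : [set s; t]%SET \in edges Gamma ->
  right_min X w -> ~ (fixed w (cgen s) /\ fixed w (cgen t)) ->
  (n <= label [set s; t]%SET)%N ->
  exists v k, [/\ zigzag (coset_step (s, true)) (coset_step (t, true)) n (w, a) = (v, k * a),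
     right_min X v, zigzag_elt s t n * w = v * artin_to_cox k
   & (k = 1 /\ forall i, (i < n)%N -> ~ fixed w (dihedral_refl s t i)) \/
     (exists i x, [/\ (i < n)%N, fixed w (dihedral_refl s t i), x \in X & k = artin_gen x])].
Proof.
move=> st rw nst; elim: n => [|n IH] nm.
  exists w, 1; rewrite mul1g artin_to_cox1 mulg1 mul1g; split=> //; left; split=> // i ilt; by [].
have [v [k [E rv Ek Hk]]] := IH (ltnW nm).
have Xk : cox_parabolic X (artin_to_cox k).
  case: Hk => [[-> _]|[_ [x [_ _ Xx ->]]]]; first by rewrite artin_to_cox1; exact: Span1.
  by rewrite artin_to_cox_gen; exact: cox_parabolic_gen.
set l := if odd n then t else s.
have Ez : zigzag_elt s t n.+1 = cgen l * zigzag_elt s t n by rewrite /zigzag_elt /l /=; case: odd.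
have Es : zigzag (coset_step (s, true)) (coset_step (t, true)) n.+1 (w, a)
    = coset_step (l, true) (v, k * a) by rewrite -E /l /=; case: odd.
have Ev : v = zigzag_elt s t n * w * (artin_to_cox k)^-1 by rewrite Ek mulgK.
have Ef : v^-1 * cgen l * v
    = artin_to_cox k * (w^-1 * dihedral_refl s t n * w) * (artin_to_cox k)^-1.
  by rewrite Ev -zigzag_refl !invgM !invgK !mulgA.
have Kf : fixed v (cgen l) <-> fixed w (dihedral_refl s t n).
  rewrite Ef; split=> [|H].
    by move=> /(spanMr _ (span_inv Xk))/(spanMl _ Xk).
  by apply: span_mul; [apply: span_mul|apply: span_inv].
rewrite Es Ez; have [Kl|nl] := EM (fixed v (cgen l)).
  have [x Xx Ex] := right_min_fixed rv Kl.
  have k1 : k = 1.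
    case: Hk => [[]//|[i [y [ilt Ki _ _]]]]; case: nst.
    apply: (fixed_dihedral R st rw _ Ki (Kf.1 Kl)); lia.
  exists v, (artin_gen x); rewrite (coset_step_fixed true (x := x)) //= k1 mul1g; split=> //.
    by rewrite artin_to_cox_gen -Ex -!mulgA Ek k1 artin_to_cox1 mulg1 !mulgA mulgV mul1g.
  by right; exists n, x; split=> //; exact/Kf.
exists (cgen l * v), k; rewrite coset_step_moved //=; split=> //.
- exact: right_min_step.
- by rewrite -!mulgA Ek.
- case: Hk => [[k1 Hn]|[i [x [ilt Ki Xx Ek']]]]; last first.
    by right; exists i, x; split=> //; exact: leq_trans ilt _.
  by left; split=> // i; rewrite ltnS leq_eqVlt => /orP[/eqP-> /Kf //|]; exact: Hn.
Qed.

(** If both letters fix the coset, what is recorded is the braid relation between the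
    generators by which they act, which have the same label by [edge_conj].
    Otherwise at most one generator is recorded, and it is determined by its image in
    the Coxeter group, where the two alternating words are equal. *)
Lemma coset_step_zigzag s t p : [set s; t]%SET \in edges Gamma -> coset_state p ->
  zigzag (coset_step (s, true)) (coset_step (t, true)) (label [set s; t]%SET) p
  = zigzag (coset_step (t, true)) (coset_step (s, true)) (label [set s; t]%SET) p.
Proof.
move=> st; case: p => w a [/= rw Xa]; set m := label _.
have [[Ks Kt]|nst] := EM (fixed w (cgen s) /\ fixed w (cgen t)).
  have [x Xx Ex] := right_min_fixed rw Ks; have [y Xy Ey] := right_min_fixed rw Kt.
  have [xyE Exy] := edge_conj R st Ex Ey.
  have E n f g : (forall k, f (w, k) = (w, artin_gen x * k)) ->
      (forall k, g (w, k) = (w, artin_gen y * k)) ->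
      zigzag f g n (w, a) = (w, zigzag ( *%g (artin_gen x)) ( *%g (artin_gen y)) n a).
    by move=> Ef Eg; elim: n => //= n ->; case: odd.
  have fx k : coset_step (s, true) (w, k) = (w, artin_gen x * k).
    by rewrite (coset_step_fixed true (x := x)).
  have fy k : coset_step (t, true) (w, k) = (w, artin_gen y * k).
    by rewrite (coset_step_fixed true (x := y)).
  have E' n f g : (forall k, f (w, k) = (w, artin_gen y * k)) ->
      (forall k, g (w, k) = (w, artin_gen x * k)) ->
      zigzag f g n (w, a) = (w, zigzag ( *%g (artin_gen y)) ( *%g (artin_gen x)) n a).
    by move=> Ef Eg; elim: n => //= n ->; case: odd.
  rewrite (E _ _ _ fx fy) (E' _ _ _ fy fx); congr (_, _).
  have := artin_alternating xyE; rewrite Exy -/m => H.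
  have := congr1 (fun z => z * a) H; rewrite -!alt_iterM mul1g !alt_iter_zigzag.
  by case: ifP.
have Es := finset.setUC [set s]%SET [set t]%SET.
have ts : [set t; s]%SET \in edges Gamma by rewrite -Es.
have nts : ~ (fixed w (cgen t) /\ fixed w (cgen s)) by move=> [? ?]; apply: nst.
have [v1 [k1 [E1 rv1 F1 H1]]] := zigzag_coset_state a st rw nst (leqnn _).
have := zigzag_coset_state a ts rw nts (leqnn _); rewrite -Es => -[v2 [k2 [E2 rv2 F2 H2]]].
rewrite E1 E2.
have G : zigzag_elt s t m = zigzag_elt t s m.
  have := word_class_alternating s t m; have := word_class_alternating t s m.
  have -> : word_class (@cox_rel Gamma) (Defs.alternating t s m)
      = word_class (@cox_rel Gamma) (Defs.alternating s t m).
    by apply/word_classP/WordSym/WordRel/CoxArtin; exact: ArtinRel.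
  by move=> ->; rewrite !alt_iter_zigzag /zigzag_elt; case: ifP.
have {}H1 : k1 = 1 \/ exists2 x, x \in X & k1 = artin_gen x.
  by case: H1 => [[-> _]|[i [x [_ _ Xx ->]]]]; [left|right; exists x].
have {}H2 : k2 = 1 \/ exists2 x, x \in X & k2 = artin_gen x.
  by case: H2 => [[-> _]|[i [x [_ _ Xx ->]]]]; [left|right; exists x].
have Xk k : k = 1 \/ (exists2 x, x \in X & k = artin_gen x) -> cox_parabolic X (artin_to_cox k).
  case=> [->|[x Xx ->]]; first by rewrite artin_to_cox1; exact: Span1.
  by rewrite artin_to_cox_gen; exact: cox_parabolic_gen.
have Ev : v2 = v1 * (artin_to_cox k1 * (artin_to_cox k2)^-1) by rewrite mulgA -F1 G F2 mulgK.
have u1 : artin_to_cox k1 * (artin_to_cox k2)^-1 = 1.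
  apply: (right_min_unique rv1); last by rewrite -Ev.
  by apply: span_mul; [exact: Xk|apply/span_inv/Xk].
rewrite Ev u1 mulg1; congr (_, _ * _).
have {u1} : artin_to_cox k1 = artin_to_cox k2 by exact: divg1_eq u1.
case: H1 H2 => [->|[x Xx ->]] [->|[y Xy ->]]; rewrite ?artin_to_cox1 ?artin_to_cox_gen //.
- by move=> /esym/eqP; rewrite (negbTE (cgen_neq1 _)).
- by move=> /eqP; rewrite (negbTE (cgen_neq1 _)).
- by move=> /(cgen_inj R) ->.
Qed.

End Retraction.

Section ParabolicSubgroups.
Variables (R : realType) (Gamma : labeled_graph).
Local Open Scope group_scope.
Implicit Types (s t x y : Gamma) (X Y Z : {set Gamma}).
Local Notation W := (coxeter_group Gamma).
Local Notation A := (artin_group Gamma).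
Implicit Types (g h a : A).

Section CosetAction.
Variable X : {set Gamma}.

Let stepP := coset_stepP R (X := X).
Let stepK := coset_stepK R (X := X).

Let stepR u v : artin_rel u v -> forall p, coset_state X p ->
  foldr (coset_step X) p u = foldr (coset_step X) p v.
Proof.
case=> s t st p Pp; rewrite !foldr_alternating !alt_iter_zigzag.
by have := coset_step_zigzag R st Pp; case: ifP.
Qed.

Definition coset_act g (p : W * A) : W * A :=
  presented_act (rel := @artin_rel Gamma) (coset_step X) g p.

Lemma coset_state1 : coset_state X (1, 1).
Proof.
split=> [r _|] /=; first by rewrite invg1 inversions1.
by rewrite standard_parabolicE; exact: Span1.
Qed.

Lemma coset_actP g p : coset_state X p -> coset_state X (coset_act g p).
Proof. exact: presented_actP. Qed.

Lemma coset_actM g h p : coset_state X p ->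
  coset_act (g * h) p = coset_act g (coset_act h p).
Proof. exact: (presented_actM stepP stepK stepR). Qed.

Lemma coset_act1 p : coset_state X p -> coset_act 1 p = p.
Proof. exact: (presented_act1 stepP stepK stepR). Qed.

Lemma coset_act_gen s p : coset_state X p -> coset_act (artin_gen s) p = coset_step X (s, true) p.
Proof. exact: (presented_act_letter stepP stepK stepR). Qed.

Lemma coset_act_genV s p : coset_state X p ->
  coset_act (artin_gen s)^-1 p = coset_step X (s, false) p.
Proof.
rewrite -[artin_gen s]/(letter _ (s, true)) -letterV.
exact: (presented_act_letter stepP stepK stepR).
Qed.

Lemma coset_actMr g w a b : coset_act g (w, a * b)
  = ((coset_act g (w, a)).1, (coset_act g (w, a)).2 * b).
Proof.
rewrite /coset_act /presented_act; elim: (word_repr g) => //= l u ->.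
by rewrite /coset_step /=; case: pickP => //= x _; rewrite mulgA.
Qed.

Lemma coset_act_parabolic g : standard_parabolic X g -> coset_act g (1, 1) = (1, g).
Proof.
have fixed1 s b a : s \in X -> coset_step X (s, b) (1, a) = (1, artin_letter s b * a).
  by move=> Xs; apply: (coset_step_fixed R) => //=; rewrite invg1 mul1g mulg1.
elim/standard_parabolic_ind => [|s k Xs IH|s k Xs IH].
- exact: coset_act1 coset_state1.
- rewrite coset_actM ?IH; last exact: coset_state1.
  by rewrite coset_act_gen ?fixed1 // -IH; apply: coset_actP coset_state1.
- rewrite coset_actM ?IH; last exact: coset_state1.
  by rewrite coset_act_genV ?fixed1 // -IH; apply: coset_actP coset_state1.
Qed.

(** Along a word in [Y] all the representatives met are in [W_Y], so the recorded
    generators are in [Y] too. *)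
Lemma coset_act_parabolicI Y g (p := coset_act g (1, 1)) : standard_parabolic Y g ->
  cox_parabolic Y p.1 /\ standard_parabolic (X :&: Y) p.2.
Proof.
rewrite {}/p; elim/standard_parabolic_ind => [|s k Ys IH|s k Ys IH].
- rewrite coset_act1; last exact: coset_state1.
  by rewrite standard_parabolicE; split; exact: Span1.
all: rewrite coset_actM; last exact: coset_state1.
all: rewrite ?coset_act_gen ?coset_act_genV; try exact: (coset_actP k coset_state1).
all: have := coset_actP k coset_state1; case: (coset_act k _) IH => w a /= [Yw XYa] [/= rw _].
all: have [Ks|ns] := EM (cox_parabolic X (w^-1 * cgen s * w));
  last (rewrite coset_step_moved //=; split=> //; apply: span_mul => //; exact: cox_parabolic_gen).
all: have [x Xx Ex] := right_min_fixed rw Ks.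
all: rewrite (coset_step_fixed R _ (x := x)) //=; split=> //.
all: have Yx : x \in Y by
  (have /cgen_parabolic[y Yy /(cgen_inj R) ->//] : cox_parabolic Y (cgen x);
   rewrite -Ex; apply: span_mul => //; apply: span_mul; [exact: span_inv|exact: cox_parabolic_gen]).
all: move: XYa; rewrite standard_parabolicE => XYa; apply: span_mul => //.
all: have XYx : [set artin_gen z | z in [set` X :&: Y]] (artin_gen x) by
  (exists x => //=; rewrite !inE; exact/andP).
- exact: span_in.
- exact: span_inV.
Qed.

End CosetAction.

(** van der Lek's theorem: an element of [A_X] is recorded as itself. *)
Lemma standard_parabolicI X Y g : standard_parabolic X g -> standard_parabolic Y g ->
  standard_parabolic (X :&: Y) g.
Proof.
by move=> Xg /(coset_act_parabolicI X)[_]; rewrite coset_act_parabolic.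
Qed.

Lemma standard_parabolicS X Y : X \subset Y -> standard_parabolic X `<=` standard_parabolic Y.
Proof.
move=> /fintype.subsetP XY; rewrite !standard_parabolicE; apply: span_sub => _ [x Xx <-].
by exists x => //; exact: XY.
Qed.

Lemma standard_parabolicM X g h : standard_parabolic X g -> standard_parabolic X h ->
  standard_parabolic X (g * h).
Proof. by rewrite standard_parabolicE; exact: span_mul. Qed.

Lemma standard_parabolicV X g : standard_parabolic X g -> standard_parabolic X g^-1.
Proof. by rewrite standard_parabolicE; exact: span_inv. Qed.

Lemma standard_parabolic1 X : standard_parabolic X 1.
Proof. by rewrite standard_parabolicE; exact: Span1. Qed.

Lemma conjugate_standard X g : standard_parabolic X g ->
  conjugate g (standard_parabolic X) = standard_parabolic X.
Proof. by rewrite standard_parabolicE; exact: conjugate_in. Qed.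

(** The element recorded along [g^-1] gives the conjugator.  As [g y g^-1] fixes the base
    coset, [y] fixes the coset reached by [g^-1], where it is recorded as a generator
    of [X]. *)
Lemma parabolic_sub_standard X Y g :
  conjugate g (standard_parabolic Y) `<=` standard_parabolic X ->
  exists h Y', [/\ standard_parabolic X h, Y' \subset X, #|Y'| = #|Y|,
    conjugate g (standard_parabolic Y) = conjugate h (standard_parabolic Y')
    & free_of_infinity Y -> free_of_infinity Y'].
Proof.
move=> gYX; have S1 := coset_state1 X.
have [] := coset_actP g^-1 S1; case E : (coset_act X g^-1 (1, 1)) => [w a] /= rw Xa.
pose phi y := odflt y [pick x in X | cgen x == w^-1 * cgen y * w].
have main y : y \in Y -> [/\ phi y \in X, cgen (phi y) = w^-1 * cgen y * w
    & g * artin_gen y * g^-1 = a^-1 * artin_gen (phi y) * a].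
  move=> Yy; set z := g * _ * _; have Xz : standard_parabolic X z.
    by apply: gYX; exists (artin_gen y) => //; exact: standard_parabolic_gen.
  have : coset_act X (artin_gen y * g^-1) (1, 1) = (w, a * z).
    have -> : artin_gen y * g^-1 = g^-1 * z by rewrite /z !mulgA mulVg mul1g.
    by rewrite coset_actM // coset_act_parabolic // -[z in LHS]mul1g coset_actMr E.
  rewrite coset_actM // E coset_act_gen //.
  rewrite /coset_step /phi /=; case: pickP => [x /andP[Xx /eqP Ex] [Ez]|_ [F _]] /=.
    by split=> //; rewrite -mulgA -[artin_gen x]/(artin_letter x true) Ez mulKg.
  have := cgen_neq1 y; have -> : cgen y = 1 by apply: (mulIg w); rewrite F mul1g.
  by rewrite eqxx.
have phi_inj : {in Y &, injective phi}.
  move=> y y' Yy Yy' Ephi; have [_ E1 _] := main _ Yy; have [_ E2 _] := main _ Yy'.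
  by move: E1; rewrite Ephi E2 => /mulIg/mulgI/(cgen_inj R).
exists a^-1, (phi @: Y)%SET; split.
- exact: standard_parabolicV.
- by apply/fintype.subsetP => _ /imsetP[y Yy ->]; have [] := main _ Yy.
- exact: card_in_imset.
- rewrite !standard_parabolicE !conjugate_span; congr (span _); apply/seteqP; split=> z.
    case=> _ [y /= Yy <-] <-; have [_ _ ->] := main _ Yy.
    exists (artin_gen (phi y)); last by rewrite invgK.
    by exists (phi y) => //=; apply/imsetP; exists y.
  case=> _ [x /= /imsetP[y Yy ->] <-] <-; have [_ _] := main _ Yy; rewrite invgK => <-.
  by exists (artin_gen y) => //; exists y.
- move=> fY _ _ /imsetP[y Yy ->] /imsetP[y' Yy' ->] neq.
  have [_ E1 _] := main _ Yy; have [_ E2 _] := main _ Yy'.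
  have yy' : [set y; y']%SET \in edges Gamma.
    by apply: fY => //; apply: contraNneq neq => ->.
  by have [] := edge_conj R yy' (esym E1) (esym E2).
Qed.

End ParabolicSubgroups.

(** * Trees *)

Section Walks.
Variable V : Type.
Implicit Types (r : V -> V -> Prop) (x y z : V).

Inductive walk r : nat -> V -> V -> Prop :=
| Walk0 x : walk r 0 x x
| WalkS n x y z : r x y -> walk r n y z -> walk r n.+1 x z.

Lemma walk1 r x y : r x y -> walk r 1 x y.
Proof. by move=> xy; apply: WalkS xy (Walk0 _ _). Qed.

Lemma walk_cat r m n x y z : walk r m x y -> walk r n y z -> walk r (m + n) x z.
Proof. by elim=> // {}m {}x w {}y xw _ IH yz; apply: WalkS xw (IH yz). Qed.

Lemma walk_rev r n x y : (forall u v, r u v -> r v u) -> walk r n x y -> walk r n y x.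
Proof.
move=> rC; elim=> [{}x|{}n {}x w {}y xw _ IH]; first exact: Walk0.
by rewrite -addn1; apply: walk_cat IH (walk1 (rC _ _ xw)).
Qed.

Lemma walk_map r r' (f : V -> V) n x y :
  (forall a b, r a b -> r' (f a) (f b)) -> walk r n x y -> walk r' n (f x) (f y).
Proof.
by move=> rf; elim=> [{}x|{}n {}x w {}y /rf xw _]; [exact: Walk0|exact: WalkS].
Qed.

Lemma walk_cross r (phi : V -> bool) n x y : walk r n x y -> phi x != phi y ->
  exists i j a b, [/\ walk r i x a, r a b, walk r j b y, (i + j.+1)%N = n & phi a != phi b].
Proof.
elim=> [{}x|{}n {}x w {}y xw wy IH]; first by rewrite eqxx.
have [E|ne _] := eqVneq (phi x) (phi w).
  rewrite E => /IH[i [j [a [b [W1 ab W2 <- ne]]]]].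
  by exists i.+1, j, a, b; split=> //; exact: WalkS xw W1.
by exists 0%N, n, x, w; split=> //; exact: Walk0.
Qed.

End Walks.

Definition adjacent (V : Type) (E : V -> V -> Prop) x y := E x y \/ E y x.

(** A tree whose edges are oriented from one class of a bipartition to the other;
    acyclicity is stated as: removing an edge separates its ends. *)
Record is_tree (V : Type) (E : V -> V -> Prop) (ty : V -> bool) : Prop := IsTree {
  tree_type : forall x y, E x y -> ty x /\ ~~ ty y;
  tree_connected : forall x y, exists n, walk (adjacent E) n x y;
  tree_bridge : forall x y, E x y -> exists phi : V -> bool,
    phi x != phi y /\ forall u v, E u v -> phi u != phi v -> u = x /\ v = y
}.

Section TreeDistance.
Variables (V : Type) (E : V -> V -> Prop) (ty : V -> bool).
Hypothesis T : is_tree E ty.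
Local Notation adj := (adjacent E).
Implicit Types (x y z p q u : V).

Lemma adjC x y : adj x y -> adj y x. Proof. by case; [right|left]. Qed.

Let exW x y : exists n, `[< walk adj n x y >].
Proof. by have [n xy] := tree_connected T x y; exists n; apply/asboolP. Qed.

Definition dist x y : nat := ex_minn (exW x y).

Lemma dist_walk x y : walk adj (dist x y) x y.
Proof. by rewrite /dist; case: ex_minnP => n /asboolP. Qed.

Lemma dist_min n x y : walk adj n x y -> (dist x y <= n)%N.
Proof. by move=> xy; rewrite /dist; case: ex_minnP => m _; apply; apply/asboolP. Qed.

Lemma dist_xx x : dist x x = 0%N.
Proof. by apply/eqP; rewrite -leqn0; apply/dist_min/Walk0. Qed.

Lemma dist_eq0 x y : dist x y = 0%N -> x = y.
Proof. by have := dist_walk x y => /[swap] ->; move E0 : 0%N => n W; case: W E0. Qed.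

Lemma distC x y : dist x y = dist y x.
Proof.
by apply/eqP; rewrite eqn_leq; apply/andP; split; apply: dist_min;
   apply: walk_rev (dist_walk _ _); exact: adjC.
Qed.

Lemma dist_triangle x y z : (dist x z <= dist x y + dist y z)%N.
Proof. by apply/dist_min/walk_cat; exact: dist_walk. Qed.

Lemma adj_type x y : adj x y -> ty y = ~~ ty x.
Proof. by case=> /(tree_type T)[-> /negbTE ->]. Qed.

Lemma walk_type n x y : walk adj n x y -> ty y = ty x (+) odd n.
Proof.
by elim=> [{}x|{}n {}x w {}y /adj_type xw _ ->]; rewrite ?addbF // xw /= addbN addNb.
Qed.

Lemma adj_dist x y o : adj x y -> dist y o = (dist x o).+1 \/ dist x o = (dist y o).+1.
Proof.
move=> xy.
have H1 : (dist y o <= (dist x o).+1)%N.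
  by apply/dist_min/WalkS/dist_walk; exact: adjC.
have H2 : (dist x o <= (dist y o).+1)%N by apply/dist_min/WalkS/dist_walk.
have ne : dist y o <> dist x o.
  move=> Exy; have := walk_type (dist_walk x o); rewrite -Exy (walk_type (dist_walk y o)).
  by rewrite (adj_type xy); case: (ty x); case: odd.
lia.
Qed.

Lemma dist_adj x y : adj x y -> dist x y = 1%N.
Proof.
by move=> xy; have [] := adj_dist y xy; rewrite dist_xx // => ->.
Qed.

Lemma step_toward x o : x <> o -> exists2 y, adj x y & dist x o = (dist y o).+1.
Proof.
have := dist_walk x o; move En : (dist x o) => n W.
case: W En => // {}n {}x w {}o xw /dist_min wo Exo _; exists w => //.
have : (dist x o <= (dist w o).+1)%N by apply/dist_min/WalkS/dist_walk.
lia.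
Qed.

Lemma adj_bridge x y : adj x y -> exists phi : V -> bool, phi x != phi y /\
  forall u v, adj u v -> phi u != phi v -> (u = x /\ v = y) \/ (u = y /\ v = x).
Proof.
case=> /(tree_bridge T)[phi [ne H]]; exists phi; split=> //; rewrite 1?eq_sym // => u v.
all: by case=> /H; rewrite ?[phi v == _]eq_sym => K /K[-> ->]; auto.
Qed.

(** A shortest path towards [p] does not cross the edge to a vertex that is further. *)
Lemma bridge_side (phi : V -> bool) p p1 u : adj p p1 ->
  (forall a b, adj a b -> phi a != phi b -> (a = p /\ b = p1) \/ (a = p1 /\ b = p)) ->
  (dist u p < dist u p1)%N -> phi u = phi p.
Proof.
move=> pp1 H lt; apply/eqP/negPn/negP => /(walk_cross (dist_walk u p)).
case=> i [j [a [b [W1 ab W2 Eij /(H _ _ ab)[]]]]] [Ea Eb]; subst a b.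
- have /dist_min := walk_cat W1 (walk1 ab); lia.
- have := dist_min W1; lia.
Qed.

(** The edge from [p] to [p1] separates the vertices closer to [p] from those closer
    to [p1], and every path between the two sides crosses it. *)
Lemma dist_through p p1 q u : adj p p1 -> (dist p1 q < dist p q)%N ->
  (dist p u < dist p1 u)%N -> dist u q = (dist u p + dist p q)%N.
Proof.
move=> pp1 ltq ltu; have [phi [ne H]] := adj_bridge pp1.
have Eu : phi u = phi p by apply: bridge_side pp1 H _; rewrite ![dist u _]distC.
have Eq : phi q = phi p1.
  apply: bridge_side (adjC pp1) _ _; last by rewrite ![dist q _]distC.
  by move=> a b ab /(H _ _ ab)[]; auto.
have : phi u != phi q by rewrite Eu Eq.
move=> /(walk_cross (dist_walk u q))[i [j [a [b [W1 ab W2 Eij /(H _ _ ab) ends]]]]].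
apply/eqP; rewrite eqn_leq dist_triangle /=.
case: ends => -[Ea Eb]; subst a b.
- have := dist_min W1; have := dist_min (WalkS ab W2); lia.
- have := dist_min W2; have := dist_min (walk_cat W1 (walk1 ab)); lia.
Qed.

(** If [z] were another neighbour of [x] closer to [o], then [dist_through] for the edge
    from [x] to [y] would put it beyond [x], at a larger distance from [o]. *)
Lemma toward_unique x y z o : adj x y -> adj x z -> (dist y o < dist x o)%N ->
  (dist z o < dist x o)%N -> y = z.
Proof.
move=> xy xz yo zo; apply: contrapT => yz.
have xzy : (dist x z < dist y z)%N.
  have [] := adj_dist z xy; first by move->.
  by rewrite (dist_adj xz) => -[] /esym/dist_eq0.
by have := dist_through xy yo xzy; lia.
Qed.

(** A path in the subgraph has to cross the bridge from [x] to [x1]. *)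
Lemma subtree_convex (r : V -> V -> Prop) n x y x1 :
  (forall a b, r a b -> adj a b) -> (forall a b, r a b -> r b a) ->
  walk r n x y -> adj x x1 -> (dist x1 y < dist x y)%N -> r x x1.
Proof.
move=> rE rC W xx1 lt; have [phi [ne H]] := adj_bridge xx1.
have Ey : phi y = phi x1.
  apply: bridge_side (adjC xx1) _ _; last by rewrite ![dist y _]distC.
  by move=> a b ab /(H _ _ ab)[]; auto.
have : phi x != phi y by rewrite Ey.
move=> /(walk_cross W)[i [j [a [b [W1 ab W2 Eij /(H _ _ (rE _ _ ab))]]]]].
by case=> -[Ea Eb]; subst a b => //; exact: rC.
Qed.

End TreeDistance.

Section TreeAction.
Variables (V : Type) (E : V -> V -> Prop) (ty : V -> bool).
Hypothesis T : is_tree E ty.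
Variables (G : groupType) (act : G -> V -> V).
Hypothesis act1 : forall x, act 1%g x = x.
Hypothesis actM : forall g h x, act (g * h)%g x = act g (act h x).
Hypothesis actE : forall g x y, E x y -> E (act g x) (act g y).
Local Notation adj := (adjacent E).
Local Notation dist := (dist T).
Implicit Types (g h k : G) (x y z p q u : V).

Lemma actK g x : act g^-1%g (act g x) = x.
Proof. by rewrite -actM mulVg act1. Qed.

Lemma act_adj g x y : adj x y -> adj (act g x) (act g y).
Proof. by case=> /(actE g); [left|right]. Qed.

Lemma dist_act g x y : dist (act g x) (act g y) = dist x y.
Proof.
have le h a b : (dist (act h a) (act h b) <= dist a b)%N.
  by apply/dist_min/(walk_map (act_adj h))/dist_walk.
by apply/eqP; rewrite eqn_leq le /= -{1}(actK g x) -{1}(actK g y) le.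
Qed.

Lemma fixed_toward g p q p1 : act g p = p -> act g q = q -> adj p p1 ->
  (dist p1 q < dist p q)%N -> act g p1 = p1.
Proof.
move=> gp gq pp1 lt; apply: (@toward_unique _ _ _ T p _ _ q) => //.
  by rewrite -{1}gp; exact: act_adj.
by rewrite -{1}gq dist_act.
Qed.

(** The vertex of a stable subtree that is nearest to the fixed point is unique, hence
    fixed: the path between two nearest vertices stays in the subtree, so it starts by
    moving away from the fixed point and never comes closer again. *)
Lemma fixed_projection (F : G -> Prop) (S : V -> Prop) (r : V -> V -> Prop) p s :
  (forall a b, r a b -> adj a b) -> (forall a b, r a b -> r b a) ->
  (forall a b, r a b -> S a -> S b) ->
  (forall a b, S a -> S b -> exists n, walk r n a b) -> S s ->
  (forall g a, F g -> S a -> S (act g a)) -> (forall g, F g -> act g p = p) ->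
  exists2 q, S q & forall g, F g -> act g q = q.
Proof.
move=> rE rC rS rW Ss FS Fp.
have ex : exists n, `[< exists2 q, S q & dist p q = n >].
  by exists (dist p s); apply/asboolP; exists s.
case: (ex_minnP ex) => n /asboolP[q Sq Eq] minn; exists q => // g Fg.
apply/esym; apply: contrapT => neq; have [q1 qq1 lt] := step_toward T neq.
have Sgq : S (act g q) by exact: FS.
have [m W] := rW _ _ Sq Sgq.
have Sq1 : S q1.
  by apply: rS Sq; apply: (subtree_convex (T := T) rE rC W qq1); rewrite lt.
have : (n <= dist p q1)%N by apply/minn/asboolP; exists q1.
have Egq : dist p (act g q) = n by rewrite -(Fp g Fg) dist_act.
have [Ed|Ed] := adj_dist T p qq1; rewrite !(distC T _ p) Eq in Ed; last by lia.
move=> _; have := @dist_through _ _ _ T q q1 (act g q) p qq1.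
rewrite ![dist _ p](distC T) Eq Egq lt Ed => /(_ (ltnSn _) (ltnSn _)); lia.
Qed.

(** Here [p1] and [q1] are the first steps of the path between [p] and [q], from both
    ends.  A point [o] fixed by [h k] is at the same distances from [p] and [q] as [k o].
    Since [k] moves [p1], the paths from [p] to [o] and to [k o] cannot both
    start with [p1], so [q] is further from [o] than [p]; the same argument with [h]
    gives the opposite inequality. *)
Lemma fixed_product p q p1 q1 h k o : adj p p1 -> adj q q1 ->
  (dist p1 q < dist p q)%N -> (dist q1 p < dist q p)%N ->
  act k p = p -> act h q = q -> act k p1 <> p1 -> act h q1 <> q1 ->
  act (h * k)%g o <> o.
Proof.
move=> pp1 qq1 lt1 lt2 kp hq kp1 hq1; rewrite actM; set o' := act k o => ho'.
have dp : dist p o' = dist p o by rewrite -{1}kp /o' dist_act.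
have dq : dist q o' = dist q o by rewrite -[in RHS]ho' -[in RHS]hq dist_act.
have E1 : dist o q = (dist o p + dist p q)%N.
  have [lt|ge] := ltnP (dist p o) (dist p1 o); first exact: dist_through lt.
  have {}ge : (dist p1 o < dist p o)%N by have [] := adj_dist T o pp1; lia.
  have [lt|ge'] := ltnP (dist p o') (dist p1 o').
    by have := dist_through pp1 lt1 lt; rewrite !(distC T o') dp dq !(distC T _ o).
  case: kp1; apply: (@toward_unique _ _ _ T p _ _ o') => //.
  - by rewrite -{1}kp; exact: act_adj.
  - by rewrite /o' dist_act -/o' dp.
  - by have [] := adj_dist T o' pp1; lia.
have E2 : dist o p = (dist o q + dist q p)%N.
  have [lt|ge] := ltnP (dist q o) (dist q1 o); first exact: dist_through lt.
  have {}ge : (dist q1 o < dist q o)%N by have [] := adj_dist T o qq1; lia.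
  have [lt|ge'] := ltnP (dist q o') (dist q1 o').
    by have := dist_through qq1 lt2 lt; rewrite !(distC T o') dp dq !(distC T _ o).
  case: hq1; apply: (@toward_unique _ _ _ T q _ _ o) => //.
  - by rewrite -{1}hq; exact: act_adj.
  - rewrite -{1}ho' dist_act -dq.
    by have [] := adj_dist T o' qq1; lia.
by move: E1 E2 lt1; rewrite (distC T q p); lia.
Qed.

(** Add the elements of [F] one at a time: if the fixed sets of [h] and of the previous
    elements are disjoint, then [fixed_product] applies to a closest pair of points. *)
Lemma serre (H : G -> Prop) (F : seq G) (v0 : V) :
  (forall g h, H g -> H h -> H (g * h)%g) ->
  (forall g, H g -> exists x, act g x = x) ->
  (forall g, g \in F -> H g) -> exists x, forall g, g \in F -> act g x = x.
Proof.
move=> HM Hfix; elim: F => [|h F IH] HF; first by exists v0.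
have [p0 Fp0] : exists x, forall g, g \in F -> act g x = x.
  by apply: IH => g Fg; apply: HF; rewrite inE Fg orbT.
have Hh : H h by apply: HF; rewrite inE eqxx.
have [q0 hq0] := Hfix _ Hh.
pose Q n := `[< exists p q, [/\ dist p q = n, forall g, g \in F -> act g p = p & act h q = q] >].
have exQ : exists n, Q n by exists (dist p0 q0); apply/asboolP; exists p0, q0.
case: (ex_minnP exQ) => n /asboolP[p [q [Epq Fp hq]]] minn.
have [Ep|neq] := EM (p = q).
  by exists p => g; rewrite inE => /orP[/eqP->|/Fp //]; rewrite Ep.
have [p1 pp1 lt1] := step_toward T neq.
have [q1 qq1 lt2] := step_toward T (nesym neq).
have [k Fk kp1] : exists2 k, k \in F & act k p1 <> p1.
  apply: contrapT => nk; have /minn : Q (dist p1 q).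
    apply/asboolP; exists p1, q; split=> // g Fg; apply: contrapT => gp1.
    by apply: nk; exists g.
  by lia.
have hq1 : act h q1 <> q1.
  move=> hq1; have /minn : Q (dist p q1) by apply/asboolP; exists p, q1.
  by rewrite distC; move: lt2; rewrite (distC T q); lia.
have [o] := Hfix _ (HM _ _ Hh (HF k (mem_behead (s := h :: F) Fk))).
case/(fixed_product (p := p) (q := q) pp1 qq1 _ _ (Fp _ Fk) hq kp1 hq1); first by rewrite lt1.
by rewrite lt2.
Qed.

End TreeAction.

(** * Metric trees are CAT(0) *)

Section FourPoint.
Context {R : realType}.
Local Open Scope ring_scope.
Import Order.TTheory GRing.Theory Num.Theory.

Definition sqdist n (x y : 'rV[R]_n) : R := \sum_(i < n) (x 0 i - y 0 i) ^+ 2.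

Lemma sqdist_ge0 n (x y : 'rV[R]_n) : 0 <= sqdist x y.
Proof. by apply: sumr_ge0 => i _; exact: sqr_ge0. Qed.

Lemma edist_ge0 n (x y : 'rV[R]_n) : 0 <= edist x y.
Proof. exact: sqrtr_ge0. Qed.

Lemma edist_sqr n (x y : 'rV[R]_n) : edist x y ^+ 2 = sqdist x y.
Proof. exact/sqr_sqrtr/sqdist_ge0. Qed.

Lemma edistC n (x y : 'rV[R]_n) : edist x y = edist y x.
Proof.
by congr Num.sqrt; apply: eq_bigr => i _; rewrite -sqrrN opprB.
Qed.

Lemma sqdist_segment (a b c : 'rV[R]_2) (u v : R) :
  sqdist (u *: b + (1 - u) *: a) ((1 - v) *: a + v *: c)
  = u ^+ 2 * sqdist b a + v ^+ 2 * sqdist a c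
    - u * v * (sqdist b a + sqdist a c - sqdist b c).
Proof. by rewrite /sqdist !big_ord_recl !big_ord0 !mxE; ring. Qed.

Lemma edist_segment n (a b : 'rV[R]_n) (u v : R) :
  edist ((1 - u) *: a + u *: b) ((1 - v) *: a + v *: b) = `|u - v| * edist a b.
Proof.
rewrite /edist -sqrtr_sqr -sqrtrM ?sqr_ge0 // mulr_sumr; congr Num.sqrt.
by apply: eq_bigr => i _; rewrite !mxE; ring.
Qed.

Lemma at_distanceE (a b z : 'rV[R]_2) t : at_distance a b t z ->
  exists l, [/\ 0 <= l <= 1, z = (1 - l) *: a + l *: b & t = l * edist a b].
Proof.
case=> Et [l l01 Ez]; exists l; split=> //; rewrite -Et Ez.
have := edist_segment a b 0 l; rewrite subr0 scale1r scale0r addr0 => ->.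
by rewrite sub0r normrN ger0_norm //; case/andP: l01.
Qed.

(** The comparison of a tripod with a Euclidean triangle of sides [A], [B], [C]:
    [(B + C - A) / 2] is the length of the common leg. *)
Lemma tripod_comparison (u v A B C d : R) : 0 <= u <= 1 -> 0 <= v <= 1 ->
  0 <= B -> 0 <= C -> `|B - C| <= A -> A <= B + C -> 0 <= d ->
  d <= Num.max `|u * B - v * C| (u * B + v * C + A - B - C) ->
  d ^+ 2 <= u ^+ 2 * B ^+ 2 + v ^+ 2 * C ^+ 2 - u * v * (B ^+ 2 + C ^+ 2 - A ^+ 2).
Proof.
move=> /andP[u0 u1] /andP[v0 v1] B0 C0 tri tri' d0.
have A0 : 0 <= A by exact: le_trans (normr_ge0 _) tri.
have sqA : (B - C) ^+ 2 <= A ^+ 2.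
  by rewrite -[_ ^+ 2]real_normK ?num_real // ler_pXn2r ?nnegrE.
have legs : d <= `|u * B - v * C| ->
    d ^+ 2 <= u ^+ 2 * B ^+ 2 + v ^+ 2 * C ^+ 2 - u * v * (B ^+ 2 + C ^+ 2 - A ^+ 2).
  move=> le; apply: (le_trans (y := (u * B - v * C) ^+ 2)).
    by rewrite -[X in _ <= X]real_normK ?num_real // ler_pXn2r ?nnegrE.
  rewrite -subr_ge0.
  have -> : u ^+ 2 * B ^+ 2 + v ^+ 2 * C ^+ 2 - u * v * (B ^+ 2 + C ^+ 2 - A ^+ 2)
     - (u * B - v * C) ^+ 2 = u * v * (A ^+ 2 - (B - C) ^+ 2) by ring.
  by rewrite mulr_ge0 ?mulr_ge0 // subr_ge0.
rewrite le_max => /orP[//|le].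
pose g := (B + C - A) / 2.
have Eg : A = B + C - 2 * g by rewrite /g; lra.
have g0 : 0 <= g by rewrite /g; lra.
have [uB|uB] := lerP (u * B) g.
  by apply: legs; apply: le_trans le _; rewrite ler_normr; apply/orP; right; lra.
have [vC|vC] := lerP (v * C) g.
  by apply: legs; apply: le_trans le _; rewrite ler_normr; apply/orP; left; lra.
have le' : d <= u * B + v * C - 2 * g by lra.
apply: (le_trans (y := (u * B + v * C - 2 * g) ^+ 2)).
  by rewrite ler_pXn2r ?nnegrE //; exact: le_trans le'.
rewrite -subr_ge0 Eg.
have -> : u ^+ 2 * B ^+ 2 + v ^+ 2 * C ^+ 2 - u * v * (B ^+ 2 + C ^+ 2 - (B + C - 2 * g) ^+ 2)
   - (u * B + v * C - 2 * g) ^+ 2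
   = 4 * ((u * (B - g)) * (v * (C - g)) - (u * B - g) * (v * C - g)) by ring.
rewrite mulr_ge0 // subr_ge0 ler_pM //; try lra.
- by rewrite mulrBr lerD2l lerN2 ler_piMl.
- by rewrite mulrBr lerD2l lerN2 ler_piMl.
Qed.

Variables (X : Type) (d : X -> X -> R).

(** Gromov's 0-hyperbolicity. *)
Definition four_point : Prop := forall x y z w,
  d x y + d z w <= Num.max (d x z + d y w) (d x w + d y z).

Hypotheses (dm : is_metric d) (d4 : four_point).

(** A geodesic triangle is a tripod: two points on the sides at [a] are joined
    either along these sides, or through the center of the tripod. *)
Lemma four_point_tripod a b c x y :
  d b a = d b x + d x a -> d a c = d a y + d y c ->
  d x y <= Num.max `|d x a - d a y| (d x a + d a y + d b c - d b a - d a c).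
Proof.
case: dm => _ _ dC _ Ex Ey.
have := d4 x y c a; have := d4 x c b a.
rewrite !le_max (dC y a) (dC c a) (dC x b) (dC c b) ler_normr.
move=> /orP H1 /orP H2; case: H2 => H2; last by apply/orP; left; apply/orP; left; lra.
case: H1 => H1; apply/orP; last by right; lra.
by left; apply/orP; right; lra.
Qed.

Lemma adjacent_sides (p0 p1 p2 : X) c0 c1 (q0 q1 q2 x' y' : 'rV[R]_2) s t :
  geodesic d p0 p1 c0 -> geodesic d p1 p2 c1 ->
  edist q0 q1 = d p0 p1 -> edist q1 q2 = d p1 p2 -> edist q0 q2 = d p0 p2 ->
  0 <= s <= d p0 p1 -> 0 <= t <= d p1 p2 ->
  at_distance q0 q1 s x' -> at_distance q1 q2 t y' ->
  d (c0 s) (c1 t) <= edist x' y'.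
Proof.
case: dm => d_ge0 d0 dC tri [c00 c01 c0d] [c10 c11 c1d] E01 E12 E02 s01 t01.
move=> /at_distanceE[l [l01 -> Es]] /at_distanceE[k [k01 -> Et]].
rewrite E01 in Es; rewrite E12 in Et.
have z0 q r : 0 <= (0 : R) <= d q r by rewrite lexx d_ge0.
have z1 q r : 0 <= d q r <= d q r by rewrite lexx d_ge0.
have D0s : d p0 (c0 s) = s by rewrite -c00 c0d // sub0r normrN ger0_norm //; case/andP: s01.
have Ds1 : d (c0 s) p1 = d p0 p1 - s.
  by rewrite -{1}c01 c0d // distrC ger0_norm // subr_ge0; case/andP: s01.
have D1t : d p1 (c1 t) = t by rewrite -c10 c1d // sub0r normrN ger0_norm //; case/andP: t01.
have Dt2 : d (c1 t) p2 = d p1 p2 - t.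
  by rewrite -{1}c11 c1d // distrC ger0_norm // subr_ge0; case/andP: t01.
have := @four_point_tripod p1 p0 p2 (c0 s) (c1 t).
rewrite D0s Ds1 D1t Dt2 => /(_ _ _)/[!subrKC].
set B := d p0 p1 in Es E01 *; set C := d p1 p2 in Et E12 *; set A := d p0 p2 in E02 *.
move=> /(_ erefl erefl) bound.
rewrite -ler_sqr ?nnegrE ?edist_ge0 ?d_ge0 // edist_sqr.
have -> : (1 - l) *: q0 + l *: q1 = (1 - l) *: q0 + (1 - (1 - l)) *: q1 by rewrite subKr.
rewrite sqdist_segment -!edist_sqr E01 E12 E02.
apply: tripod_comparison; rewrite ?d_ge0 //.
- by case/andP: l01 => ? ?; apply/andP; split; lra.
- have T1 := tri p0 p2 p1; have T2 := tri p1 p0 p2.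
  rewrite (dC p2 p1) (dC p1 p0) -/A -/B -/C in T1 T2.
  by rewrite ler_norml; apply/andP; split; lra.
- exact: tri.
- have -> : (1 - l) * B = B - s by rewrite Es mulrBl mul1r.
  by rewrite -Et.
Qed.

Lemma four_point_cat0 : cat0_inequality d.
Proof.
case: (dm) => d_ge0 d0 dC tri p c p' geo comp i j s t x' y' si tj xi yj.
have [ji|ji|ij] : [\/ j = i, j = ordS i | i = ordS j].
  case: i j {si tj xi yj} => [[|[|[|//]]] hi] [[|[|[|//]]] hj];
    first [by constructor 1; apply: val_inj | by constructor 2; apply: val_inj
          | by constructor 3; apply: val_inj].
- have [g0 g1 gd] := geo i; rewrite -> ji in *; rewrite gd //.
  have [l [l01 -> Es]] := at_distanceE xi; have [k [k01 -> Et]] := at_distanceE yj.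
  rewrite edist_segment comp Es Et comp -mulrBl normrM ler_wpM2l ?normr_ge0 //.
  by rewrite ger0_norm.
- rewrite -> ji in *; apply: (adjacent_sides (geo i) (geo (ordS i))) xi yj => //.
- rewrite -> ij in *; rewrite dC edistC.
  by apply: (adjacent_sides (geo j) (geo (ordS j))) yj xi.
Qed.

End FourPoint.

Section Ancestors.
Variables (V : Type) (E : V -> V -> Prop) (ty : V -> bool).
Hypothesis T : is_tree E ty.
Variable o : V.
Local Notation adj := (adjacent E).
Implicit Types (u v w : V).

(** The tree is rooted at [o] from now on. *)
Definition depth v := dist T v o.

Definition parent v : V :=
  if pselect (exists w, adj v w /\ depth v = (depth w).+1) is left h then sval (cid h) else v.

Lemma parentP v : v <> o -> adj v (parent v) /\ depth v = (depth (parent v)).+1.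
Proof.
move=> vo; rewrite /parent; case: pselect => [h|[]]; first exact: svalP (cid h).
by have [w vw Ed] := step_toward T vo; exists w.
Qed.

Lemma parent_unique v w : adj v w -> (depth w < depth v)%N -> parent v = w.
Proof.
move=> vw lt; have vo : v <> o by move=> E'; move: lt; rewrite E' /depth dist_xx.
have [vp Ed] := parentP vo; apply: (toward_unique (T := T) (o := o) vp vw) => //.
by move: Ed; rewrite /depth => ->.
Qed.

Lemma depth_root : depth o = 0%N. Proof. exact: dist_xx. Qed.

Lemma depth_gt0 v : (0 < depth v)%N -> v <> o.
Proof. by move=> + E'; rewrite E' depth_root. Qed.

Lemma depth0 v : depth v = 0%N -> v = o.
Proof. exact: dist_eq0. Qed.

Definition ancestor n v := iter (depth v - n) parent v.

Lemma depth_iter_parent k v : (k <= depth v)%N -> depth (iter k parent v) = (depth v - k)%N.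
Proof.
elim: k => [|k IH] kv; first by rewrite subn0.
have Ek := IH (ltnW kv); have /parentP[_ /=] : iter k parent v <> o.
  by apply: depth_gt0; rewrite Ek subn_gt0.
by rewrite Ek => Ed; lia.
Qed.

Lemma depth_ancestor n v : (n <= depth v)%N -> depth (ancestor n v) = n.
Proof. by move=> nv; rewrite /ancestor depth_iter_parent ?leq_subr // subKn. Qed.

Lemma ancestor_ancestor m n v : (m <= n <= depth v)%N ->
  ancestor m (ancestor n v) = ancestor m v.
Proof.
move=> /andP[mn nv]; rewrite {1}/ancestor depth_ancestor // /ancestor -iterD.
by congr (iter _ parent v); lia.
Qed.

Lemma ancestor_depth v : ancestor (depth v) v = v.
Proof. by rewrite /ancestor subnn. Qed.

Lemma ancestor_parent n v : (n < depth v)%N -> ancestor n (parent v) = ancestor n v.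
Proof.
move=> nv; have [_ Ed] := parentP (depth_gt0 (leq_ltn_trans (leq0n _) nv)).
by rewrite /ancestor -iterSr; congr (iter _ parent v); lia.
Qed.

Lemma ancestor0 v : ancestor 0 v = o.
Proof. by apply: depth0; rewrite depth_ancestor. Qed.

Let common v w n := `[< [/\ (n <= depth v)%N, (n <= depth w)%N & ancestor n v = ancestor n w] >].

Let common0 v w : exists n, common v w n.
Proof. by exists 0%N; apply/asboolP; rewrite !ancestor0. Qed.

Let common_bound v w n : common v w n -> (n <= depth v)%N.
Proof. by case/asboolP. Qed.

Definition meet_depth v w : nat := ex_maxn (common0 v w) (@common_bound v w).

Lemma meet_depthP n v w : (n <= meet_depth v w)%N <->
  [/\ (n <= depth v)%N, (n <= depth w)%N & ancestor n v = ancestor n w].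
Proof.
rewrite /meet_depth; case: ex_maxnP => k /asboolP[kv kw Ek] maxk; split=> [nk|H].
  split; [lia|lia|].
  by rewrite -(@ancestor_ancestor n k v) ?nk // Ek ancestor_ancestor ?nk.
exact/maxk/asboolP.
Qed.

Lemma meet_depth_spec v w (n := meet_depth v w) :
  [/\ (n <= depth v)%N, (n <= depth w)%N & ancestor n v = ancestor n w].
Proof. exact/meet_depthP. Qed.

Lemma meet_depthC v w : meet_depth v w = meet_depth w v.
Proof.
apply/eqP; rewrite eqn_leq; apply/andP; split; apply/meet_depthP.
- by have [] := meet_depth_spec v w.
- by have [] := meet_depth_spec w v.
Qed.

Lemma meet_depth_ultra u v w :
  (minn (meet_depth u v) (meet_depth v w) <= meet_depth u w)%N.
Proof.
set n := minn _ _.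
have /meet_depthP[? ? E1] : (n <= meet_depth u v)%N by exact: geq_minl.
have /meet_depthP[? ? E2] : (n <= meet_depth v w)%N by exact: geq_minr.
by apply/meet_depthP; split=> //; rewrite E1.
Qed.

Lemma meet_depth_id v : meet_depth v v = depth v.
Proof.
apply/eqP; rewrite eqn_leq; apply/andP; split; last exact/meet_depthP.
by have [] := meet_depth_spec v v.
Qed.

Lemma meet_depth_parent v : v <> o -> (depth (parent v) <= meet_depth v (parent v))%N.
Proof.
move=> vo; have [_ Ed] := parentP vo; apply/meet_depthP; split=> //; first by rewrite Ed.
by rewrite ancestor_parent // Ed.
Qed.

End Ancestors.

Section Realization.
Variables (R : realType) (V : Type) (E : V -> V -> Prop) (ty : V -> bool).
Hypothesis T : is_tree E ty.
Variable o : V.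
Local Notation adj := (adjacent E).
Local Open Scope ring_scope.
Import Order.TTheory GRing.Theory Num.Theory.
Implicit Types (u v w : V).
Local Notation depth := (depth T o).
Local Notation parent := (parent T o).
Local Notation ancestor := (ancestor T o).
Local Notation meet_depth := (meet_depth T o).

Definition tree_edge := {e : V * V | E e.1 e.2}.

Definition esrc (e : tree_edge) : V := (sval e).1.
Definition edst (e : tree_edge) : V := (sval e).2.

Lemma edgeP e : E (esrc e) (edst e). Proof. exact: svalP e. Qed.

Lemma edge_adj e : adj (esrc e) (edst e). Proof. by left; exact: edgeP. Qed.

Lemma edge_eq e e' : esrc e = esrc e' -> edst e = edst e' -> e = e'.
Proof.
case: e e' => [[a b] p] [[a' b'] p']; rewrite /esrc /edst /= => Ea Eb; subst a' b'.
by congr exist; exact: Prop_irrelevance.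
Qed.

Definition open_unit := {t : R | 0 < t < 1}.

(** Interior points of an edge are kept apart from the vertices, so that every point has
    a single description. *)
Inductive point := PVertex of V | PEdge of tree_edge & open_unit.

Definition edge_point (e : tree_edge) (t : R) : point :=
  if insub t is Some s then PEdge e (s : open_unit)
  else if t <= 0 then PVertex (esrc e) else PVertex (edst e).

Lemma edge_point0 e : edge_point e 0 = PVertex (esrc e).
Proof. by rewrite /edge_point insubF ?ltxx ?lexx. Qed.

Lemma edge_point1 e : edge_point e 1 = PVertex (edst e).
Proof. by rewrite /edge_point insubF ?ltxx ?andbF // ler10. Qed.

Lemma edge_point_in e (t : open_unit) : edge_point e (val t) = PEdge e t.
Proof. by rewrite /edge_point valK. Qed.

Variant edge_point_spec e t : R -> point -> Prop :=
| EdgePoint0 of t = 0 : edge_point_spec e t 0 (PVertex (esrc e))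
| EdgePoint1 of t = 1 : edge_point_spec e t 1 (PVertex (edst e))
| EdgePointIn (s : open_unit) of t = val s : edge_point_spec e t (val s) (PEdge e s).

Lemma edge_pointP e t : 0 <= t <= 1 -> edge_point_spec e t t (edge_point e t).
Proof.
move=> /andP[]; rewrite le_eqVlt => /orP[/eqP <- _|t0].
  by rewrite edge_point0; constructor.
rewrite le_eqVlt => /orP[/eqP ->|t1]; first by rewrite edge_point1; constructor.
have t01 : 0 < t < 1 by rewrite t0.
by rewrite -[t]/(val (exist _ t t01 : open_unit)) edge_point_in; constructor.
Qed.

Definition height (p : point) : R :=
  match p with
  | PVertex v => (depth v)%:R
  | PEdge e t => (1 - val t) * (depth (esrc e))%:R + val t * (depth (edst e))%:R
  end.

Definition child (e : tree_edge) := if (depth (esrc e) < depth (edst e))%N then edst e else esrc e.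

Definition top (p : point) : V :=
  match p with PVertex v => v | PEdge e _ => child e end.

Lemma edge_depth e : depth (edst e) = (depth (esrc e)).+1 \/ depth (esrc e) = (depth (edst e)).+1.
Proof. exact: adj_dist (edge_adj e). Qed.

Lemma child_neq_root e : child e <> o.
Proof.
apply: (@depth_gt0 _ _ _ T); rewrite /child.
by case: (ltnP (depth (esrc e))) => lt; have [Ed|Ed] := edge_depth e; lia.
Qed.

Lemma child_parent e :
  (child e = edst e /\ parent (child e) = esrc e) \/
  (child e = esrc e /\ parent (child e) = edst e).
Proof.
rewrite /child; case: ltnP => lt; [left|right]; split=> //; apply: parent_unique => //.
- exact/adjC/edge_adj.
- exact: edge_adj.
- by have [] := edge_depth e; lia.
Qed.

Lemma edge_child_inj e e' : child e = child e' -> e = e'.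
Proof.
have [tE tE'] := tree_type T (edgeP e); have [tF tF'] := tree_type T (edgeP e').
move=> Ec; have := child_parent e; have := child_parent e'; rewrite -Ec.
case=> -[E1 E2] [] [E3 E4].
- by apply: edge_eq; congruence.
- by move: tE; rewrite -E3 E1; case: (ty _) tF'.
- by move: tF; rewrite -E1 E3; case: (ty _) tE'.
- by apply: edge_eq; congruence.
Qed.

Lemma height_top p : (depth (top p))%:R - 1 < height p <= (depth (top p))%:R.
Proof.
case: p => [v|e [t /= /andP[t0 t1]]] /=; first by rewrite lexx andbT ltrBlDr ltrDl.
rewrite /child; case: ltnP => lt; have [Ed|Ed] := edge_depth e; try lia.
- by rewrite Ed -natr1; apply/andP; split; nra.
- by rewrite Ed -natr1; apply/andP; split; nra.
Qed.

Lemma height_in_edge e (t : open_unit) : height (PEdge e t) < (depth (child e))%:R.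
Proof.
case: t => [t /= /andP[t0 t1]]; rewrite /child; case: ltnP => lt;
  have [Ed|Ed] := edge_depth e; try lia; rewrite Ed -natr1; nra.
Qed.

Lemma height_ge0 p : 0 <= height p.
Proof.
case: p => [v|e [t /= /andP[t0 t1]]] //=; rewrite addr_ge0 ?mulr_ge0 //; lra.
Qed.

Lemma height_edge_point e t : 0 <= t <= 1 ->
  height (edge_point e t) = (1 - t) * (depth (esrc e))%:R + t * (depth (edst e))%:R.
Proof.
move=> t01; case: (edge_pointP e t01) => [_|_|s _] //=; first by rewrite subr0 mul0r mul1r addr0.
by rewrite subrr mul0r mul1r add0r.
Qed.

Lemma height_edge_dist e s t : 0 <= s <= 1 -> 0 <= t <= 1 ->
  `|height (edge_point e s) - height (edge_point e t)| = `|s - t|.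
Proof.
move=> s01 t01; rewrite !height_edge_point //.
have [Ed|Ed] := edge_depth e; rewrite Ed -natr1.
  by rewrite distrC -[RHS]normrN; congr `|_|; ring.
by rewrite -[RHS]normrN; congr `|_|; ring.
Qed.

Lemma edge_point_inj e s t : 0 <= s <= 1 -> 0 <= t <= 1 ->
  edge_point e s = edge_point e t -> s = t.
Proof.
move=> s01 t01 Est; apply/eqP; rewrite -subr_eq0 -normr_eq0.
by rewrite -(height_edge_dist e) // Est subrr normr0.
Qed.

Lemma edge_point_meet e e' s t : e <> e' -> 0 <= s <= 1 -> 0 <= t <= 1 ->
  edge_point e s = edge_point e' t ->
  [/\ s = 0, t = 0 & esrc e = esrc e'] \/ [/\ s = 1, t = 1 & edst e = edst e'].
Proof.
have [tE tE'] := tree_type T (edgeP e); have [tF tF'] := tree_type T (edgeP e').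
move=> ne s01 t01; case: (edge_pointP e s01) => [_|_|s' _];
  case: (edge_pointP e' t01) => [_|_|t' _] //.
- by case=> Ee; left.
- by case=> Ee; move: tE; rewrite /esrc /edst in Ee *; rewrite Ee (negbTE tF').
- by case=> Ee; move: tF; rewrite /esrc /edst in Ee *; rewrite -Ee (negbTE tE').
- by case=> Ee; right.
- by case=> /ne.
Qed.

Lemma top_height_inj p q : top p = top q -> height p = height q -> p = q.
Proof.
case: p q => [v|e t] [w|e' t'].
- by move=> /= ->.
- by move=> /= Ev; have := height_in_edge e' t'; rewrite /= -Ev => + Eh; rewrite -Eh ltxx.
- by move=> /= Ev; have := height_in_edge e t; rewrite /= Ev => + Eh; rewrite Eh ltxx.
rewrite /top => /edge_child_inj Ee; subst e'.
have t01 (r : open_unit) : 0 <= val r <= 1 by case: r => r /= /andP[? ?]; rewrite !ltW.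
rewrite -!edge_point_in => Eh; congr edge_point; apply/eqP.
by rewrite -subr_eq0 -normr_eq0 -(height_edge_dist e) // Eh subrr normr0.
Qed.

(** The Gromov product at the root: the height at which the paths from the root to [p]
    and to [q] split.  It satisfies a reversed ultrametric inequality ([gromov_ultra]), from
    which both the triangle inequality and the four-point condition follow. *)
Definition gromov (p q : point) : R :=
  Num.min (height p) (Num.min (height q) (meet_depth (top p) (top q))%:R).

Definition tree_dist (p q : point) : R := height p + height q - 2 * gromov p q.

Lemma gromovC p q : gromov p q = gromov q p.
Proof. by rewrite /gromov minCA meet_depthC. Qed.

Lemma gromov_lel p q : gromov p q <= height p.
Proof. by rewrite /gromov ge_min lexx. Qed.

Lemma gromov_ler p q : gromov p q <= height q.
Proof. by rewrite gromovC gromov_lel. Qed.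

Lemma gromov_meet p q : gromov p q <= (meet_depth (top p) (top q))%:R.
Proof. by rewrite /gromov !ge_min lexx !orbT. Qed.

Lemma gromov_ultra p q r : Num.min (gromov p q) (gromov q r) <= gromov p r.
Proof.
have := meet_depth_ultra T o (top p) (top q) (top r); rewrite geq_min -!(ler_nat R).
move: (gromov_lel p q) (gromov_ler q r) (gromov_meet p q) (gromov_meet q r).
rewrite [gromov p r]/gromov; move: (gromov p q) (gromov q r) => a b ap br am bm le.
rewrite !le_min !ge_min ap br orbT /=; apply/orP.
by case/orP: le; [left; exact: le_trans am _|right; exact: le_trans bm _].
Qed.

Lemma gromov_id p : gromov p p = height p.
Proof.
by apply/min_idPl; rewrite le_min lexx meet_depth_id /=; case/andP: (height_top p).
Qed.

Lemma tree_dist_metric : is_metric tree_dist.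
Proof.
split=> [p q|p q|p q|p q r].
- by have := gromov_lel p q; have := gromov_ler p q; rewrite /tree_dist; lra.
- split=> [D0|->]; last by rewrite /tree_dist gromov_id; ring.
  have Hp : height p = gromov p q.
    by have := gromov_lel p q; have := gromov_ler p q; move: D0; rewrite /tree_dist; lra.
  have Hq : height q = gromov p q.
    by have := gromov_lel p q; have := gromov_ler p q; move: D0; rewrite /tree_dist; lra.
  have le := gromov_meet p q; have [mp mq Ea] := meet_depth_spec T o (top p) (top q).
  have up x : height x = gromov p q -> (depth (top x) <= meet_depth (top p) (top q))%N.
    move=> Ex; have /andP[hx _] := height_top x; rewrite -ltnS -(ltr_nat R) -natr1; lra.
  apply: top_height_inj; last by rewrite Hp Hq.
  have Ep : meet_depth (top p) (top q) = depth (top p) by apply/eqP; rewrite eqn_leq mp up.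
  have Eq : meet_depth (top p) (top q) = depth (top q) by apply/eqP; rewrite eqn_leq mq up.
  by move: Ea; rewrite {1}Ep Eq !ancestor_depth.
- by rewrite /tree_dist gromovC; ring.
- have := gromov_ultra p q r; rewrite ge_min.
  have := gromov_ler p q; have := gromov_lel q r; rewrite /tree_dist.
  by move=> ? ? /orP[] ?; lra.
Qed.

Lemma tree_dist_four_point : four_point tree_dist.
Proof.
move=> x y z w; rewrite le_max /tree_dist.
have U a b c : gromov a b >= gromov a c \/ gromov a b >= gromov c b.
  by have := gromov_ultra a c b; rewrite ge_min => /orP.
have C := gromovC.
have m (P Q : bool) : P \/ Q -> P || Q by move=> H; apply/orP.
suff : (gromov x z + gromov y w <= gromov x y + gromov z w) \/
       (gromov x w + gromov y z <= gromov x y + gromov z w).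
  by case=> H; apply/orP; [left|right]; lra.
have := U x y z; have := U x y w; have := U z w x; have := U z w y.
rewrite (C z x) (C z y) (C w y).
by move=> [] ? [] ? [] ? [] ?; lra.
Qed.

(** ** The realization as a one-dimensional cube complex *)

Definition tree_chart (e : tree_edge) (u : 'rV[R]_1) : point := edge_point e (u 0 0).

Lemma unit_cube1 (u : 'rV[R]_1) : unit_cube R 1 u <-> 0 <= u 0 0 <= 1.
Proof. by split=> [|h i]; [exact|rewrite (ord1 i)]. Qed.

Lemma row1_eq (u v : 'rV[R]_1) : u 0 0 = v 0 0 -> u = v.
Proof. by move=> Euv; apply/rowP => i; rewrite (ord1 i). Qed.

Lemma edist1 (u v : 'rV[R]_1) : edist u v = `|u 0 0 - v 0 0|.
Proof. by rewrite /edist big_ord_recl big_ord0 addr0 sqrtr_sqr. Qed.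

Lemma isometry_onto_id n (A : set 'rV[R]_n) : isometry_onto A A id.
Proof. by split=> //; rewrite image_id. Qed.

Hypothesis vertex_on_edge : forall v, exists w, adj v w.

Lemma tree_chart_surj x : exists e, (tree_chart e @` unit_cube R 1) x.
Proof.
have zero_in : unit_cube R 1 (const_mx 0) by apply/unit_cube1; rewrite mxE lexx ler01.
have one_in : unit_cube R 1 (const_mx 1) by apply/unit_cube1; rewrite mxE lexx ler01.
case: x => [v|e t].
  have [w [vw|wv]] := vertex_on_edge v.
    exists (exist _ (v, w) vw : tree_edge), (const_mx 0) => //.
    by rewrite /tree_chart mxE edge_point0.
  exists (exist _ (w, v) wv : tree_edge), (const_mx 1) => //.
  by rewrite /tree_chart mxE edge_point1.
exists e, (const_mx (val t)); last by rewrite /tree_chart mxE edge_point_in.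
by apply/unit_cube1; rewrite mxE; case: t => t /= /andP[? ?]; rewrite !ltW.
Qed.

Lemma tree_chart_inj e (u v : 'rV[R]_1) : unit_cube R 1 u -> unit_cube R 1 v ->
  tree_chart e u = tree_chart e v -> u = v.
Proof. by move=> /unit_cube1 u1 /unit_cube1 v1 /(edge_point_inj u1 v1)/row1_eq. Qed.

Lemma end_face (b : bool) (u : 'rV[R]_1) :
  cube_face (fun=> Some b) u <-> u 0 0 = b%:R.
Proof.
split=> [[_ H]|Eu]; first exact: H.
split=> [|i b' [<-]]; last by rewrite (ord1 i).
by apply/unit_cube1; rewrite Eu; case: b {Eu}; rewrite ?lexx ler01.
Qed.

(** Two distinct edges share at most one vertex, which is at the same end of both
    because of the bipartition, so the gluing map is the identity. *)
Lemma tree_chart_glue e e' :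
  (tree_chart e @` unit_cube R 1) `&` (tree_chart e' @` unit_cube R 1) !=set0 ->
  exists (A A' : set 'rV[R]_1) h, [/\ is_face A, is_face A', isometry_onto A A' h
    & forall u u' : 'rV[R]_1, unit_cube R 1 u -> unit_cube R 1 u' ->
        (tree_chart e u = tree_chart e' u' <-> A u /\ u' = h u)].
Proof.
move=> [x [[v /unit_cube1 v1 Ev] [v' /unit_cube1 v1' Ev']]].
have [Ee|ne] := EM (e = e').
  subst e'; exists (unit_cube R 1), (unit_cube R 1), id; split.
  - by exists (fun=> None); apply/seteqP; split=> u => [u1|[]//]; split.
  - by exists (fun=> None); apply/seteqP; split=> u => [u1|[]//]; split.
  - exact: isometry_onto_id.
  - by move=> u u' u1 u1'; split=> [/(tree_chart_inj u1 u1') ->|[_ ->]].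
have face b : is_face (cube_face (R := R) (n := 1) (fun=> Some b)) by exists (fun=> Some b).
have Evv : edge_point e (v 0 0) = edge_point e' (v' 0 0).
  by rewrite -/(tree_chart e v) -/(tree_chart e' v') Ev Ev'.
have [[_ _ Es]|[_ _ Es]] := edge_point_meet ne v1 v1' Evv.
  exists (cube_face (fun=> Some false)), (cube_face (fun=> Some false)), id.
  split=> //; first exact: isometry_onto_id.
  move=> u u' /unit_cube1 u1 /unit_cube1 u1'; split.
    case/(edge_point_meet ne u1 u1') => -[Eu Eu' Et]; last by case: ne; exact: edge_eq.
    by split; [exact/end_face|apply: row1_eq; rewrite Eu].
  by case=> /end_face Eu ->; rewrite /tree_chart Eu !edge_point0 Es.
exists (cube_face (fun=> Some true)), (cube_face (fun=> Some true)), id.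
split=> //; first exact: isometry_onto_id.
move=> u u' /unit_cube1 u1 /unit_cube1 u1'; split.
  case/(edge_point_meet ne u1 u1') => -[Eu Eu' Et]; first by case: ne; exact: edge_eq.
  by split; [exact/end_face|apply: row1_eq; rewrite Eu].
by case=> /end_face Eu ->; rewrite /tree_chart Eu !edge_point1 Es.
Qed.

Definition tree_complex : cubical_complex R :=
  @CubicalComplex R point tree_edge (fun=> 1%N) tree_chart
    tree_chart_surj tree_chart_inj tree_chart_glue.

End Realization.

Section Strings.
Context {R : realType} (K : cubical_complex R).
Local Open Scope ring_scope.
Import Order.TTheory GRing.Theory Num.Theory.
Implicit Types (x y z : carrier K).

Lemma string_cat x y z l l' : string x y l -> string y z l' -> string x z (l + l').
Proof.
elim=> [{}x|c u v {}y {}l u1 v1 _ IH yz]; first by rewrite add0r.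
by rewrite -addrA; exact: StringCons u1 v1 (IH yz).
Qed.

Lemma string_segment (c : cell K) u v : unit_cube R (cell_dim c) u ->
  unit_cube R (cell_dim c) v -> string (chart u) (chart v) (edist u v).
Proof.
by move=> u1 v1; rewrite -[edist u v]addr0; apply: StringCons u1 v1 (StringNil _).
Qed.

Lemma string_rev x y l : string x y l -> string y x l.
Proof.
elim=> [{}x|c u v {}y {}l u1 v1 _ IH]; first exact: StringNil.
by rewrite addrC edistC; exact: string_cat IH (string_segment v1 u1).
Qed.

Variable d : carrier K -> carrier K -> R.
Hypothesis dm : is_metric d.
Hypothesis d_chart : forall (c : cell K) u v, unit_cube R (cell_dim c) u ->
  unit_cube R (cell_dim c) v -> d (chart u) (chart v) = edist u v.

Lemma string_dist_le x y l : string x y l -> d x y <= l.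
Proof.
case: dm => _ d0 _ tri; elim=> [{}x|c u v {}y {}l u1 v1 _ IH].
  by rewrite (d0 x x).2.
by apply: le_trans (tri _ (chart v) _) _; rewrite d_chart // lerD2l.
Qed.

(** A metric that agrees with the charts is a lower bound for the length of strings. *)
Lemma cube_dist_eq : (forall x y, string x y (d x y)) -> @cube_dist R K = d.
Proof.
move=> dS; apply/funext => x; apply/funext => y; apply/eqP; rewrite eq_le; apply/andP; split.
  apply: ge_inf; last exact: dS.
  by exists (d x y) => l; exact: string_dist_le.
apply: lb_le_inf; first by exists (d x y); exact: dS.
by move=> l; exact: string_dist_le.
Qed.

Lemma geodesic_segment (c : cell K) u v : unit_cube R (cell_dim c) u ->
  unit_cube R (cell_dim c) v -> exists g, geodesic d (chart u) (chart v) g.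
Proof.
move=> u1 v1; case: (dm) => d_ge0 d0 dC tri.
set L := edist u v; have L0 : 0 <= L by exact: edist_ge0.
pose a t := (1 - t / L) *: u + (t / L) *: v.
have a_in t : 0 <= t <= L -> unit_cube R (cell_dim c) (a t).
  move=> /andP[t0 t1] i; rewrite !mxE.
  have /andP[ui0 ui1] := u1 i; have /andP[vi0 vi1] := v1 i.
  have r0 : 0 <= t / L by rewrite divr_ge0.
  have r1 : t / L <= 1.
    have [L_gt0|L_le0] := ltP 0 L; first by rewrite ler_pdivrMr // mul1r.
    by have -> : L = 0 by [apply/eqP; rewrite eq_le L_le0]; rewrite invr0 mulr0 ler01.
  by apply/andP; split; nra.
have da s t : edist (a s) (a t) = `|s - t| / L * L.
  by rewrite edist_segment -/L -mulrBl normrM (ger0_norm (x := L^-1)) ?invr_ge0.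
have dL : d (chart u) (chart v) = L by exact: d_chart.
exists (fun t => chart (a t)); rewrite /geodesic dL; split.
- by rewrite /a mul0r subr0 scale1r scale0r addr0.
- have [L_eq0|L_neq0] := eqVneq L 0.
    have Euv : chart u = chart v by apply/d0; rewrite dL.
    by rewrite /a L_eq0 mul0r subr0 scale1r scale0r addr0.
  by rewrite /a divff // subrr scale0r scale1r add0r.
- move=> s t sL tL; rewrite d_chart ?da; try exact: a_in.
  have [L_eq0|L_neq0] := eqVneq L 0; last by rewrite divfK.
  move: sL tL; rewrite L_eq0 -!eq_le => /eqP <- /eqP <-.
  by rewrite subrr normr0 !mul0r.
Qed.

Lemma geodesic_cat x y z g h : geodesic d x y g -> geodesic d y z h ->
  d x z = d x y + d y z -> exists k, geodesic d x z k.
Proof.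
case: (dm) => d_ge0 d0 dC tri [g0 g1 gd] [h0 h1 hd] Exz.
have xy0 := d_ge0 x y; have yz0 := d_ge0 y z.
exists (fun t => if t <= d x y then g t else h (t - d x y)).
have mixed s t : 0 <= s <= d x y -> d x y <= t <= d x z ->
    d (g s) (h (t - d x y)) = t - s.
  move=> /andP[s0 s1] /andP[t0 t1].
  have gs1 : d (g s) y = d x y - s.
    by rewrite -{1}g1 gd ?lexx ?xy0 ?s0 // distrC ger0_norm // subr_ge0.
  have gs0 : d x (g s) = s.
    by rewrite -g0 gd ?lexx ?xy0 ?s0 // sub0r normrN ger0_norm.
  have t01 : 0 <= t - d x y <= d y z by apply/andP; split; lra.
  have ht0 : d y (h (t - d x y)) = t - d x y.
    by rewrite -{1}h0 hd ?lexx ?yz0 // sub0r normrN ger0_norm //; case/andP: t01.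
  have ht1 : d (h (t - d x y)) z = d x z - t.
    rewrite -{1}h1 hd ?lexx ?yz0 // distrC ger0_norm; first by lra.
    by rewrite subr_ge0; case/andP: t01.
  have T1 := tri (g s) y (h (t - d x y)).
  have T2 := tri x (g s) z; have T3 := tri (g s) (h (t - d x y)) z; lra.
split.
- by rewrite xy0.
- case: ifP => le; last by rewrite Exz addrAC subrr add0r.
  have yz : y = z by apply/d0; lra.
  by rewrite Exz -yz (d0 y y).2 // addr0 g1 yz.
- move=> s t /andP[s0 s1] /andP[t0 t1].
  have [sx|sx] := lerP s (d x y); have [tx|tx] := lerP t (d x y).
  + by apply: gd; rewrite ?s0 ?t0.
  + rewrite mixed ?s0 ?(ltW tx) // distrC ger0_norm // subr_ge0; lra.
  + rewrite dC mixed ?t0 ?(ltW sx) // ger0_norm // subr_ge0; lra.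
  + by rewrite hd; [congr `|_|; ring|apply/andP; split; lra|apply/andP; split; lra].
Qed.

(** The segments of a string that realizes the distance are geodesics that fit
    together. *)
Lemma geodesic_string x y l : string x y l -> l = d x y -> exists g, geodesic d x y g.
Proof.
case: (dm) => d_ge0 d0 dC tri.
elim=> [{}x _|c u v {}y {}l u1 v1 vy IH El].
  exists (fun=> x); have E0 : d x x = 0 by exact/d0.
  split=> // s t; rewrite E0 -!eq_le => /eqP <- /eqP <-.
  by rewrite subrr normr0.
have le := string_dist_le vy; have T := tri (chart u) (chart v) y.
rewrite d_chart // in T; have [|h gh] := IH; first by lra.
have [g gg] := geodesic_segment u1 v1.
by apply: geodesic_cat gg gh _; rewrite d_chart //; lra.
Qed.

Lemma cat0_from_strings (x0 : carrier K) : four_point d ->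
  (forall x y, string x y (d x y)) -> cat0_cube_complex K.
Proof.
move=> d4 dS; split; first by exists.
  by move=> x y; exists (d x y).
rewrite (cube_dist_eq dS); split=> //; last exact: four_point_cat0.
by move=> x y; apply: geodesic_string (dS x y) _.
Qed.

End Strings.

Section TreeComplex.
Variables (R : realType) (V : Type) (E : V -> V -> Prop) (ty : V -> bool).
Hypothesis T : is_tree E ty.
Variable o : V.
Hypothesis vertex_on_edge : forall v, exists w, adjacent E v w.
Local Open Scope ring_scope.
Import Order.TTheory GRing.Theory Num.Theory.
Implicit Types (u v w : V).
Local Notation depth := (depth T o).
Local Notation parent := (parent T o).
Local Notation ancestor := (ancestor T o).
Local Notation meet_depth := (meet_depth T o).
Local Notation height := (height (R := R) T o).
Local Notation top := (top (R := R) T o).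
Local Notation child := (child T o).
Local Notation d := (tree_dist (R := R) T o).
Local Notation K := (tree_complex R T o vertex_on_edge).
Implicit Types (p q : point R E).

Lemma edge_top e t : 0 <= t <= 1 ->
  top (edge_point e t) = child e \/
  top (edge_point e t) = parent (child e)
    /\ height (edge_point e t) = (depth (parent (child e)))%:R.
Proof.
by move=> t01; case: (edge_pointP e t01) => [_|_|s _] /=; try (by left);
  have [[-> ->]|[-> ->]] := child_parent T o e; auto.
Qed.

Lemma tree_dist_edge e s t : 0 <= s <= 1 -> 0 <= t <= 1 ->
  d (edge_point e s) (edge_point e t) = `|s - t|.
Proof.
move=> s01 t01; rewrite -(height_edge_dist T o e) //.
set p := edge_point e s; set q := edge_point e t.
have ce := @child_neq_root _ _ _ T o e.
have up : Num.min (height p) (height q) <= (meet_depth (top p) (top q))%:R.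
  have cp : (depth (parent (child e)))%:R <= (meet_depth (child e) (parent (child e)))%:R :> R.
    by rewrite ler_nat; exact: meet_depth_parent.
  rewrite ge_min; apply/orP; have [Ep|[Ep hp]] := edge_top e s01; have [Eq|[Eq hq]] := edge_top e t01.
  - rewrite -/p in Ep; rewrite -/q in Eq.
    by left; rewrite Eq -Ep meet_depth_id; have /andP[] := height_top T o p.
  - by right; rewrite -/p -/q in Ep Eq hq *; rewrite hq Ep Eq.
  - by left; rewrite -/p -/q in Ep Eq hp *; rewrite hp Ep Eq meet_depthC.
  - by left; rewrite -/p -/q in Ep Eq hp *; rewrite hp Ep Eq meet_depth_id.
rewrite /tree_dist /gromov minA (min_idPl up); by have [le|lt] := lerP (height p) (height q); ring.
Qed.

Lemma cell_dist (c : cell K) (u v : 'rV[R]_1) : unit_cube R 1 u -> unit_cube R 1 v ->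
  d (tree_chart c u) (tree_chart c v) = edist u v.
Proof.
by move=> /unit_cube1 u1 /unit_cube1 v1; rewrite /tree_chart tree_dist_edge // edist1.
Qed.

Lemma edge_string e s t : 0 <= s <= 1 -> 0 <= t <= 1 ->
  string (K := K) (edge_point e s) (edge_point e t)
    `|height (edge_point e s) - height (edge_point e t)|.
Proof.
move=> s01 t01; rewrite (height_edge_dist T o) //.
have s1 : unit_cube R 1 (const_mx s) by apply/unit_cube1; rewrite mxE.
have t1 : unit_cube R 1 (const_mx t) by apply/unit_cube1; rewrite mxE.
have := @string_segment R K e _ _ s1 t1.
by rewrite edist1 !mxE /= /tree_chart !mxE.
Qed.

Definition on_edge e p := exists2 t, 0 <= t <= 1 & p = edge_point e t.

Lemma on_edge_string e p q : on_edge e p -> on_edge e q ->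
  string (K := K) p q `|height p - height q|.
Proof. by case=> s s01 -> [t t01 ->]; exact: edge_string. Qed.

Lemma on_edge_ends e : on_edge e (PVertex R E (esrc e)) /\ on_edge e (PVertex R E (edst e)).
Proof.
split; [exists 0; last by rewrite edge_point0|exists 1; last by rewrite edge_point1].
  by rewrite lexx ler01.
by rewrite lexx ler01.
Qed.

Lemma on_edge_child e : on_edge e (PVertex R E (child e)) /\
  on_edge e (PVertex R E (parent (child e))).
Proof. by have [? ?] := on_edge_ends e; have [[-> ->]|[-> ->]] := child_parent T o e. Qed.

Lemma edge_above v : v <> o -> exists e, child e = v.
Proof.
move=> vo; have [[vp|pv] Ed] := parentP T (o := o) vo.
  exists (exist _ (v, parent v) vp : tree_edge E); rewrite /child /esrc /edst /=.
  by rewrite Ed ltnNge leqnSn.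
exists (exist _ (parent v, v) pv : tree_edge E); rewrite /child /esrc /edst /=.
by rewrite Ed leqnn.
Qed.

Lemma on_edge_top p e : child e = top p -> on_edge e p.
Proof.
case: p => [v|e' t] /= Ee; first by rewrite -Ee; have [] := on_edge_child e.
have -> : e = e' by exact: edge_child_inj Ee.
exists (val t); last by rewrite edge_point_in.
by case: t => t /= /andP[? ?]; rewrite !ltW.
Qed.

Lemma top_root p : top p = o -> p = PVertex R E o.
Proof.
by case: p => [v /= -> //|e t] /= Eo; have := @child_neq_root _ _ _ T o e; rewrite Eo.
Qed.

Lemma ancestor_string v n : (n <= depth v)%N ->
  string (K := K) (PVertex R E v) (PVertex R E (ancestor n v)) ((depth v)%:R - n%:R).
Proof.
move Ek : (depth v - n)%N => k; elim: k v Ek => [|k IH] v Ek nv.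
  have En : n = depth v by lia.
  by rewrite En ancestor_depth subrr; exact: StringNil.
have vo : v <> o by apply: (depth_gt0 (T := T)); rewrite -/(depth v); lia.
have [vp Ed] := parentP T (o := o) vo; have [e Ee] := edge_above vo.
have [ov op] := on_edge_child e; rewrite Ee in ov op.
have := on_edge_string ov op; rewrite /= Ed -natr1 addrAC subrr add0r normr1 => S1.
have S2 := IH (parent v) _ _.
rewrite -ancestor_parent; last lia.
rewrite -addrAC addrC; apply: string_cat S1 (S2 _ _); lia.
Qed.

Lemma down_string p n : n%:R <= height p ->
  string (K := K) p (PVertex R E (ancestor n (top p))) (height p - n%:R).
Proof.
move=> np; have /andP[hp1 hp2] := height_top T o p.
have nt : (n <= depth (top p))%N by rewrite -(ler_nat R); exact: le_trans np hp2.
have [En|ne] := eqVneq n (depth (top p)).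
  have -> : p = PVertex R E (top p).
    apply: (top_height_inj (T := T) (o := o)) => //=; apply/eqP.
    by rewrite eq_le hp2 /= -En.
  by rewrite /= En ancestor_depth subrr; exact: StringNil.
have lt : (n < depth (top p))%N by rewrite ltn_neqAle ne.
have vo : top p <> o by apply: (depth_gt0 (T := T)); exact: leq_ltn_trans lt.
have [vp Ed] := parentP T (o := o) vo; have [e Ee] := edge_above vo.
have [_ op] := on_edge_child e; rewrite Ee in op.
have := on_edge_string (on_edge_top Ee) op; rewrite /= ger0_norm; last first.
  by rewrite subr_ge0; move: hp1; rewrite Ed -natr1 addrK; exact: ltW.
move=> S1; have S2 := @ancestor_string (parent (top p)) n _.
rewrite ancestor_parent // in S2.
have := string_cat S1 (S2 _); rewrite addrA subrK; apply; lia.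
Qed.

(** When [p] is an ancestor of [q], go down from [q] to the upper end of the edge of [p],
   unless [q] is on the same edge. *)
Lemma below_string p q : height p <= (meet_depth (top p) (top q))%:R ->
  height p <= height q -> string (K := K) q p (height q - height p).
Proof.
move=> hm hpq; have /andP[hp1 hp2] := height_top T o p; have /andP[hq1 hq2] := height_top T o q.
have le : (depth (top p) <= meet_depth (top p) (top q))%N.
  by rewrite -ltnS -(ltr_nat R) -natr1; lra.
have /meet_depthP[_ lq Ea] := le; rewrite ancestor_depth in Ea.
have [vo|vo] := EM (top p = o).
  have Ep := top_root vo; rewrite Ep /= depth_root.
  by have := @down_string q 0 (height_ge0 T o q); rewrite ancestor0.
have [e Ee] := edge_above vo; have [ov _] := on_edge_child e; rewrite Ee in ov.
have [dq|dq] := lerP (depth (top p))%:R (height q).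
  have := down_string dq; rewrite -Ea => S1.
  have := string_cat S1 (on_edge_string ov (on_edge_top Ee)).
  by rewrite /= ger0_norm ?subr_ge0 // addrA subrK.
have Et : top p = top q.
  rewrite Ea; have -> : depth (top p) = depth (top q); last exact: ancestor_depth.
  by apply/eqP; rewrite eqn_leq lq /= -ltnS -(ltr_nat R) -natr1; lra.
have := on_edge_string (on_edge_top (etrans Ee Et)) (on_edge_top Ee).
by rewrite ger0_norm // subr_ge0.
Qed.

(** Go down from both points to their lowest common ancestor. *)
Lemma tree_string p q : string (K := K) p q (d p q).
Proof.
rewrite /tree_dist; have := erefl (gromov T o p q); rewrite {1}/gromov.
have [le1|lt1] := lerP (height p) (Num.min (height q) (meet_depth (top p) (top q))%:R).
  move: le1; rewrite le_min => /andP[hq hm] <-.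
  have -> : height p + height q - 2 * height p = height q - height p by ring.
  by apply: string_rev; exact: below_string.
have [le2|lt2] := lerP (height q) (meet_depth (top p) (top q))%:R.
  move=> <-; have -> : height p + height q - 2 * height q = height p - height q by ring.
  by apply: below_string; [rewrite meet_depthC|move: lt1; rewrite (min_idPl le2) => /ltW].
move=> <-; have [_ _ Ea] := meet_depth_spec T o (top p) (top q).
move: lt1; rewrite (min_idPr (ltW lt2)) => lt1.
have S1 := down_string (ltW lt1); have S2 := down_string (ltW lt2).
rewrite -Ea in S2; have := string_cat S1 (string_rev S2).
by congr string; ring.
Qed.

Lemma tree_complex_cat0 : cat0_cube_complex K.
Proof.
apply: (cat0_from_strings (d := d : carrier K -> carrier K -> R)).
- exact: tree_dist_metric.
- exact: cell_dist.
- exact: PVertex o.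
- exact: tree_dist_four_point.
- exact: tree_string.
Qed.

Lemma tree_complex_finite_dimensional : finite_dimensional K.
Proof. by exists 1%N. Qed.

Variables (G : groupType) (act : G -> V -> V).
Hypothesis act1 : forall x, act 1%g x = x.
Hypothesis actM : forall g h x, act (g * h)%g x = act g (act h x).
Hypothesis actE : forall g x y, E x y -> E (act g x) (act g y).

Definition act_edge g (e : tree_edge E) : tree_edge E :=
  exist _ (act g (esrc e), act g (edst e)) (actE g (edgeP e)).

Definition act_point g p : point R E :=
  match p with PVertex v => PVertex R E (act g v) | PEdge e t => PEdge (act_edge g e) t end.

Lemma act_edge_point g e t : act_point g (edge_point e t) = edge_point (act_edge g e) t.
Proof. by rewrite /edge_point; case: insubP => //= _; case: ifP. Qed.

Lemma act_point_cellular : @cellular_action R K G act_point.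
Proof.
split.
- case=> [v|e t] /=; first by rewrite act1.
  by congr PEdge; apply: edge_eq; rewrite /= /esrc /edst /= act1.
- move=> g h [v|e t] /=; first by rewrite actM.
  by congr PEdge; apply: edge_eq; rewrite /= /esrc /edst /= actM.
move=> g e; exists (act_edge g e), (unit_cube R 1), id; split.
- by exists (fun=> None); apply/seteqP; split=> u => [u1|[]//]; split.
- exact: isometry_onto_id.
- by move=> u _; exact: act_edge_point.
Qed.

(** The action preserves the bipartition, so that it fixes both ends of an edge when
    it fixes an interior point. *)
Lemma FC'_fixes_vertex : FC'_group R G -> forall g, exists v, act g v = v.
Proof.
move=> /(_ K act_point tree_complex_finite_dimensional tree_complex_cat0 act_point_cellular).
move=> fixes g; have [[v|e t] /=] := fixes g; first by case=> ?; exists v.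
by case=> Ee; exists (esrc e); rewrite -[in RHS]Ee.
Qed.

End TreeComplex.

(** * The Bass-Serre tree of two non-adjacent vertices *)

Section BassSerre.
Variables (Gamma : labeled_graph) (a b : Gamma).
Hypothesis nab : [set a; b]%SET \notin edges Gamma.
Hypothesis neq_ab : a != b.
Local Open Scope group_scope.
Local Notation A := (artin_group Gamma).
Implicit Types (g h k : A) (i j : bool) (s t : Gamma) (Z : {set Gamma}).

(** The boolean [true] stands for [a], and [false] for [b]: these are the generators of
   the two factors of the amalgam. *)
Definition factor i : {set Gamma} := ~: [set if i then a else b].

Lemma in_factor i s : (s \in factor i) = (s != if i then a else b).
Proof. by rewrite !inE. Qed.

Definition edge_group : A -> bool :=
  fun g => `[< standard_parabolic (factor true) g /\ standard_parabolic (factor false) g >].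

Lemma edge_groupMl s (e : bool) x : s != a -> s != b ->
  edge_group ((artin_letter s e)^-1 * x) = edge_group x.
Proof.
move=> sa sb; apply/asbool_equiv_eq; rewrite !standard_parabolicE.
have gen i : span [set artin_gen y | y in [set` factor i]] (artin_letter s e)^-1.
  have mem : [set artin_gen y | y in [set` factor i]] (artin_gen s).
    by exists s => //=; rewrite in_factor; case: i.
  by apply: span_inv; rewrite /artin_letter; case: e; [exact: span_in|exact: span_inV].
by rewrite !(spanMl _ (gen _)).
Qed.

(** The group acts on its boolean functions by affine maps: by translations on the first
    factor, and by translations conjugated by the indicator of the edge group on
    the second.  The two agree on the edge group, so they extend to the amalgam. *)
Definition affine_step (l : Gamma * bool) (f : A -> bool) : A -> bool :=
  let h := artin_letter l.1 l.2 in
  fun x => f (h^-1 * x) (+) ((l.1 == a) && (edge_group (h^-1 * x) (+) edge_group x)).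

Lemma artin_letterV s e : (artin_letter s (~~ e))^-1 = artin_letter s e.
Proof. by case: e; rewrite /= ?invgK. Qed.

Lemma affine_stepK s e f : affine_step (s, e) (affine_step (s, ~~ e) f) = f.
Proof.
apply/funext => x; rewrite /affine_step /= artin_letterV !mulVKg.
by case: (s == a); case: (f x); case: (edge_group x); case: (edge_group _).
Qed.

Lemma word_class_letter l u : word_class (@artin_rel Gamma) (l :: u)
  = artin_letter l.1 l.2 * word_class (@artin_rel Gamma) u.
Proof. by rewrite word_class_cons; case: l => s []; rewrite ?letterV. Qed.

Lemma affine_word_left u f : all (fun l => l.1 != a) u ->
  foldr affine_step f u = fun x => f ((word_class (@artin_rel Gamma) u)^-1 * x).
Proof.
elim: u => [_|l u IH /= /andP[la ua]]; first by apply/funext => x; rewrite word_class_nil invg1 mul1g.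
rewrite IH // /affine_step (negbTE la) word_class_letter; apply/funext => x.
by rewrite addbF invgM mulgA.
Qed.

Lemma affine_word_right u f : all (fun l => l.1 != b) u ->
  foldr affine_step f u = fun x => f ((word_class (@artin_rel Gamma) u)^-1 * x)
    (+) edge_group ((word_class (@artin_rel Gamma) u)^-1 * x) (+) edge_group x.
Proof.
elim: u => [_|l u IH /= /andP[lb ub]].
  by apply/funext => x; rewrite word_class_nil invg1 mul1g -addbA addbb addbF.
rewrite IH // word_class_letter; apply/funext => x; rewrite /affine_step invgM -!mulgA.
case: eqVneq => [_|la] /=; last by rewrite addbF (@edge_groupMl l.1 l.2 x).
by rewrite -!addbA addKb.
Qed.

Lemma affine_rel u v : artin_rel u v -> forall f, True ->
  foldr affine_step f u = foldr affine_step f v.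
Proof.
move=> uv f _; have Euv : word_class (@artin_rel Gamma) u = word_class (@artin_rel Gamma) v.
  exact/word_classP/WordRel.
case: uv Euv => s t st Euv; have neq_st := edge_neq st.
have letters c x y n : x != c -> y != c -> all (fun l => l.1 != c) (Defs.alternating x y n).
  by move=> xc yc; elim: n x y xc yc => // n IH x y xc yc; rewrite alternatingS /= xc IH.
have [[sa ta]|nA] := EM (s != a /\ t != a); first by rewrite !affine_word_left ?Euv ?letters.
have [sb tb] : s != b /\ t != b.
  split; apply/eqP => E; apply: nA; split; apply/eqP => E'.
  - by move: neq_ab; rewrite -E -E' eqxx.
  - by move: nab; rewrite -E -E' finset.setUC st.
  - by move: nab; rewrite -E -E' st.
  - by move: neq_ab; rewrite -E -E' eqxx.
by rewrite !affine_word_right ?Euv ?letters.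
Qed.

Let trivT (f : A -> bool) := True.
Let affine_stepP l f : trivT f -> trivT (affine_step l f). Proof. by []. Qed.
Let affine_stepK' s e f : trivT f -> affine_step (s, e) (affine_step (s, ~~ e) f) = f.
Proof. by move=> _; exact: affine_stepK. Qed.

Definition affine_act g f := presented_act (rel := @artin_rel Gamma) affine_step g f.

Lemma affine_actM g h f : affine_act (g * h) f = affine_act g (affine_act h f).
Proof. exact: (presented_actM affine_stepP affine_stepK' affine_rel). Qed.

Lemma affine_act1 f : affine_act 1 f = f.
Proof. exact: (presented_act1 affine_stepP affine_stepK' affine_rel). Qed.

Lemma affine_act_letter s e f : affine_act (artin_letter s e) f = affine_step (s, e) f.
Proof.
have -> : artin_letter s e = letter (@artin_rel Gamma) (s, e) by case: e; rewrite ?letterV.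
exact: (presented_act_letter affine_stepP affine_stepK' affine_rel).
Qed.

Lemma artin_letter_ind (P : A -> Prop) : P 1 ->
  (forall s e g, P g -> P (artin_letter s e * g)) -> forall g, P g.
Proof.
by move=> P1 PM; apply: artin_ind => // s g Pg; [exact: (PM s true)|exact: (PM s false)].
Qed.

Lemma standard_parabolic_letter_ind Z (P : A -> Prop) : P 1 ->
  (forall s e g, s \in Z -> P g -> P (artin_letter s e * g)) ->
  forall g, standard_parabolic Z g -> P g.
Proof.
move=> P1 PM; apply: standard_parabolic_ind => // s g Zs Pg.
  exact: (PM s true).
exact: (PM s false).
Qed.

Lemma affine_act_affine g f x :
  affine_act g f x = affine_act g (fun=> false) x (+) f (g^-1 * x).
Proof.
elim/artin_letter_ind: g f x => [|s e g IH] f x.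
  by rewrite !affine_act1 invg1 mul1g.
rewrite !affine_actM !affine_act_letter /affine_step /= [in LHS]IH invgM mulgA.
by rewrite -!addbA; congr (_ (+) _); rewrite addbC.
Qed.

Lemma affine_act_left g : standard_parabolic (factor true) g ->
  affine_act g (fun=> false) = fun=> false.
Proof.
elim/standard_parabolic_letter_ind => [|s e k]; first exact: affine_act1.
rewrite in_factor => sa IH; rewrite affine_actM IH affine_act_letter.
by apply/funext => x; rewrite /affine_step /= (negbTE sa).
Qed.

Lemma affine_act_right g : standard_parabolic (factor false) g ->
  affine_act g edge_group = edge_group.
Proof.
elim/standard_parabolic_letter_ind => [|s e k]; first exact: affine_act1.
rewrite in_factor => sb IH; rewrite affine_actM IH affine_act_letter.
apply/funext => x; rewrite /affine_step /=; case: eqVneq => [_|sa] /=.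
  by rewrite addKb.
by rewrite addbF edge_groupMl.
Qed.

Definition coset_in i g : set A := [set h | standard_parabolic (factor i) (g^-1 * h)].

Lemma coset_inE i g k : coset_in i g k = standard_parabolic (factor i) (g^-1 * k).
Proof. by []. Qed.

Definition bs_vertex := {x : bool * set A | exists g, x.2 = coset_in x.1 g}.

Definition bs_coset i g : bs_vertex := exist _ (i, coset_in i g) (ex_intro _ g erefl).

Definition bs_type (x : bs_vertex) : bool := (sval x).1.

Lemma bs_vertex_eq (x y : bs_vertex) : sval x = sval y -> x = y.
Proof.
by case: x y => [x px] [y py] /= Exy; subst y; congr exist; exact: Prop_irrelevance.
Qed.

Lemma bs_cosetP i j g h :
  bs_coset i g = bs_coset j h <-> i = j /\ standard_parabolic (factor i) (g^-1 * h).
Proof.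
split=> [[Eij] Egh|[<- Pgh]].
  subst j; split=> //.
  have : coset_in i h h by rewrite coset_inE mulVg; exact: standard_parabolic1.
  by rewrite -Egh.
apply: bs_vertex_eq => /=; congr (_, _); apply/seteqP; split=> k; rewrite !coset_inE => H.
  have -> : h^-1 * k = (g^-1 * h)^-1 * (g^-1 * k) by rewrite invgM invgK -mulgA mulVKg.
  exact: standard_parabolicM (standard_parabolicV Pgh) H.
have -> : g^-1 * k = (g^-1 * h) * (h^-1 * k) by rewrite -mulgA mulVKg.
exact: standard_parabolicM.
Qed.

Lemma bs_vertexP x : exists g, x = bs_coset (bs_type x) g.
Proof. by case: x => -[i S] [g /= Eg]; exists g; apply: bs_vertex_eq; congr (_, _); exact: Eg. Qed.

Lemma bs_act_subproof g (x : bs_vertex) :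
  exists k, [set h | (sval x).2 (g^-1 * h)] = coset_in (sval x).1 k.
Proof.
case: x => -[i S] [k /= ->]; exists (g * k).
by apply/seteqP; split=> h; rewrite /= !coset_inE invgM mulgA.
Qed.

Definition bs_act g (x : bs_vertex) : bs_vertex :=
  exist _ ((sval x).1, [set h | (sval x).2 (g^-1 * h)]) (bs_act_subproof g x).

Lemma bs_act_coset g i h : bs_act g (bs_coset i h) = bs_coset i (g * h).
Proof.
apply: bs_vertex_eq; congr (_, _).
by apply/seteqP; split=> k; rewrite /= !coset_inE invgM mulgA.
Qed.

Lemma bs_act1 x : bs_act 1 x = x.
Proof. by have [g ->] := bs_vertexP x; rewrite bs_act_coset mul1g. Qed.

Lemma bs_actM g h x : bs_act (g * h) x = bs_act g (bs_act h x).
Proof. by have [k ->] := bs_vertexP x; rewrite !bs_act_coset mulgA. Qed.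

Lemma bs_fixed g i h :
  bs_act g (bs_coset i h) = bs_coset i h <-> conjugate h (standard_parabolic (factor i)) g.
Proof.
rewrite bs_act_coset conjugateP; split=> [/esym/bs_cosetP[_]|H]; first by rewrite mulgA.
by apply/esym/bs_cosetP; rewrite mulgA.
Qed.

Definition bs_edge (x y : bs_vertex) : Prop :=
  exists g, x = bs_coset true g /\ y = bs_coset false g.

Lemma bs_act_edge g x y : bs_edge x y -> bs_edge (bs_act g x) (bs_act g y).
Proof. by case=> h [-> ->]; exists (g * h); rewrite !bs_act_coset. Qed.

(** When [a] and [b] are in [Z], this subgraph is the Bass-Serre tree of [A_Z]. *)
Definition bs_subadj Z (x y : bs_vertex) : Prop :=
  exists i g, [/\ standard_parabolic Z g, x = bs_coset i g & y = bs_coset (~~ i) g].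

Definition bs_sub Z (x : bs_vertex) : Prop :=
  exists i g, standard_parabolic Z g /\ x = bs_coset i g.

Lemma bs_subadj_adj Z x y : bs_subadj Z x y -> adjacent bs_edge x y.
Proof. by case=> -[] [g [_ -> ->]]; [left|right]; exists g. Qed.

Lemma bs_subadjC Z x y : bs_subadj Z x y -> bs_subadj Z y x.
Proof. by case=> i [g [Zg -> ->]]; exists (~~ i), g; rewrite negbK. Qed.

Lemma bs_subadj_sub Z x y : bs_subadj Z x y -> bs_sub Z x -> bs_sub Z y.
Proof. by case=> i [g [Zg -> ->]] _; exists (~~ i), g. Qed.

Lemma bs_sub_act Z g x : standard_parabolic Z g -> bs_sub Z x -> bs_sub Z (bs_act g x).
Proof.
move=> Zg [i [h [Zh ->]]]; exists i, (g * h); split; last exact: bs_act_coset.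
exact: standard_parabolicM.
Qed.

Lemma bs_subadj_act Z g x y : standard_parabolic Z g ->
  bs_subadj Z x y -> bs_subadj Z (bs_act g x) (bs_act g y).
Proof.
move=> Zg [i [h [Zh -> ->]]]; exists i, (g * h); rewrite !bs_act_coset; split=> //.
exact: standard_parabolicM.
Qed.

(** By induction on a word in [Z]: each letter lies in one of the two factors, so it moves
    the base vertex by at most two edges, and then the walk for the rest of the word
    can be translated by this letter. *)
Lemma bs_sub_connected Z x y : bs_sub Z x -> bs_sub Z y ->
  exists n, walk (bs_subadj Z) n x y.
Proof.
have flip i g : standard_parabolic Z g -> walk (bs_subadj Z) 1 (bs_coset i g) (bs_coset (~~ i) g).
  by move=> Zg; apply: walk1; exists i, g.
have base g : standard_parabolic Z g ->
    exists n, walk (bs_subadj Z) n (bs_coset true 1) (bs_coset true g).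
  elim/standard_parabolic_letter_ind => [|s e k Zs [n W]]; first by exists 0%N; exact: Walk0.
  have Zse : standard_parabolic Z (artin_letter s e).
    by case: e; rewrite /=; [|apply: standard_parabolicV]; exact: standard_parabolic_gen.
  have := walk_map (fun x y => @bs_subadj_act Z _ x y Zse) W; rewrite !bs_act_coset mulg1.
  have same i : s != (if i then a else b) -> bs_coset i 1 = bs_coset i (artin_letter s e).
    move=> si; apply/bs_cosetP; split=> //; rewrite invg1 mul1g.
    have Fs : standard_parabolic (factor i) (artin_gen s).
      by apply: standard_parabolic_gen; rewrite in_factor.
    by case: e {W Zse} => //=; exact: standard_parabolicV.
  have [Es|sa] := eqVneq s a; last by rewrite -(same true) // => W'; exists n.
  have F : bs_coset false 1 = bs_coset false (artin_letter s e) by apply: same; rewrite Es.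
  move=> W'; have W0 := flip true 1 (@standard_parabolic1 _ Z); rewrite /= F in W0.
  by have := walk_cat (walk_cat W0 (flip false _ Zse)) W'; exists (1 + 1 + n)%N.
have base2 z : bs_sub Z z -> exists n, walk (bs_subadj Z) n (bs_coset true 1) z.
  case=> -[] [g [Zg ->]]; first exact: base.
  have [n W] := base g Zg; exists (n + 1)%N; apply: walk_cat W _; exact: (flip true).
move=> /base2[n Wx] /base2[m Wy]; exists (n + m)%N; apply: walk_cat Wy.
by apply: walk_rev Wx; exact: bs_subadjC.
Qed.

(** The affine action moves the zero function (resp. the indicator of the edge group) along
   the vertices of the first (resp. second) class.  The images of the two ends of an
   edge differ by the indicator of a coset of the edge group, so their values at 1
   differ at the base edge only, and tell its two sides apart. *)
Let side (x : bs_vertex) : bool :=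
  let g := sval (cid (bs_vertexP x)) in
  affine_act g (if bs_type x then fun=> false else edge_group) 1.

Let side_coset i g :
  side (bs_coset i g) = affine_act g (if i then fun=> false else edge_group) 1.
Proof.
rewrite /side; case: cid => h /= /bs_cosetP[_]; rewrite /bs_type /= => Hgh.
have -> : h = g * (g^-1 * h) by rewrite mulVKg.
rewrite affine_actM; congr (affine_act g _ _).
by case: i Hgh => Hgh; [exact: affine_act_left|exact: affine_act_right].
Qed.

Let side_edge g : side (bs_coset true g) != side (bs_coset false g) -> edge_group g^-1.
Proof.
rewrite !side_coset [in X in _ != X]affine_act_affine mulg1.
by case: (affine_act _ _ _); case: (edge_group _).
Qed.

Lemma standard_parabolicT g : standard_parabolic [set: Gamma]%SET g.
Proof.
elim/artin_letter_ind: g => [|s e g IH]; first exact: standard_parabolic1.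
apply: standard_parabolicM => //.
by case: e; rewrite /=; [|apply: standard_parabolicV]; apply: standard_parabolic_gen; rewrite inE.
Qed.

Lemma bs_tree : is_tree bs_edge bs_type.
Proof.
split.
- by move=> x y [g [-> ->]].
- have all_sub z : bs_sub [set: Gamma]%SET z.
    have [g Eg] := bs_vertexP z; exists (bs_type z), g; split=> //.
    exact: standard_parabolicT.
  move=> x y; have [n W] := bs_sub_connected (all_sub x) (all_sub y); exists n.
  by move: (walk_map (f := id) (@bs_subadj_adj _) W).
move=> _ _ [g0 [-> ->]]; exists (fun x => side (bs_act g0^-1 x)); split.
  rewrite !bs_act_coset mulVg !side_coset !affine_act1.
  rewrite /edge_group asboolT //; split; exact: standard_parabolic1.
move=> _ _ [g [-> ->]]; rewrite !bs_act_coset => /side_edge/asboolP.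
by rewrite invgM invgK => -[H1 H2]; split; apply/bs_cosetP.
Qed.

Lemma bs_vertex_on_edge x : exists y, adjacent bs_edge x y.
Proof.
have [g ->] := bs_vertexP x; exists (bs_coset (~~ bs_type x) g).
by case: (bs_type x); [left|right]; exists g.
Qed.

End BassSerre.

(** * Complete parabolic subgroups *)

Section CompleteParabolics.
Variables (R : realType) (Gamma : labeled_graph).
Local Open Scope group_scope.
Local Notation A := (artin_group Gamma).
Implicit Types (g h k : A) (X Y Z : {set Gamma}) (P Q : set A).

Lemma conjugateS g P Q : P `<=` Q -> conjugate g P `<=` conjugate g Q.
Proof. by move=> PQ x; rewrite !conjugateP; exact: PQ. Qed.

Lemma conjugate_standardS k X Y : X \subset Y ->
  conjugate k (standard_parabolic X) `<=` conjugate k (standard_parabolic Y).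
Proof. by move=> XY; apply: conjugateS; exact: standard_parabolicS. Qed.

Lemma complete_conjugate k P : complete_parabolic P -> complete_parabolic (conjugate k P).
Proof. by case=> g [X [fX ->]]; exists (k * g), X; rewrite conjugateM. Qed.

Lemma parabolic_sub X Y g k :
  conjugate g (standard_parabolic Y) `<=` conjugate k (standard_parabolic X) ->
  exists h Y', [/\ standard_parabolic X (k^-1 * h), Y' \subset X, #|Y'| = #|Y|,
    conjugate g (standard_parabolic Y) = conjugate h (standard_parabolic Y')
    & free_of_infinity Y -> free_of_infinity Y'].
Proof.
move=> sub.
have : conjugate (k^-1 * g) (standard_parabolic Y) `<=` standard_parabolic X.
  rewrite -conjugateM -[standard_parabolic X]conjugate1 -(mulVg k) -conjugateM.
  exact: conjugateS.
case/(parabolic_sub_standard R) => h [Y' [Xh Y'X cY' E fY]].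
exists (k * h), Y'; split=> //; first by rewrite mulKg.
by rewrite -[RHS]conjugateM -E conjugateM mulVKg.
Qed.

Lemma parabolic_sub_eq X Y g k : #|X| <= #|Y| ->
  conjugate g (standard_parabolic Y) `<=` conjugate k (standard_parabolic X) ->
  conjugate g (standard_parabolic Y) = conjugate k (standard_parabolic X).
Proof.
move=> cXY /parabolic_sub[h [Y' [Xh Y'X cY' -> _]]].
have -> : Y' = X by apply/eqP; rewrite finset.eqEcard Y'X cY'.
by rewrite -[in RHS](conjugate_standard Xh) conjugateM mulVKg.
Qed.

Lemma not_free Z : ~ free_of_infinity Z -> exists a b,
  [/\ a \in Z, b \in Z, a != b & [set a; b]%SET \notin edges Gamma].
Proof.
move=> nf; apply: contrapT => H; apply: nf => a b aZ bZ ab.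
by apply/negPn/negP => nab; apply: H; exists a, b.
Qed.

Lemma free_factor a b X : [set a; b]%SET \notin edges Gamma -> a != b ->
  free_of_infinity X -> exists i, X \subset factor a b i.
Proof.
move=> nab ab fX.
have [aX|naX] := boolP (a \in X); last first.
  by exists true; apply/fintype.subsetP => x xX; rewrite in_factor; apply: contraNneq naX => <-.
have [bX|nbX] := boolP (b \in X); last first.
  by exists false; apply/fintype.subsetP => x xX; rewrite in_factor; apply: contraNneq nbX => <-.
by rewrite fX in nab.
Qed.

Lemma complete_fixes a b g X i : X \subset factor a b i ->
  forall h, conjugate g (standard_parabolic X) h ->
  bs_act h (bs_coset a b i g) = bs_coset a b i g.
Proof. by move=> Xi h Ph; apply/bs_fixed; exact: conjugate_standardS Xi _ Ph. Qed.

Lemma fixed_in_standard a b Z i y g : standard_parabolic Z y -> standard_parabolic Z g ->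
  bs_act g (bs_coset a b i y) = bs_coset a b i y ->
  conjugate y (standard_parabolic (factor a b i :&: Z)) g.
Proof.
move=> Zy Zg /bs_fixed/conjugateP H; apply/conjugateP; apply: (standard_parabolicI R) => //.
by apply: standard_parabolicM => //; apply: standard_parabolicM => //; exact: standard_parabolicV.
Qed.

Lemma factor_proper a b Z i : a \in Z -> b \in Z -> (#|factor a b i :&: Z| < #|Z|)%N.
Proof.
move=> aZ bZ; apply/proper_card/properP; split; first exact: finset.subsetIr.
by case: i; [exists a|exists b] => //; rewrite finset.in_setI in_factor eqxx.
Qed.

Definition elliptic (F : set A) := forall a b : Gamma,
  [set a; b]%SET \notin edges Gamma -> a != b ->
  exists x : bs_vertex a b, forall g, F g -> bs_act g x = x.

Lemma complete_elliptic P : complete_parabolic P -> elliptic P.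
Proof.
case=> g [X [fX ->]] a b nab ab; have [i Xi] := free_factor nab ab fX.
by exists (bs_coset a b i g); exact: complete_fixes.
Qed.

(** In the tree of a non-edge inside [Y], a fixed vertex projects to the subtree of
    [A_Y], whose vertex stabilizers in [A_Y] are parabolics of smaller rank. *)
Lemma elliptic_complete (F : set A) k Y : elliptic F ->
  F `<=` conjugate k (standard_parabolic Y) ->
  exists Q, [/\ complete_parabolic Q, Q `<=` conjugate k (standard_parabolic Y) & F `<=` Q].
Proof.
move=> eF; have [n] := ubnP #|Y|; elim: n Y k => // n IH Y k lt FY.
have [fY|/not_free[a [b [aY bY ab nab]]]] := EM (free_of_infinity Y).
  by exists (conjugate k (standard_parabolic Y)); split=> //; exists k, Y.
pose F' : A -> Prop := fun h => F (k * h * k^-1).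
have F'Y h : F' h -> standard_parabolic Y h.
  by move=> /FY/conjugateP; rewrite !mulgA mulVg mul1g mulgVK.
have [x Fx] := eF a b nab ab.
have F'x h : F' h -> bs_act h (bs_act k^-1 x) = bs_act k^-1 x.
  by move=> /Fx E; rewrite -bs_actM -[in RHS]E -bs_actM !mulgA mulVg mul1g.
have base : bs_sub Y (bs_coset a b true 1).
  by exists true, 1; split=> //; exact: standard_parabolic1.
have [q [i [y [Yy ->]]] Fq] := fixed_projection (bs_tree nab ab) (@bs_act1 _ a b)
  (@bs_actM _ a b) (@bs_act_edge _ a b) (@bs_subadj_adj _ a b Y) (@bs_subadjC _ a b Y)
  (@bs_subadj_sub _ a b Y) (@bs_sub_connected _ a b ab Y) base
  (fun h z Fh => @bs_sub_act _ a b Y h z (F'Y h Fh)) F'x.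
have FY' : F `<=` conjugate (k * y) (standard_parabolic (factor a b i :&: Y)).
  move=> h Fh; rewrite -conjugateM; apply/conjugateP.
  have F'h : F' (k^-1 * h * k) by rewrite /F' !mulgA mulgV mul1g mulgK.
  by apply: fixed_in_standard => //; [exact: F'Y|exact: Fq].
have [|Q [cQ QY FQ]] := IH _ _ _ FY'; first exact: leq_trans (factor_proper _ aY bY) _.
exists Q; split=> //; apply: subset_trans QY _.
rewrite -conjugateM; apply: conjugateS; rewrite -[X in _ `<=` X](conjugate_standard Yy).
by apply: conjugate_standardS; exact: finset.subsetIr.
Qed.

Hypothesis classB : class_B Gamma.

(** By induction on the size of [Z], which the hypothesis on the class B starts.  If [Z]
    contains a non-edge, [P] and [Q] fix vertices [p] and [q] of its tree.  If [p = q],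
    they lie in the stabilizer of this vertex, of smaller rank.  Otherwise, the
    intersection fixes the next vertex [p1] on the path from [p] to [q], so that [P]
    can be replaced by its intersection with the stabilizer of [p1], and [p] by [p1].
    To see that this intersection is complete parabolic, [elliptic_complete] shrinks
    the stabilizer of the edge to a complete parabolic subgroup, and the induction
    hypothesis applies in the stabilizer of [p]. *)
Lemma completeI Z P Q : complete_parabolic P -> complete_parabolic Q ->
  P `<=` standard_parabolic Z -> Q `<=` standard_parabolic Z -> complete_parabolic (P `&` Q).
Proof.
have [n] := ubnP #|Z|; elim: n Z P Q => // n IH Z P Q ltZ cP cQ PZ QZ.
have inZ P' : complete_parabolic P' -> P' `<=` standard_parabolic Z ->
    exists h X, [/\ standard_parabolic Z h, X \subset Z, P' = conjugate h (standard_parabolic X)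
      & free_of_infinity X].
  case=> g [X [fX ->]]; rewrite -{1}[standard_parabolic Z]conjugate1 => /parabolic_sub.
  case=> h [X' [Zh X'Z _ -> /(_ fX) fX']]; exists h, X'; split=> //.
  by move: Zh; rewrite invg1 mul1g.
have [fZ|/not_free[a [b [aZ bZ ab nab]]]] := EM (free_of_infinity Z).
  have [h [X [Zh XZ EP _]]] := inZ _ cP PZ; have [h' [X' [Zh' XZ' EQ _]]] := inZ _ cQ QZ.
  have [||g [Y [Zg YZ ->]]] := classB fZ (P1 := P) (P2 := Q).
  - by exists h, X.
  - by exists h', X'.
  - exists g, Y; split=> // v w vY wY.
    by apply: fZ; exact: (fintype.subsetP YZ).
(* The same statement inside a vertex stabilizer of the tree, up to conjugation. *)
have IHk k i P' Q' : complete_parabolic P' -> complete_parabolic Q' ->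
    P' `<=` conjugate k (standard_parabolic (factor a b i :&: Z)) ->
    Q' `<=` conjugate k (standard_parabolic (factor a b i :&: Z)) ->
    complete_parabolic (P' `&` Q').
  move=> cP' cQ' /(@conjugateS k^-1) sP /(@conjugateS k^-1) sQ.
  rewrite !conjugateM mulVg conjugate1 in sP sQ.
  have := IH _ _ _ (leq_trans (factor_proper i aZ bZ) ltZ)
    (complete_conjugate k^-1 cP') (complete_conjugate k^-1 cQ') sP sQ.
  by move=> /(complete_conjugate k); rewrite -conjugateI conjugateM mulgV conjugate1.
have vertex P' : complete_parabolic P' -> P' `<=` standard_parabolic Z ->
    exists2 p : bs_vertex a b, bs_sub Z p & forall g, P' g -> bs_act g p = p.
  move=> cP' PZ'; have [h [X [Zh XZ -> fX]]] := inZ _ cP' PZ'.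
  have [i Xi] := free_factor nab ab fX; exists (bs_coset a b i h); last exact: complete_fixes.
  by exists i, h.
have [p Zp Pp] := vertex _ cP PZ; have [q Zq Qq] := vertex _ cQ QZ.
pose T := bs_tree nab ab; have [m] := ubnP (dist T p q).
elim: m p P cP PZ Zp Pp => // m IHm p P cP PZ Zp Pp ltm.
have [Epq|neq] := EM (p = q).
  subst q; case: Zp Pp Qq => i [y [Zy ->]] Pp Qq {Zq ltm}.
  by apply: (IHk y i) => // g Pg; apply: fixed_in_standard => //;
    [exact: PZ|exact: Pp|exact: QZ|exact: Qq].
have [p1 pp1 lt1] := step_toward T neq.
have [l W] := bs_sub_connected ab Zp Zq.
have := subtree_convex (T := T) (@bs_subadj_adj _ a b Z) (@bs_subadjC _ a b Z) W pp1.
rewrite lt1 => /(_ (ltnSn _))[i [y [Zy Ep Ep1]]].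
pose Z'' := factor a b (~~ i) :&: (factor a b i :&: Z).
pose Eg : set A := conjugate y (standard_parabolic Z'').
have ePE : elliptic (P `&` Eg).
  move=> a' b' nab' ab'; have [x Px] := complete_elliptic cP nab' ab'.
  by exists x => g [Pg _]; exact: Px.
have [E' [cE' E'E PE]] := elliptic_complete ePE (@subIsetr _ P Eg).
have EgS j : Eg `<=` conjugate y (standard_parabolic (factor a b j :&: Z)).
  apply: conjugate_standardS; rewrite /Z''; case: (i) j => -[]; apply/fintype.subsetP => x;
    by rewrite !finset.in_setI /= => /and3P[F1 F2 Zx]; rewrite ?F1 ?F2 Zx.
have cP' : complete_parabolic (P `&` E').
  apply: (IHk y i) => //; last exact: subset_trans E'E (EgS i).
  move=> g Pg; apply: fixed_in_standard => //; [exact: PZ|].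
  by rewrite -Ep; exact: Pp.
have -> : P `&` Q = (P `&` E') `&` Q.
  apply/seteqP; split=> g [Pg]; last by case: Pg => Pg _ Qg.
  move=> Qg; split=> //; split=> //; apply: PE; split=> //.
  have gp1 := fixed_toward (T := T) (@bs_act1 _ a b) (@bs_actM _ a b)
    (@bs_act_edge _ a b) (Pp g Pg) (Qq g Qg) pp1.
  have {}gp1 : bs_act g p1 = p1 by apply: gp1; rewrite lt1.
  have Zg := PZ g Pg; apply/conjugateP; apply: (standard_parabolicI R).
    by apply/conjugateP/bs_fixed; rewrite -Ep1.
  by apply/conjugateP; apply: fixed_in_standard => //; rewrite -Ep; exact: Pp.
apply: (IHm p1) => //.
- by move=> g [/PZ].
- by exists (~~ i), y.
- move=> g [_ /E'E Eg']; rewrite Ep1; apply/bs_fixed.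
  by move: Eg'; apply: conjugate_standardS; exact: finset.subsetIl.
- by move: ltm; rewrite lt1.
Qed.

Lemma complete_setI P Q : complete_parabolic P -> complete_parabolic Q ->
  complete_parabolic (P `&` Q).
Proof.
by move=> cP cQ; apply: (@completeI [set: Gamma]%SET) => // g _; exact: standard_parabolicT.
Qed.

(** Take a finite subset whose smallest complete parabolic subgroup has maximal rank [n].
    Adding an element of [H] to it does not increase this rank, so a complete
    parabolic subgroup of rank at most [n] contains both.  It equals the first one, since
    their intersection is complete parabolic and has rank at least [n]. *)
Lemma locally_complete (H : set A) :
  (forall F : seq A, (forall g, g \in F -> H g) ->
    exists2 P, complete_parabolic P & forall g, g \in F -> P g) ->
  exists P, complete_parabolic P /\ H `<=` P.
Proof.
move=> locH.
pose S n := `[< exists F : seq A, (forall g, g \in F -> H g) /\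
  forall g X, free_of_infinity X ->
    (forall h, h \in F -> conjugate g (standard_parabolic X) h) -> (n <= #|X|)%N >].
have exS : exists n, S n by exists 0%N; apply/asboolP; exists [::].
have boundS n : S n -> (n <= #|Gamma|)%N.
  move=> /asboolP[F [FH minF]]; have [_ [g [X [fX ->]]] FP] := locH F FH.
  exact: leq_trans (minF g X fX FP) (max_card _).
case: (ex_maxnP exS boundS) => n /asboolP[F [FH minF]] maxn.
have small (F' : seq A) : (forall g, g \in F' -> H g) -> exists g X, [/\ free_of_infinity X,
    (forall h, h \in F' -> conjugate g (standard_parabolic X) h) & (#|X| <= n)%N].
  move=> F'H; apply: contrapT => no.
  suff /maxn : S n.+1 by rewrite ltnn.
  apply/asboolP; exists F'; split=> // g X fX F'X; rewrite ltnNge; apply/negP => le.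
  by apply: no; exists g, X.
have [g0 [X0 [fX0 FX0 le0]]] := small F FH.
have contain g X : free_of_infinity X -> (#|X| <= n)%N ->
    (forall h, h \in F -> conjugate g (standard_parabolic X) h) ->
    conjugate g (standard_parabolic X) `<=` conjugate g0 (standard_parabolic X0).
  move=> fX leX FX; have cPQ := complete_setI (ex_intro _ g (ex_intro _ X (conj fX erefl)))
    (ex_intro _ g0 (ex_intro _ X0 (conj fX0 erefl))).
  case: cPQ => g2 [X2 [fX2 E2]].
  have le2 : (#|X| <= #|X2|)%N.
    apply: leq_trans leX _; apply: (minF g2) => // h Fh; rewrite -E2.
    by split; [exact: FX|exact: FX0].
  have := parabolic_sub_eq (g := g2) (k := g) le2; rewrite -E2 => <-.
    by move=> x [].
  by move=> x [].
exists (conjugate g0 (standard_parabolic X0)); split; first by exists g0, X0.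
move=> h Hh; have [|g [X [fX hFX leX]]] := small (h :: F).
  by move=> k; rewrite inE => /orP[/eqP->//|/FH].
apply: (contain g X fX leX) => [k Fk|]; apply: hFX; first by rewrite inE Fk orbT.
by rewrite inE eqxx.
Qed.

Lemma FC'_elliptic (H : subgroup A) (F : seq A) : FC'_group R (subgroup_type H) ->
  (forall g, g \in F -> subgroup_set H g) -> elliptic [set g | g \in F].
Proof.
move=> fcH FH a b nab ab; have [H1 HM HV] := (is_subgroupP _).1 (subgroupP H).
suff Hfix g : subgroup_set H g -> exists x : bs_vertex a b, bs_act g x = x.
  exact: (serre (bs_tree nab ab) (@bs_act1 _ a b) (@bs_actM _ a b)
    (@bs_act_edge _ a b) (bs_coset a b true 1) HM Hfix FH).
move=> Hg; have Hg' : g \in [pred y | y \in subgroup_set H] by exact/mem_set.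
pose act (h : subgroup_type H) (x : bs_vertex a b) := bs_act (val h) x.
have act1 x : act 1 x = x by rewrite /act val1 bs_act1.
have actM (h k : subgroup_type H) x : act (h * k) x = act h (act k x) by rewrite /act valM bs_actM.
have actE (h : subgroup_type H) x y : bs_edge x y -> bs_edge (act h x) (act h y) by exact: bs_act_edge.
have [x fx] := FC'_fixes_vertex (bs_tree nab ab) (bs_coset a b true 1)
  (@bs_vertex_on_edge _ a b) act1 actM actE fcH (exist _ g Hg').
by exists x.
Qed.

End CompleteParabolics.

Theorem proposition1p8 (R : realType) (Gamma : labeled_graph)
    (H : subgroup (artin_group Gamma)) :
  class_B Gamma -> FC'_group R (subgroup_type H) ->
  exists P : set (artin_group Gamma), complete_parabolic P /\ H `<=` P.
Proof.
move=> classB fcH; apply: (locally_complete R classB) => F FH.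
have [|P [cP _ FP]] := elliptic_complete R (k := 1%g) (Y := [set: Gamma]%SET) (FC'_elliptic fcH FH).
  by move=> g _; rewrite conjugate1; exact: standard_parabolicT.
by exists P.
Qed.
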